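(* Let $S\subset C(\mathbf{k})$ be finite and let $F,G\in\mathbf{k}[x_1,x_2]$ be nonconstant coprime polynomials. For any $\epsilon>0$ there exist an integer $m$ and a constant $c$, depending only on $\epsilon$ (for the given $F,G$), such that for all pairs $(g_1,g_2)\in(\mathcal{O}_S^* )^2$ with $\max\{h(g_1),h(g_2)\}\ge c\max\{1,2\mathfrak g-2+|S|\}$, either $g_1^{m_1}g_2^{m_2}\in\mathbf{k}$ for some integers $m_1,m_2$, not both zero, with $|m_1|+|m_2|\le 2m$, or both of the following hold: (a) $N_{S,\gcd}(F(g_1,g_2),G(g_1,g_2))\le\epsilon\max\{h(g_1),h(g_2)\}$; (b) if moreover not both $F$ and $G$ vanish at $(0,0)$, then $h_{\gcd}(F(g_1,g_2),G(g_1,g_2))\le\epsilon\max\{h(g_1),h(g_2)\}$.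
   Context: $\mathbf{k}$ is an algebraically closed field of characteristic zero, $C$ a smooth projective curve over $\mathbf{k}$ of genus $\mathfrak g$, $K=\mathbf{k}(C)$; $v_{\mathfrak p}$ is the order-of-vanishing valuation at $\mathfrak p\in C(\mathbf{k})$. $\mathcal{O}_S^*=\{f\in K^*: v_{\mathfrak p}(f)=0\ \forall\mathfrak p\notin S\}$. For $f\in K^*$: $v^0_{\mathfrak p}(f)=\max\{0,v_{\mathfrak p}(f)\}$, $h(f)=\sum_{\mathfrak p}\max\{0,-v_{\mathfrak p}(f)\}$. For $f,g\in K$: $N_{S,\gcd}(f,g)=\sum_{\mathfrak p\notin S}\min\{v^0_{\mathfrak p}(f),v^0_{\mathfrak p}(g)\}$, $h_{\gcd}(f,g)=\sum_{\mathfrak p\in C}\min\{v^0_{\mathfrak p}(f),v^0_{\mathfrak p}(g)\}$. *)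

(* Defs.v *)
From HB Require Import structures.
From mathcomp Require Import all_boot all_order all_algebra.
From mathcomp Require Import boolp classical_sets cardinality fsbigop reals.
Set Implicit Arguments.
Unset Strict Implicit.
Unset Printing Implicit Defensive.
Import Order.TTheory GRing.Theory Num.Theory.
Local Open Scope ring_scope.

(* A curve C over k is given through its function field K = k(C): a field   *)
(* K with an embedding iota : k -> K such that K is a finite extension of   *)
(* k(t) for some t transcendental over k.                                   *)

Section FunctionField.
Variables (k : closedFieldType) (K : fieldType) (iota : {rmorphism k -> K}).

Definition polyK (p : {poly k}) (t : K) : K := (map_poly iota p).[t].

Definition is_function_field : Prop :=
  exists t : K,
    (forall p : {poly k}, polyK p t = 0 -> p = 0) /\
    exists (n : nat) (e : 'I_n -> K),
      forall x : K, exists (q : {poly k}) (a : 'I_n -> {poly k}),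
        q != 0 /\ polyK q t * x = \sum_(i < n) polyK (a i) t * e i.

(* A point p of C(k) = a normalized discrete valuation v_p of K trivial on  *)
(* k (all such places have degree one since k is algebraically closed).    *)
(* Convention: v 0 = 0 (the value at 0 is never used as a valuation).       *)
Definition is_place (v : K -> int) : Prop :=
  [/\ v 0 = 0,
      forall x y, x != 0 -> y != 0 -> v (x * y) = v x + v y,
      forall x y, x != 0 -> y != 0 -> x + y != 0 ->
        Num.min (v x) (v y) <= v (x + y),
      forall c : k, c != 0 -> v (iota c) = 0
    & exists t, v t = 1].

Definition place : Type := {classic {v : K -> int | is_place v}}.

Definition vp (p : place) (x : K) : int := proj1_sig p x.

Definition psum (f : place -> nat) : nat :=
  (\big[addn/0%N]_(p \in [set: place]) f p)%N.

Definition v0 (p : place) (x : K) : nat := absz (Num.max (0:int) (vp p x)).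

Definition hgt (x : K) : nat := psum (fun p => absz (Num.max (0:int) (- vp p x))).

Definition in_OS (S : seq place) (x : K) : Prop :=
  x != 0 /\ forall p : place, p \notin S -> vp p x = 0.

(* min{v^0_p(f), v^0_p(g)}, with v^0_p(0) = +oo; only used when (f,g)<>(0,0) *)
Definition gcd_term (p : place) (f g : K) : nat :=
  if f == 0 then v0 p g else if g == 0 then v0 p f else minn (v0 p f) (v0 p g).

(* "N_{S,gcd}(f,g) <= B".  When f = g = 0 the quantity is +oo, so the       *)
(* inequality fails; otherwise the sum is finite.                           *)
Definition NSgcd_le (R : realType) (S : seq place) (f g : K) (B : R) : Prop :=
  ~~ ((f == 0) && (g == 0)) /\
  ((psum (fun p => if p \in S then 0%N else gcd_term p f g))%:R <= B).

Definition hgcd_le (R : realType) (f g : K) (B : R) : Prop :=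
  ~~ ((f == 0) && (g == 0)) /\ ((psum (fun p => gcd_term p f g))%:R <= B).

(* Genus, via Riemann's theorem: g = max_D (deg D - l(D) + 1). *)
Definition divisor_fin (D : place -> int) : Prop :=
  finite_set [set p : place | D p != 0].

Definition deg (D : place -> int) : int :=
  \big[+%R/0]_(p \in [set: place]) D p.

Definition inL (D : place -> int) (x : K) : Prop :=
  x = 0 \/ forall p : place, 0 <= vp p x + D p.

Definition k_indep (n : nat) (f : 'I_n -> K) : Prop :=
  forall c : 'I_n -> k, \sum_(i < n) iota (c i) * f i = 0 -> forall i, c i = 0.

Definition dimL (D : place -> int) (n : nat) : Prop :=
  (exists f : 'I_n -> K, (forall i, inL D (f i)) /\ k_indep f) /\
  ~ (exists f : 'I_n.+1 -> K, (forall i, inL D (f i)) /\ k_indep f).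

Definition is_genus (gen : nat) : Prop :=
  (forall D n, divisor_fin D -> dimL D n -> deg D - n%:Z + 1 <= gen%:Z) /\
  (exists D n, divisor_fin D /\ dimL D n /\ deg D - n%:Z + 1 = gen%:Z).

End FunctionField.

(* Bivariate polynomials k[x1,x2] as {poly {poly k}}: outer variable x2,    *)
(* inner variable x1.                                                       *)

Definition eval2 (k : closedFieldType) (K : fieldType) (iota : {rmorphism k -> K})
  (F : {poly {poly k}}) (a b : K) : K :=
  (map_poly (map_poly iota) F).[b%:P].[a].

Definition eval2k (k : closedFieldType) (F : {poly {poly k}}) (a b : k) : k :=
  F.[b%:P].[a].

Definition nonconstant2 (k : closedFieldType) (F : {poly {poly k}}) : Prop :=
  ~ exists c : k, F = c%:P%:P.

Definition coprime2 (k : closedFieldType) (F G : {poly {poly k}}) : Prop :=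
  forall D Q1 Q2 : {poly {poly k}}, F = D * Q1 -> G = D * Q2 ->
    exists c : k, c != 0 /\ D = c%:P%:P.

(* Main.v *)
(* Eliminating either variable from F and G bounds the local gcd of F(g1, g2) and G(g1, g2),
   up to the zeros and poles of g1 and g2 (which lie in S), by the minima of v(g1 - a) and
   v(g2 - b) for finitely many nonzero constants a, b.  For n large, look at the n^2 monomials
   g1^i g2^j with i, j < n.  If they are linearly independent over k, compare the Wronskian of
   the functions (g1/a)^i (g2/b)^j - 1, all divisible by the common zeros, with the degree
   2g - 2 of a differential: the gcd is at most about 2 h / n.  The same method bounds the
   vanishing along S of a polynomial with nonzero constant term.  If they are dependent, a
   minimal relation and the Wronskian produce a monomial z = g1^a g2^b of height
   O(max(1, 2g - 2 + |S|)); when z is not constant, it controls everything directly, since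
   g1 = c, g2 = d at a point forces z = c^a d^b there.

   The product formula follows from the definition of the genus applied to the multiples of a
   principal divisor.  That some differential has degree at most 2g - 2 follows from the
   Weierstrass gap theorem: the functions with poles only at p form a free k[f]-module, with
   a basis of known pole orders, and the discriminant of its trace form bounds the
   ramification of f. *)
Require Import Defs.
From HB Require Import structures.
From mathcomp Require Import all_boot all_order all_algebra perm.
From mathcomp Require Import zify ring lra.
From mathcomp Require Import boolp classical_sets cardinality fsbigop reals.
Set Implicit Arguments.
Unset Strict Implicit.
Unset Printing Implicit Defensive.
Import Order.TTheory GRing.Theory Num.Theory.
Local Open Scope ring_scope.

(** * Valuations at places *)

Section Valuation.
Variables (k : closedFieldType) (K : fieldType) (iota : {rmorphism k -> K}).
Implicit Types (q : place iota) (x y z : K).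

(** The constants may depend on [F], [G] and [eps] only, so every estimate has to be uniform in the
    curve, the genus and [S]. Polynomials therefore enter through their sizes and roots, and all
    exponents stay in a box whose side is fixed before the curve. With n^2 monomials, subtracting 1
    leaves n^2 - 1 functions that vanish to the order mu of the common zero. The Wronskian gains
    (n^2 - 1) mu and loses at most (n - 1)(h(g1) + h(g2)) along [S]; as n^2 - 1 = (n - 1)(n + 1),
    the quotient is 2 h / (n + 1). Every multiple of max(1, 2g - 2 + |S|) is absorbed by the choice
    of [c]. A differential is encoded by one derivation [D] of K together with the factors that turn
    [D] into d/dt at each place. The genus enters through the inequality deg D - l(D) + 1 <= gen.
    For [f] with a single pole, of order e + 1 at p, the gaps bound the total ramification off p by
    e + 2g, and df has order -(e + 2) at p; the difference is 2g - 2. *)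

Lemma vp_place q : is_place iota (vp q).
Proof. by rewrite /vp; case: q. Qed.

Lemma place_inj q q' : vp q =1 vp q' -> q = q'.
Proof.
move=> e; case: q q' e => v pv [v' pv'] /= e.
have ev : v = v' by apply/funext => x; apply: e.
by subst v'; congr exist; apply: Prop_irrelevance.
Qed.

Lemma vp0 q : vp q 0 = 0. Proof. by case: (vp_place q). Qed.

Lemma vpM q x y : x != 0 -> y != 0 -> vp q (x * y) = vp q x + vp q y.
Proof. by case: (vp_place q) => _ h _ _ _; apply: h. Qed.

Lemma vp_iota q (c : k) : vp q (iota c) = 0.
Proof.
have [->|c0] := eqVneq c 0; first by rewrite rmorph0 vp0.
by case: (vp_place q) => _ _ _ h _; apply: h.
Qed.

Lemma vp1 q : vp q 1 = 0.
Proof. by rewrite -(rmorph1 iota) vp_iota. Qed.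

Lemma vpN q x : vp q (- x) = vp q x.
Proof.
have [->|x0] := eqVneq x 0; first by rewrite oppr0.
have -> : - x = iota (-1) * x by rewrite rmorphN1 mulN1r.
by rewrite vpM ?vp_iota ?add0r // fmorph_eq0 oppr_eq0 oner_eq0.
Qed.

Lemma vpV q x : vp q x^-1 = - vp q x.
Proof.
have [->|x0] := eqVneq x 0; first by rewrite invr0 vp0 oppr0.
have := vp1 q; rewrite -(mulVf x0) vpM ?invr_eq0 //; lia.
Qed.

Lemma vpX q x n : vp q (x ^+ n) = vp q x *+ n.
Proof.
have [->|x0] := eqVneq x 0.
  by case: n => [|n]; rewrite ?expr0 ?mulr0n ?vp1 // exprS mul0r vp0 mul0rn.
elim: n => [|n IH]; first by rewrite expr0 vp1 mulr0n.
by rewrite exprS vpM ?expf_neq0 // IH mulrS.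
Qed.

Lemma vpXz q x (n : int) : vp q (x ^ n) = vp q x * n.
Proof.
case: n => n; first by rewrite /exprz vpX -mulr_natr natz.
by rewrite NegzE -exprnN vpV vpX -mulr_natr natz mulrN.
Qed.

Definition vge q x (n : int) : Prop := x = 0 \/ n <= vp q x.

Lemma vge_vp q x : vge q x (vp q x). Proof. by right. Qed.

Lemma vgeE q x n : x != 0 -> vge q x n -> n <= vp q x.
Proof. by move=> /eqP x0 []. Qed.

Lemma vge0 q n : vge q 0 n. Proof. by left. Qed.

Lemma vge_iota q c : vge q (iota c) 0.
Proof. by right; rewrite vp_iota. Qed.

Lemma vge_one q : vge q 1 0.
Proof. by right; rewrite vp1. Qed.

Lemma vge_le q x m n : m <= n -> vge q x n -> vge q x m.
Proof. by move=> mn [->|h]; [left|right; apply: le_trans h]. Qed.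

Lemma vgeM q x y m n : vge q x m -> vge q y n -> vge q (x * y) (m + n).
Proof.
have [->|x0] := eqVneq x 0; first by rewrite mul0r; left.
have [->|y0] := eqVneq y 0; first by rewrite mulr0; left.
by move=> /(vgeE x0) hx /(vgeE y0) hy; right; rewrite vpM // lerD.
Qed.

Lemma vgeMl q x y n : vge q x 0 -> vge q y n -> vge q (x * y) n.
Proof. by move=> hx hy; rewrite -[n]add0r; apply: vgeM. Qed.

Lemma vgeMr q x y n : vge q x n -> vge q y 0 -> vge q (x * y) n.
Proof. by move=> hx hy; rewrite -[n]addr0; apply: vgeM. Qed.

Lemma vgeN q x n : vge q x n -> vge q (- x) n.
Proof. by case=> [->|h]; [left; rewrite oppr0|right; rewrite vpN]. Qed.

Lemma vgeD q x y n : vge q x n -> vge q y n -> vge q (x + y) n.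
Proof.
have [->|x0] := eqVneq x 0; first by rewrite add0r.
have [->|y0] := eqVneq y 0; first by rewrite addr0.
have [->|xy0] := eqVneq (x + y) 0; first by left.
move=> /(vgeE x0) hx /(vgeE y0) hy; right.
case: (vp_place q) => _ _ h _ _; apply: le_trans (h _ _ x0 y0 xy0).
by rewrite le_min hx.
Qed.

Lemma vgeB q x y n : vge q x n -> vge q y n -> vge q (x - y) n.
Proof. by move=> hx hy; apply: vgeD => //; apply: vgeN. Qed.

Lemma vge_sum q (I : Type) (r : seq I) (P : pred I) (F : I -> K) n :
  (forall i, P i -> vge q (F i) n) -> vge q (\sum_(i <- r | P i) F i) n.
Proof.
move=> h; elim/big_ind: _ => //; [exact: vge0|by move=> *; apply: vgeD].
Qed.

Lemma vge_prod q (I : Type) (r : seq I) (P : pred I) (F : I -> K) (n : I -> int) :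
  (forall i, P i -> vge q (F i) (n i)) ->
  vge q (\prod_(i <- r | P i) F i) (\sum_(i <- r | P i) n i).
Proof.
move=> h; elim/big_rec2: _ => [|i y1 y2 Pi IH]; first exact: vge_one.
by apply: vgeM => //; apply: h.
Qed.

Lemma vgeX q x m n : vge q x m -> vge q (x ^+ n) (m *+ n).
Proof.
move=> h; elim: n => [|n IH]; first by rewrite expr0; apply: vge_one.
by rewrite exprS mulrS; apply: vgeM.
Qed.

Lemma vgeX0 q x n : vge q x 0 -> vge q (x ^+ n) 0.
Proof. by move=> h; have := vgeX n h; rewrite mul0rn. Qed.

Lemma vge_nat q x : (forall n : nat, vge q x n%:Z) -> x = 0.
Proof.
move=> h; apply/eqP; apply/negPn/negP => x0.
have := vgeE x0 (h (absz (vp q x)).+1); lia.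
Qed.

Lemma vpD_lt q x y : x != 0 -> vge q y (vp q x + 1) ->
  x + y != 0 /\ vp q (x + y) = vp q x.
Proof.
move=> x0 hy; have xy0 : x + y != 0.
  apply/eqP => e; have ex : x = - y by rewrite -[x]addr0 -(subrr y) addrA e sub0r.
  have : vge q x (vp q x + 1) by rewrite {1}ex; apply: vgeN.
  by move/(vgeE x0); lia.
split=> //; apply/eqP; rewrite eq_le; apply/andP; split; last first.
  apply: (vgeE xy0); apply: vgeD; first exact: vge_vp.
  by apply: vge_le hy; lia.
rewrite leNgt; apply/negP => hlt.
have : vge q (x + y - y) (vp q x + 1).
  by apply: vgeB => //; right; rewrite lezD1.
by rewrite addrK => /(vgeE x0); lia.
Qed.

(** The nonzero terms have pairwise different values, so the one of least value dominates and the
    sum is nonzero of that value. *)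
Lemma vp_sum_distinct q (I : finType) (F : I -> K) (i0 : I) :
  (forall i j, F i != 0 -> F j != 0 -> vp q (F i) = vp q (F j) -> i = j) ->
  F i0 != 0 ->
  \sum_i F i != 0 /\ vp q (\sum_i F i) <= vp q (F i0).
Proof.
move=> inj F0.
case: (@arg_minP _ _ _ i0 (fun i => F i != 0) (fun i => vp q (F i)) F0) => j Fj hj.
rewrite (bigD1 j) //=.
have [h1 h2] : F j + \sum_(i | i != j) F i != 0 /\
    vp q (F j + \sum_(i | i != j) F i) = vp q (F j).
  apply: vpD_lt => //; apply: vge_sum => i ij.
  have [->|Fi] := eqVneq (F i) 0; first exact: vge0.
  right; have := hj i Fi; rewrite lezD1 lt_neqAle => ->; rewrite andbT.
  by apply: contra ij => /eqP e; apply/eqP; apply: inj.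
by split=> //; rewrite h2; apply: hj.
Qed.

Lemma uniformizer q : exists t, vp q t = 1.
Proof. by case: (vp_place q). Qed.

Lemma vp_neq0 q x : vp q x != 0 -> x != 0.
Proof. by apply: contraNneq => ->; rewrite vp0. Qed.

End Valuation.

(** The relation is wanted with coefficients in the domain itself, so the family is padded by zero
    columns to a square matrix, whose determinant vanishes. *)
Lemma lindep (R : idomainType) (I J : finType) (a : I -> J -> R) :
  (#|J| < #|I|)%N ->
  exists c : I -> R, (exists i, c i != 0) /\ forall j, \sum_i c i * a i j = 0.
Proof.
move=> hIJ.
pose A : 'M[R]_#|I| := \matrix_(i, j)
  (if insub (j : nat) is Some j' then a (enum_val i) (enum_val (j' : 'I_#|J|)) else 0).
have dA : \det A = 0.
  rewrite (expand_det_col _ (Ordinal hIJ)) big1 // => i _.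
  by rewrite mxE insubF /= ?ltnn // mul0r.
case/eqP/det0P: dA => v v0 hv.
exists (fun i => v 0 (enum_rank i)); split.
  have [i vi] : exists i, v 0 i != 0.
    apply/existsP; apply: contraNT v0; rewrite negb_exists => /forallP h.
    by apply/eqP/rowP => i; rewrite mxE; apply/eqP; move: (h i); rewrite negbK.
  by exists (enum_val i); rewrite enum_valK.
move=> j; pose j' : 'I_#|I| := widen_ord (ltnW hIJ) (enum_rank j).
have := congr1 (fun M : 'rV_#|I| => M 0 j') hv; rewrite !mxE => e; rewrite -[RHS]e.
rewrite [RHS](reindex (@enum_rank I)) /=; last first.
  by exists enum_val => i _; rewrite ?enum_rankK ?enum_valK.
by apply: eq_bigr => i _; rewrite !mxE /= valK !enum_rankK.
Qed.

(** * Evaluation of polynomials and algebraic dependence in a function field *)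

Section FunctionField.
Variables (k : closedFieldType) (K : fieldType) (iota : {rmorphism k -> K}).
Implicit Types (x y z : K) (p r : {poly k}) (P Q : {poly {poly k}}).
Local Notation "p @ x" := (polyK iota p x) (at level 35).
Local Notation ev2 := (eval2 iota).

Lemma polyKD p r x : (p + r) @ x = p @ x + r @ x.
Proof. by rewrite /polyK rmorphD hornerD. Qed.
Lemma polyKN p x : (- p) @ x = - (p @ x).
Proof. by rewrite /polyK rmorphN hornerN. Qed.
Lemma polyKB p r x : (p - r) @ x = p @ x - r @ x.
Proof. by rewrite polyKD polyKN. Qed.
Lemma polyKM p r x : (p * r) @ x = p @ x * r @ x.
Proof. by rewrite /polyK rmorphM hornerM. Qed.
Lemma polyKC c x : c%:P @ x = iota c.
Proof. by rewrite /polyK map_polyC hornerC. Qed.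
Lemma polyK0 x : 0 @ x = 0.
Proof. by rewrite /polyK rmorph0 horner0. Qed.
Lemma polyK1 x : 1 @ x = 1.
Proof. by rewrite /polyK rmorph1 hornerC. Qed.
Lemma polyKX x : 'X @ x = x.
Proof. by rewrite /polyK map_polyX hornerX. Qed.
Lemma polyKXn p x n : (p ^+ n) @ x = (p @ x) ^+ n.
Proof. by rewrite /polyK rmorphXn horner_exp. Qed.

Lemma polyK_sum (I : Type) (s : seq I) (P : pred I) (F : I -> {poly k}) x :
  (\sum_(i <- s | P i) F i) @ x = \sum_(i <- s | P i) F i @ x.
Proof. by apply: (big_morph (polyK iota ^~ x)); [move=> *; apply: polyKD|apply: polyK0]. Qed.

Lemma polyK_prod (I : Type) (s : seq I) (P : pred I) (F : I -> {poly k}) x :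
  (\prod_(i <- s | P i) F i) @ x = \prod_(i <- s | P i) F i @ x.
Proof. by apply: (big_morph (polyK iota ^~ x)); [move=> *; apply: polyKM|apply: polyK1]. Qed.

Lemma polyK_coef p x n : (size p <= n)%N -> p @ x = \sum_(i < n) iota p`_i * x ^+ i.
Proof.
move=> hn; rewrite /polyK (horner_coef_wide (n := n)).
  by apply: eq_bigr => i _; rewrite coef_map.
by rewrite size_map_poly.
Qed.

Lemma ev2D P Q x y : ev2 (P + Q) x y = ev2 P x y + ev2 Q x y.
Proof. by rewrite /eval2 rmorphD !hornerD. Qed.
Lemma ev2M P Q x y : ev2 (P * Q) x y = ev2 P x y * ev2 Q x y.
Proof. by rewrite /eval2 rmorphM !hornerM. Qed.
Lemma ev20 x y : ev2 0 x y = 0.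
Proof. by rewrite /eval2 rmorph0 !horner0. Qed.
Lemma ev2C p x y : ev2 p%:P x y = p @ x.
Proof. by rewrite /eval2 map_polyC hornerC. Qed.
Lemma ev2X x y : ev2 'X x y = y.
Proof. by rewrite /eval2 map_polyX hornerX hornerC. Qed.
Lemma ev2Xn x y n : ev2 'X^n x y = y ^+ n.
Proof. by elim: n => [|n IH]; rewrite ?expr0 ?ev2C ?polyK1 // !exprS ev2M ev2X IH. Qed.
Lemma ev2Z p Q x y : ev2 (p *: Q) x y = p @ x * ev2 Q x y.
Proof. by rewrite -mul_polyC ev2M ev2C. Qed.
Lemma ev2_sum (I : Type) (s : seq I) (P : pred I) (F : I -> {poly {poly k}}) x y :
  ev2 (\sum_(i <- s | P i) F i) x y = \sum_(i <- s | P i) ev2 (F i) x y.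
Proof. by apply: (big_morph (fun P => ev2 P x y)); [move=> *; apply: ev2D|apply: ev20]. Qed.

Lemma ev2_coef P x y n :
  (size P <= n)%N -> ev2 P x y = \sum_(i < n) P`_i @ x * y ^+ i.
Proof.
move=> hn; have {1}-> : P = \sum_(i < n) P`_i *: 'X^i.
  rewrite -[LHS]coefK poly_def.
  rewrite (big_ord_widen n (fun i => P`_i *: 'X^i)) // big_mkcond.
  apply: eq_bigr => i _; case: ltnP => // h.
  by rewrite nth_default // scale0r.
by rewrite ev2_sum; apply: eq_bigr => i _; rewrite ev2Z ev2Xn.
Qed.

Lemma ev2_swap P x y : ev2 (swapXY P) x y = ev2 P y x.
Proof. by rewrite /eval2 -swapXY_map horner2_swapXY. Qed.

Lemma ev2_map_polyC p x y : ev2 (map_poly polyC p) x y = p @ y.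
Proof. by rewrite -(swapXY_polyC p) ev2_swap ev2C. Qed.

Definition transc x : Prop := forall p, p @ x = 0 -> p = 0.

(** Over an algebraically closed field a relation splits into factors x - c, so an algebraic element
    is a constant. *)
Lemma notconst_transc x : (forall c, x <> iota c) -> transc x.
Proof.
move=> hx p hp; apply/eqP; apply/negPn/negP => p0.
have [rs ers] := closed_field_poly_normal p.
move: hp; rewrite ers -mul_polyC polyKM polyKC polyK_prod => /eqP.
rewrite mulf_eq0 fmorph_eq0 lead_coef_eq0 (negbTE p0) /=.
rewrite prodf_seq_eq0 => /hasP [c _] /=.
by rewrite polyKB polyKX polyKC subr_eq0 => /eqP /hx.
Qed.

Lemma transc_notconst x : transc x -> forall c, x <> iota c.
Proof.
move=> tx c e; have := tx ('X - c%:P); rewrite polyKB polyKX polyKC e subrr.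
by move=> /(_ erefl) /eqP; rewrite polyXsubC_eq0.
Qed.

Definition dependent_over x (I : finType) (z : I -> K) : Prop :=
  exists a : I -> {poly k}, (exists i, a i != 0) /\ \sum_i a i @ x * z i = 0.

Hypothesis hK : is_function_field iota.

Lemma transc_algebraic_aux t x : transc x ->
  (exists P : {poly {poly k}}, P != 0 /\ ev2 P t x = 0) ->
  exists Q, [/\ Q != 0, ev2 Q x t = 0 & (1 < size Q)%N].
Proof.
move=> tx [P [P0 hP]]; exists (swapXY P); split.
- by rewrite swapXY_eq0.
- by rewrite ev2_swap.
rewrite ltnNge; apply/negP => h.
have hS : ev2 (swapXY P) x t = 0 by rewrite ev2_swap.
have e := size1_polyC h; move: hS; rewrite e ev2C => /tx e0.
by move: e; rewrite e0 polyC0 => /eqP; rewrite swapXY_eq0 (negbTE P0).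
Qed.

(** Finiteness over the given k(t) transfers to every transcendental [x]: [t] satisfies an equation
    [Q] of degree m over k(x), so the products t^l e_j with l < m span K over k(x). *)
Lemma fin_over x : transc x ->
  exists N, forall I : finType, (N < #|I|)%N -> forall z : I -> K, dependent_over x z.
Proof.
case: hK => t [tt [n [e he]]] tx.
have common (I : finType) (z : I -> K) : exists q (a : I -> 'I_n -> {poly k}),
    q != 0 /\ forall i, q @ t * z i = \sum_j a i j @ t * e j.
  have /choice[q hq] : forall i, exists q, exists a : 'I_n -> {poly k},
      q != 0 /\ q @ t * z i = \sum_j a j @ t * e j by move=> i; apply: he.
  have /choice[a ha] := hq.
  exists (\prod_i q i), (fun i j => (\prod_(l | l != i) q l) * a i j); split.
    by apply/prodf_neq0 => i _; case: (ha i).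
  move=> i; rewrite (bigD1 i) //= polyKM mulrAC mulrC (proj2 (ha i)) mulr_sumr.
  by apply: eq_bigr => j _; rewrite polyKM mulrA.
have [Q [Q0 hQ sQ]] : exists Q, [/\ Q != 0, ev2 Q x t = 0 & (1 < size Q)%N].
  apply: transc_algebraic_aux => //.
  have [q [a [q0 ha]]] := common _ (fun i : 'I_n.+1 => x ^+ i).
  have [|c [[i ci] hc]] := lindep (fun i j => a i j); first by rewrite !card_ord.
  exists (q%:P * \poly_(i < n.+1) c (inord i)); split.
    rewrite mulf_neq0 ?polyC_eq0 //; apply/eqP => /polyP/(_ i).
    by rewrite coef_poly ltn_ord inord_val coef0 => /eqP; rewrite (negbTE ci).
  rewrite ev2M ev2C (ev2_coef _ _ (size_poly _ _)) mulr_sumr.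
  transitivity (\sum_(i < n.+1) \sum_j c i @ t * (a i j @ t * e j)).
    apply: eq_bigr => l _; rewrite coef_poly ltn_ord inord_val mulrCA ha mulr_sumr //.
  rewrite exchange_big big1 // => j _.
  under eq_bigr do rewrite mulrA -polyKM.
  by rewrite -mulr_suml -polyK_sum hc polyK0 mul0r.
pose m := (size Q).-1; pose b := lead_coef Q.
have b0 : b != 0 by rewrite lead_coef_eq0.
have bx : b @ x != 0 by apply/eqP => /tx /eqP; rewrite (negbTE b0).
exists (n * m)%N => I hI z.
have [q [a [q0 ha]]] := common _ z.
(* Pseudo-division by [Q] reduces each coefficient to degree below [m] in [t]; the powers of the
   leading coefficient [b] that this costs are equalised by [ss i]. *)
pose A i j := map_poly polyC (a i j).
pose s i j := scalp (A i j) Q; pose r i j := A i j %% Q.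
have hr i j : (b @ x) ^+ s i j * a i j @ t = ev2 (r i j) x t.
  rewrite -polyKXn -(ev2_map_polyC _ x t) -/(A i j) -ev2Z /b Pdiv.Idomain.divp_eq.
  by rewrite ev2D ev2M hQ mulr0 add0r.
pose ss i := (\sum_j s i j)%N.
pose v i (jl : 'I_n * 'I_m) := b ^+ (ss i - s i jl.1) * (r i jl.1)`_jl.2.
have hv i : (b @ x) ^+ ss i * (q @ t * z i) =
    \sum_(jl : 'I_n * 'I_m) v i jl @ x * (t ^+ jl.2 * e jl.1).
  rewrite ha -(pair_bigA _ (fun j l => v i (j, l) @ x * (t ^+ l * e j))) /= mulr_sumr.
  apply: eq_bigr => j _; rewrite mulrA.
  have les : (s i j <= ss i)%N by rewrite /ss (bigD1 j) //= leq_addr.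
  rewrite -{1}(subnK les) exprD -(mulrA (_ ^+ (_ - _))) hr (@ev2_coef _ _ _ m); last first.
    by rewrite -ltnS (ltn_predK sQ) Pdiv.Idomain.ltn_modpN0.
  rewrite mulr_sumr mulr_suml; apply: eq_bigr => l _.
  by rewrite /v /= polyKM polyKXn !mulrA.
have [|c [[i ci] hc]] := lindep v; first by rewrite card_prod !card_ord.
exists (fun i => c i * b ^+ ss i); split.
  by exists i; rewrite mulf_neq0 ?expf_neq0.
apply/eqP; have : q @ t != 0 by apply/eqP => /tt /eqP; rewrite (negbTE q0).
move=> qt; rewrite -(inj_eq (mulfI qt)) mulr0 mulr_sumr; apply/eqP.
transitivity (\sum_i \sum_(jl : 'I_n * 'I_m) c i @ x * (v i jl @ x * (t ^+ jl.2 * e jl.1))).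
  apply: eq_bigr => l _; rewrite -mulr_sumr -hv polyKM polyKXn.
  by rewrite mulrCA -!mulrA.
rewrite exchange_big big1 // => j _.
under eq_bigr do rewrite mulrA -polyKM.
by rewrite -mulr_suml -polyK_sum hc polyK0 mul0r.
Qed.

Lemma transc_alg x y : transc x -> exists P : {poly {poly k}}, P != 0 /\ ev2 P x y = 0.
Proof.
move=> /fin_over [N hN].
have [|a [[i ai] ha]] := hN 'I_N.+1 _ (fun i => y ^+ i); first by rewrite card_ord.
exists (\poly_(i < N.+1) a (inord i)); split.
  apply/eqP => /polyP/(_ i).
  by rewrite coef_poly ltn_ord inord_val coef0 => /eqP; rewrite (negbTE ai).
rewrite (ev2_coef _ _ (size_poly _ _)) -[RHS]ha.
by apply: eq_bigr => l _; rewrite coef_poly ltn_ord inord_val.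
Qed.

Hypothesis char0 : [pchar k] =i pred0.

Lemma natk_eq0 n : (n%:R == 0 :> k) = (n == 0%N).
Proof. by have /pcharf0P -> := char0. Qed.

(** A relation of least degree in [y] works: its derivative in [y] is nonzero in characteristic zero
    and of smaller degree, hence no relation, and a vanishing constant term would allow division by
    the second variable. *)
Lemma transc_minpoly x y : transc x -> exists P : {poly {poly k}},
  [/\ ev2 P x y = 0, ev2 P^`() x y != 0 & y != 0 -> P`_0 != 0].
Proof.
move=> tx; pose good n := `[< exists P, [/\ P != 0, ev2 P x y = 0 & size P = n] >].
have [n hn] : exists n, good n.
  by have [P [P0 hP]] := transc_alg y tx; exists (size P); apply/asboolP; exists P.
case: (ex_minnP (ex_intro _ n hn)) => m /asboolP [P [P0 hP sP]] hm.
have min Q : Q != 0 -> ev2 Q x y = 0 -> (m <= size Q)%N.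
  by move=> Q0 hQ; apply: hm; apply/asboolP; exists Q.
have m1 : (1 < m)%N.
  rewrite ltnNge -sP; apply/negP => /size1_polyC e.
  by move: hP P0; rewrite e ev2C => /tx ->; rewrite polyC0 eqxx.
exists P; split=> //.
- have dP0 : P^`() != 0.
    apply/eqP => /polyP/(_ m.-2); rewrite coef_deriv coef0 => /eqP.
    have -> : m.-2.+1 = m.-1 by lia.
    rewrite -sP -/(lead_coef P) -mulr_natr mulf_eq0 lead_coef_eq0 (negbTE P0) /=.
    by rewrite -polyC_natr polyC_eq0 natk_eq0 sP; lia.
  by apply/eqP => /(min _ dP0); have := lt_size_deriv P0; rewrite sP; lia.
- move=> y0; apply/eqP => P00.
  have [P1 eP] : exists P1, P = P1 * 'X.
    by exists (\poly_(i < size P) P`_i.+1); apply/polyP => -[|i];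
      rewrite coefMX //= coef_poly; case: ltnP => // h; rewrite nth_default // ltnW.
  have P10 : P1 != 0 by apply: contraNneq P0 => e; rewrite eP e mul0r.
  move/eqP: hP; rewrite eP ev2M ev2X mulf_eq0 (negbTE y0) orbF => /eqP /(min _ P10).
  by rewrite -sP eP size_mulX //; lia.
Qed.

End FunctionField.

(** * Existence of places *)

Section Chevalley.
Variables (k : closedFieldType) (K : fieldType) (iota : {rmorphism k -> K}).
Implicit Types (x y z a b : K) (B : set K).
Local Notation "p @ x" := (polyK iota p x) (at level 35).

(** A subring containing k and [x] in which [x] is not invertible; a maximal one will be the
    valuation ring of a zero of [x]. *)
Definition ring_avoiding x B : Prop :=
  [/\ forall c, B (iota c), B x, forall a b, B a -> B b -> B (a + b),
      forall a b, B a -> B b -> B (a * b) & forall b, B b -> x * b <> 1].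

Lemma exists_ring_avoiding x : transc iota x -> exists B, ring_avoiding x B.
Proof.
move=> tx; exists (fun z => exists p, p @ x = z); split.
- by move=> c; exists c%:P; rewrite polyKC.
- by exists 'X; rewrite polyKX.
- by move=> a b [p <-] [r <-]; exists (p + r); rewrite polyKD.
- by move=> a b [p <-] [r <-]; exists (p * r); rewrite polyKM.
- move=> b [p <-] e; have := tx ('X * p - 1).
  rewrite polyKB polyKM polyKX polyK1 e subrr => /(_ erefl) /(congr1 (fun p => p.[0])).
  by rewrite hornerD hornerM hornerX hornerN hornerC horner0 mul0r sub0r => /eqP; rewrite oppr_eq0 oner_eq0.
Qed.

Lemma exists_max_ring_avoiding x : transc iota x ->
  exists B, ring_avoiding x B /\
    forall B', ring_avoiding x B' -> (B `<=` B' -> B' `<=` B)%classic.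
Proof.
move=> tx; have [B0 hB0] := exists_ring_avoiding tx.
pose T := {B | ring_avoiding x B}.
have [||A tA|[B hB] mB] := @ZL_preorder T (exist _ B0 hB0)
    (fun X Y => `[< proj1_sig X `<=` proj1_sig Y >])%classic.
- by move=> B; apply/asboolP => z.
- by move=> B1 B2 B3 /asboolP h1 /asboolP h2; apply/asboolP => z /h1 /h2.
- have [[B1 AB1]|nA] := pselect (exists X, A X); last first.
    by exists (exist _ B0 hB0) => B AB; case: nA; exists B.
  pose U z := exists X, A X /\ proj1_sig X z.
  have UP a b : U a -> U b -> exists X, [/\ A X, proj1_sig X a & proj1_sig X b].
    move=> [B2 [A2 h2]] [B3 [A3 h3]]; case: (tA _ _ A2 A3) => /asboolP h.
      by exists B3; split=> //; apply: h.
    by exists B2; split=> //; apply: h.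
  have hU : ring_avoiding x U.
    split.
    + by move=> c; exists B1; split=> //; case: (proj2_sig B1).
    + by exists B1; split=> //; case: (proj2_sig B1).
    + move=> a b Ua Ub; have [B [AB Ba Bb]] := UP _ _ Ua Ub.
      by exists B; split=> //; case: (proj2_sig B) => _ _ h _ _; apply: h.
    + move=> a b Ua Ub; have [B [AB Ba Bb]] := UP _ _ Ua Ub.
      by exists B; split=> //; case: (proj2_sig B) => _ _ _ h _; apply: h.
    + by move=> b [B [AB Bb]]; case: (proj2_sig B) => _ _ _ _ h; apply: h.
  by exists (exist _ U hU) => B AB; apply/asboolP => z /= Bz; exists B.
- exists B; split=> // B' hB' le.
  by have /asboolP := mB (exist _ B' hB') (asboolT le).
Qed.

Section MaximalRing.
Variables (x : K) (B : set K).
Hypotheses (tx : transc iota x) (hB : ring_avoiding x B).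
Hypothesis maxB : forall B', ring_avoiding x B' -> (B `<=` B' -> B' `<=` B)%classic.

Lemma Biota c : B (iota c). Proof. by case: hB. Qed.
Lemma Bx : B x. Proof. by case: hB. Qed.
Lemma BD a b : B a -> B b -> B (a + b). Proof. by case: hB => _ _ h _ _; apply: h. Qed.
Lemma BM a b : B a -> B b -> B (a * b). Proof. by case: hB => _ _ _ h _; apply: h. Qed.
Lemma Bav b : B b -> x * b <> 1. Proof. by case: hB => _ _ _ _ h; apply: h. Qed.
Lemma B0 : B 0. Proof. by rewrite -(rmorph0 iota); apply: Biota. Qed.
Lemma B1 : B 1. Proof. by rewrite -(rmorph1 iota); apply: Biota. Qed.
Lemma BN a : B a -> B (- a).
Proof. by move=> h; rewrite -mulN1r -(rmorphN1 iota); apply: BM => //; apply: Biota. Qed.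
Lemma BB a b : B a -> B b -> B (a - b).
Proof. by move=> ha hb; apply: BD => //; apply: BN. Qed.
Lemma BX a n : B a -> B (a ^+ n).
Proof. by move=> h; elim: n => [|n IH]; rewrite ?expr0 ?exprS; [apply: B1|apply: BM]. Qed.
Lemma Bsum (I : Type) (s : seq I) (P : pred I) (F : I -> K) :
  (forall i, P i -> B (F i)) -> B (\sum_(i <- s | P i) F i).
Proof. by move=> h; elim/big_ind: _ => //; [exact: B0|exact: BD]. Qed.

(** Inverting 1 - x b keeps [x] non-invertible, since every power of 1 - x b is again of the form 1
    - x b'; maximality then puts the inverse in [B]. *)
Lemma B_inv b : B b -> B (1 - x * b)^-1.
Proof.
move=> Bb; pose u := 1 - x * b.
have u0 : u != 0 by rewrite subr_eq0; apply/eqP => e; apply: (Bav Bb).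
have Bu : B u by apply: BB; [apply: B1|apply: BM => //; apply: Bx].
have uX r : exists2 b', B b' & u ^+ r = 1 - x * b'.
  elim: r => [|r [b' Bb' e]]; first by exists 0; [apply: B0|rewrite expr0 mulr0 subr0].
  exists (b' + b - b * (x * b')); last by rewrite exprS e /u; ring.
  by apply: BB; [apply: BD|apply: BM => //; apply: BM => //; apply: Bx].
pose B' z := exists r, B (z * u ^+ r).
have BB' z : B z -> B' z by exists 0%N; rewrite expr0 mulr1.
have hB' : ring_avoiding x B'.
  split.
  - by move=> c; apply/BB'/Biota.
  - exact/BB'/Bx.
  - move=> a c [r hr] [s hs]; exists (r + s)%N; rewrite mulrDl.
    by apply: BD; rewrite exprD; [rewrite mulrA|rewrite (mulrC (u ^+ r)) mulrA];
      apply: BM => //; apply: BX.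
  - move=> a c [r hr] [s hs]; exists (r + s)%N.
    by rewrite exprD mulrACA; apply: BM.
  - move=> c [r hr] e; have [b' Bb' eb] := uX r.
    apply: (Bav (b := b' + c * u ^+ r)); first exact: BD.
    by rewrite mulrDr mulrA e mul1r eb; ring.
apply: (maxB hB') => //; exists 1%N.
by rewrite expr1 mulVf //; apply: B1.
Qed.

Definition relpoly z n := exists p : {poly K},
  [/\ (size p <= n)%N, forall i, B p`_i & x * p.[z] = 1].

(* Chevalley: shortest witnesses that [x] is a unit of both [B[z]] and [B[z^-1]] would
   shorten each other, so [B] is a valuation ring. *)
Lemma relpoly_step z n m : z != 0 -> (m <= n.+1)%N ->
  relpoly z n.+1 -> relpoly z^-1 m -> relpoly z n.
Proof.
move=> z0 mn [p [sp Bp hp]] [r [sr Br hr]].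
pose u := (1 - x * r`_0)^-1.
have u0 : 1 - x * r`_0 != 0 by rewrite subr_eq0; apply/eqP => e; apply: (Bav (Br 0%N)).
(* Multiplying the relation for z^-1 by z^n gives (1 - x r_0) z^n as [x] times the sum of r_(n-i)
   z^i over i < n; substituting this for the top power of [z] in [p] produces [p']. *)
pose p' := \poly_(i < n) (p`_i + x * (p`_n * (u * r`_(n - i)))).
exists p'; split; first exact: size_poly.
  move=> i; rewrite coef_poly; case: ifP => _; last exact: B0.
  apply: BD => //; apply: BM; first exact: Bx.
  by do 2!apply: BM => //; apply: B_inv.
rewrite (horner_coef_wide z (size_poly _ _)).
have -> : \sum_(i < n) p'`_i * z ^+ i =
   \sum_(i < n) p`_i * z ^+ i + x * (p`_n * (u * \sum_(i < n) r`_(n - i) * z ^+ i)).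
  rewrite 3!mulr_sumr -big_split; apply: eq_bigr => i _.
  by rewrite coef_poly ltn_ord /=; ring.
have e1 : \sum_(i < n) r`_(n - i) * z ^+ i = z ^+ n * (r.[z^-1] - r`_0).
  rewrite (horner_coef_wide _ (leq_trans sr mn)) big_ord_recl expr0 mulr1 addrAC subrr add0r.
  rewrite mulr_sumr (reindex_inj rev_ord_inj) /=; apply: eq_bigr => i _.
  rewrite /bump /= add1n subKn // mulrCA; congr (_ * _).
  have e : z ^+ n = z ^+ (n - i.+1) * z ^+ i.+1 by rewrite -exprD subnK.
  by rewrite exprVn e mulfK ?expf_neq0.
have -> : \sum_(i < n) p`_i * z ^+ i = p.[z] - p`_n * z ^+ n.
  by rewrite (horner_coef_wide z sp) big_ord_recr /= addrK.
rewrite e1 mulrDr mulrBr hp.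
have -> : x * (x * (p`_n * (u * (z ^+ n * (r.[z^-1] - r`_0))))) =
    x * (p`_n * (u * (z ^+ n * (x * r.[z^-1] - x * r`_0)))).
  by rewrite -mulrBr [x * (p`_n * _)]mulrCA [x * (u * _)]mulrCA [x * (z ^+ n * _)]mulrCA.
by rewrite hr [z ^+ n * _]mulrC mulKf // subrK.
Qed.

Lemma relpoly_absurd z n m : z != 0 -> relpoly z n -> relpoly z^-1 m -> False.
Proof.
move: {2}(n + m)%N (leqnn (n + m)) => N; elim: N z n m => [|N IH] z n m hN z0 hn hm.
  case: hn => p [sp _]; have -> : p = 0 by apply/eqP; rewrite -size_poly_eq0; lia.
  by rewrite horner0 mulr0 => /eqP; rewrite eq_sym oner_eq0.
have pos y l : relpoly y l -> (0 < l)%N.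
  case: l => // -[p [sp _]]; have -> : p = 0 by apply/eqP; rewrite -size_poly_eq0; lia.
  by rewrite horner0 mulr0 => /eqP; rewrite eq_sym oner_eq0.
have zi0 : z^-1 != 0 by rewrite invr_eq0.
have n0 := pos _ _ hn; have m0 := pos _ _ hm.
case: (leqP m n) => h.
  apply: (IH z n.-1 m) => //; first by lia.
  by apply: (relpoly_step (m := m)) => //; rewrite prednK.
apply: (IH z n m.-1) => //; first by lia.
apply: (relpoly_step (m := n)) => //; rewrite ?prednK ?invrK //; exact: ltnW.
Qed.

Lemma B_valuation z : B z \/ B z^-1.
Proof.
have [->|z0] := eqVneq z 0; first by left; apply: B0.
suff key y : ~ B y -> exists n, relpoly y n.
  have [?|n1] := pselect (B z); first by left.
  have [?|n2] := pselect (B z^-1); first by right.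
  by have [n hn] := key _ n1; have [m hm] := key _ n2; case: (relpoly_absurd z0 hn hm).
move=> nBy.
pose B' w := exists p : {poly K}, (forall i, B p`_i) /\ p.[y] = w.
have BB' w : B w -> B' w.
  move=> Bw; exists w%:P; rewrite hornerC; split=> // i.
  by rewrite coefC; case: ifP => // _; apply: B0.
apply: contrapT => nrel; apply: nBy.
apply: (maxB (B' := B')) => //; last first.
  exists 'X; rewrite hornerX; split=> // i.
  by rewrite coefX; case: eqP => _; [apply: B1|apply: B0].
split.
- by move=> c; apply/BB'/Biota.
- exact/BB'/Bx.
- move=> a b [p [hp <-]] [r [hr <-]]; exists (p + r); rewrite hornerD; split=> // i.
  by rewrite coefD; apply: BD.
- move=> a b [p [hp <-]] [r [hr <-]]; exists (p * r); rewrite hornerM; split=> // i.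
  by rewrite coefM; apply: Bsum => j _; apply: BM.
- by move=> b [p [hp <-]] e; apply: nrel; exists (size p), p.
Qed.

Definition unitB z := [/\ z != 0, B z & B z^-1].

Lemma unitBM y z : unitB y -> unitB z -> unitB (y * z).
Proof.
move=> [y0 By Biy] [z0 Bz Biz]; split; first by rewrite mulf_neq0.
  exact: BM.
by rewrite invfM; apply: BM.
Qed.

Lemma unitBV y : unitB y -> unitB y^-1.
Proof. by move=> [y0 By Biy]; split; rewrite ?invr_eq0 ?invrK. Qed.

Lemma unitBX y n : unitB y -> unitB (y ^+ n).
Proof.
move=> h; elim: n => [|n IH]; last by rewrite exprS; apply: unitBM.
by rewrite expr0; split; rewrite ?oner_eq0 ?invr1 //; apply: B1.
Qed.

Lemma x_neq0 : x != 0.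
Proof. by apply/eqP; have := transc_notconst tx (c := 0); rewrite rmorph0. Qed.

Lemma unitB_iota c : c != 0 -> unitB (iota c).
Proof. by move=> c0; split; rewrite ?fmorph_eq0 -?fmorphV //; apply: Biota. Qed.

Lemma unitB_xz (n : int) : unitB (x ^ n) -> n = 0.
Proof.
have pos (m : nat) : ~ unitB (x ^+ m.+1).
  move=> [_ _ Bi]; apply: (Bav (b := x ^+ m * (x ^+ m.+1)^-1)).
    by apply: BM => //; apply: BX; apply: Bx.
  by rewrite mulrA -exprS mulfV // expf_neq0 // x_neq0.
case: n => [[|n]|n] // h; first by case: (pos n).
by case: (pos n); move: h; rewrite NegzE -exprnN => /unitBV; rewrite invrK.
Qed.

Lemma polyK_unitB p : p != 0 -> exists (n : nat) u, unitB u /\ p @ x = x ^+ n * u.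
Proof.
elim/poly_ind: p => [|p c IH]; first by rewrite eqxx.
have Bp r : B (r @ x).
  elim/poly_ind: r => [|r d IHr]; first by rewrite polyK0; apply: B0.
  rewrite polyKD polyKM polyKX polyKC; apply: BD; last exact: Biota.
  by apply: BM => //; apply: Bx.
have [->|c0] := eqVneq c 0.
  rewrite addr0 => h; have p0 : p != 0 by apply: contraNneq h => ->; rewrite mul0r.
  have [n [u [hu e]]] := IH p0; exists n.+1, u; split=> //.
  by rewrite polyKM polyKX e mulrC mulrA -exprS.
move=> _; exists 0%N, (iota c * (1 - x * (- (p @ x) / iota c))); split.
  apply: unitBM; first exact: unitB_iota.
  have Bm : B (- (p @ x) / iota c).
    by apply: BM; [apply: BN|rewrite -fmorphV; apply: Biota].
  split; last exact: B_inv.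
    by rewrite subr_eq0; apply/eqP => e; apply: (Bav Bm).
  by apply: BB; [apply: B1|apply: BM => //; apply: Bx].
rewrite expr0 mul1r polyKD polyKM polyKX polyKC mulrBr mulr1 addrC; congr (_ + _).
by rewrite mulrCA [iota c * _]mulrC divfK ?fmorph_eq0 // mulrN opprK mulrC.
Qed.

Lemma nonunitB_add a b : B a -> B b -> ~ unitB a -> ~ unitB b -> ~ unitB (a + b).
Proof.
have key c d : B d -> ~ unitB d -> B (c / d) -> d != 0 -> ~ unitB (c + d).
  move=> Bd nd Bcd d0 [cd0 _ h]; apply: nd; split=> //.
  have -> : d^-1 = (c / d + 1) * (c + d)^-1.
    by rewrite -(mulfV d0) -mulrDl mulrAC mulfV // mul1r.
  by apply: BM => //; apply: BD => //; apply: B1.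
move=> Ba Bb na nb.
have [->|a0] := eqVneq a 0; first by rewrite add0r.
have [->|b0] := eqVneq b 0; first by rewrite addr0.
case: (B_valuation (a / b)) => h; first exact: key.
by rewrite addrC; apply: key => //; move: h; rewrite invfM invrK mulrC.
Qed.

(** Divide by a term [F j] that makes all the ratios integral. If no other ratio were a unit, -1
    would be a sum of non-units, and these are closed under addition. *)
Lemma unitB_ratio (I : finType) (F : I -> K) (i0 : I) (P : pred I) :
  P i0 -> (forall i, P i -> F i != 0) -> \sum_(i | P i) F i = 0 ->
  exists i j, [/\ P i, P j, i != j & unitB (F i / F j)].
Proof.
move=> Pi0 F0 sF.
have [j [Pj hj]] : exists j, P j /\ forall i, P i -> B (F i / F j).
  suff [j [Pj hj]] : exists j, P j /\ forall i, i \in enum P -> B (F i / F j).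
    by exists j; split=> // i Pi; apply: hj; rewrite mem_enum.
  have : {subset enum P <= P} by move=> i; rewrite mem_enum.
  elim: (enum P) => [|i s IH] hs; first by exists i0.
  have [|j [Pj hj]] := IH; first by move=> l ls; apply: hs; rewrite in_cons ls orbT.
  have Pi : P i by apply: hs; rewrite in_cons eqxx.
  case: (B_valuation (F i / F j)) => h.
    by exists j; split=> // l; rewrite in_cons => /predU1P[->|/hj].
  exists i; split=> // l; rewrite in_cons => /predU1P[->|/hj hl].
    by rewrite mulfV ?F0 //; apply: B1.
  have -> : F l / F i = (F l / F j) * (F i / F j)^-1.
    by rewrite invf_div mulrA divfK ?F0.
  exact: BM.
apply: contrapT => hn.
have nu i : P i -> i != j -> ~ unitB (F i / F j).
  by move=> Pi ij u; apply: hn; exists i, j.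
have : ~ unitB (\sum_(i | P i && (i != j)) F i / F j).
  pose Q a := B a /\ ~ unitB a.
  suff [] : Q (\sum_(i | P i && (i != j)) F i / F j) by [].
  elim/big_ind: _ => [|a b [Ba na] [Bb nb]|i /andP[Pi ij]].
  - by split; [apply: B0|case; rewrite eqxx].
  - by split; [apply: BD|apply: nonunitB_add].
  - by split; [apply: hj|apply: nu].
apply; rewrite -mulr_suml; move: sF; rewrite (bigD1 j) //= => /eqP.
rewrite addrC addr_eq0 => /eqP ->; rewrite mulNr mulfV ?F0 //.
by rewrite -(rmorphN1 iota); apply: unitB_iota; rewrite oppr_eq0 oner_eq0.
Qed.

(* Two terms of a vanishing polynomial relation in [z] have the same value, so the value of
   [z] is commensurable with that of [x], with a denominator bounded by the field degree. *)
Lemma unitB_power (N : nat) z :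
  (forall I : finType, (N < #|I|)%N -> forall z : I -> K, dependent_over iota x z) ->
  z != 0 -> exists n : int, unitB (z ^+ N`! / x ^ n).
Proof.
move=> hN z0.
have [|a [[i ai] ha]] := hN 'I_N.+1 _ (fun i => z ^+ i); first by rewrite card_ord.
have [j aj||i1 [i2 [a1 a2 ne u12]]] :=
    @unitB_ratio _ (fun j => a j @ x * z ^+ j) i (fun j => a j != 0) ai.
- rewrite mulf_neq0 ?expf_neq0 //.
  by apply/eqP => /tx /eqP; rewrite (negbTE aj).
- rewrite -[RHS]ha [RHS](bigID (fun j => a j != 0)) /= [X in _ + X]big1 ?addr0 // => j.
  by rewrite negbK => /eqP ->; rewrite polyK0 mul0r.
have [j [n [j0 jN u]]] : exists (j : nat) (n : int),
    [/\ (0 < j)%N, (j <= N)%N & unitB (z ^+ j / x ^ n)].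
  wlog lt12 : i1 i2 a1 a2 ne u12 / (i1 < i2)%N => [hw|].
    case: (ltngtP i1 i2) => h; first exact: (hw i1 i2).
      by apply: (hw i2 i1) => //; [rewrite eq_sym|rewrite -invf_div; apply: unitBV].
    by move: ne; rewrite -val_eqE /= h eqxx.
  have [n1 [u1 [hu1 e1]]] := polyK_unitB a1; have [n2 [u2 [hu2 e2]]] := polyK_unitB a2.
  exists (i2 - i1)%N, (n1%:Z - n2%:Z); split; [by rewrite subn_gt0| |].
    by rewrite (leq_trans (leq_subr _ _)) // -ltnS.
  have /unitBV := unitBM u12 (unitBM (unitBV hu1) hu2); congr (unitB _).
  have [u10 _ _] := hu1; have [u20 _ _] := hu2; have x0 := x_neq0.
  rewrite e1 e2 expfzDr // -exprnN -exprnP.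
  have -> : z ^+ i2 = z ^+ (i2 - i1) * z ^+ i1 by rewrite -exprD subnK // ltnW.
  have X1 := expf_neq0 n1 x0; have X2 := expf_neq0 n2 x0.
  have Z1 := expf_neq0 i1 z0; have Z2 := expf_neq0 (i2 - i1) z0.
  move: X1 X2 Z1 Z2 u10 u20.
  move: (x ^+ n1) (x ^+ n2) (z ^+ i1) (z ^+ (i2 - i1)) (u1) (u2) => X1 X2 Z1 Z2 U1 U2.
  by move=> h1 h2 h3 h4 h5 h6; field; rewrite ?h1 ?h2 ?h3 ?h4 ?h5 ?h6.
have [d ed] : exists d, N`! = (j * d)%N.
  by have /dvdnP[d ->] : (j %| N`!)%N; [apply: dvdn_fact; rewrite j0|exists d; rewrite mulnC].
exists (n * d%:Z); have := unitBX d u; rewrite expr_div_n -exprM -ed.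
by rewrite -exprz_exp -exprnP.
Qed.

(** Every z^N! is a unit times a power of [x]. The exponent [w0 z] is a homomorphism to the
    integers, nonnegative exactly on [B]; dividing it by its least positive value makes it a
    normalised place, positive at [x]. *)
Lemma maximal_ring_place (N : nat) :
  (forall I : finType, (N < #|I|)%N -> forall z : I -> K, dependent_over iota x z) ->
  exists q : place iota, 0 < vp q x.
Proof.
move=> hN; have x0 := x_neq0.
have /choice[w0 hw0] : forall z, exists n : int, z != 0 -> unitB (z ^+ N`! / x ^ n).
  move=> z; have [->|z0] := eqVneq z 0; first by exists 0.
  by have [n hn] := unitB_power hN z0; exists n.
have w0E z n : z != 0 -> unitB (z ^+ N`! / x ^ n) -> w0 z = n.
  move=> z0 hn; have /unitBV hm := hw0 z z0.
  apply/eqP; rewrite -subr_eq0; apply/eqP; apply: unitB_xz.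
  have := unitBM hm hn; congr (unitB _).
  have Z0 := expf_neq0 N`! z0; have X0 := expfz_neq0 n x0.
  by rewrite expfzDr // -invr_expz invf_div mulrA mulfVK.
have w0M y z : y != 0 -> z != 0 -> w0 (y * z) = w0 y + w0 z.
  move=> y0 z0; apply: w0E; first by rewrite mulf_neq0.
  by have := unitBM (hw0 y y0) (hw0 z z0); rewrite exprMn expfzDr // mulf_div.
have w0_unit z : unitB z -> w0 z = 0.
  by move=> h; apply: w0E; [case: h|rewrite expr0z divr1; apply: unitBX].
have w0V z : z != 0 -> w0 z^-1 = - w0 z.
  move=> z0; have : w0 1 = 0 by apply: w0_unit; split; rewrite ?oner_eq0 ?invr1 //; apply: B1.
  by rewrite -(mulfV z0) w0M ?invr_eq0 // => /eqP; rewrite addrC addr_eq0 => /eqP.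
have w0x : w0 x = N`!.
  apply: w0E => //; rewrite -exprnP mulfV ?expf_neq0 //.
  by split; rewrite ?oner_eq0 ?invr1 //; apply: B1.
have w0_ge0 z : z != 0 -> B z -> 0 <= w0 z.
  move=> z0 Bz; rewrite leNgt; apply/negP => lt0.
  have [_ _ h] := hw0 z z0.
  have [n en] : exists n : nat, w0 z = - (n.+1)%:Z by exists (absz (w0 z)).-1; lia.
  have := unitBV (hw0 z z0); rewrite en -exprnN invrK invfM => -[_ Bi _].
  apply: (Bav (b := x ^+ n * ((z ^+ N`!)^-1 * (x ^+ n.+1)^-1 * z ^+ N`!))).
    apply: BM; first by apply: BX; apply: Bx.
    by apply: BM => //; apply: BX.
  by rewrite mulrA -exprS mulrAC mulVf ?expf_neq0 // mul1r mulfV // expf_neq0.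
have w0_lt0 z : z != 0 -> 0 <= w0 z -> B z.
  move=> z0 h; case: (B_valuation z) => // Bi.
  have zi0 : z^-1 != 0 by rewrite invr_eq0.
  have e0 : w0 z = 0 by have := w0_ge0 _ zi0 Bi; rewrite w0V //; lia.
  have := hw0 z z0; rewrite e0 expr0z divr1 => -[_ BzN _].
  have -> : z = z ^+ N`! * z^-1 ^+ (N`!).-1.
    have e : z ^+ N`! = z * z ^+ N`!.-1 by rewrite -exprS prednK // fact_gt0.
    by rewrite e exprVn mulfK // expf_neq0.
  by apply: BM => //; apply: BX.
have w0_min y z : y != 0 -> z != 0 -> y + z != 0 -> Num.min (w0 y) (w0 z) <= w0 (y + z).
  wlog h : y z / B (y / z) => [hw|y0 z0 yz0].
    case: (B_valuation (y / z)) => h y0 z0 yz0; first exact: hw.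
    by rewrite minC addrC; apply: hw => //; [rewrite -invf_div|rewrite addrC].
  have e : y + z = (y / z + 1) * z by rewrite mulrDl mul1r divfK.
  have yz1 : y / z + 1 != 0 by apply: contraNneq yz0 => h0; rewrite e h0 mul0r.
  rewrite e w0M // ge_min; apply/orP; right; rewrite lerDr; apply: w0_ge0 => //.
  by apply: BD => //; apply: B1.
pose pos n := `[< exists z, z != 0 /\ w0 z = n.+1%:Z >].
have [n hn] : exists n, pos n.
  by exists N`!.-1; apply/asboolP; exists x; rewrite w0x prednK ?fact_gt0.
case: (ex_minnP (ex_intro _ n hn)) => g /asboolP[t [t0 wt]] hg.
have tX m : w0 (t ^ m) = m * g.+1%:Z.
  have tXn l : w0 (t ^+ l) = l%:Z * g.+1%:Z.
    elim: l => [|l IH]; last by rewrite exprS w0M ?expf_neq0 // IH wt; lia.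
    by rewrite expr0 mul0r; apply: w0_unit; split; rewrite ?oner_eq0 ?invr1 //; apply: B1.
  by case: m => m; [exact: tXn|rewrite NegzE -exprnN w0V ?expf_neq0 // tXn mulNr].
have gdvd z : z != 0 -> w0 z = (w0 z %/ g.+1%:Z)%Z * g.+1%:Z.
  move=> z0; pose r := (w0 z %% g.+1%:Z)%Z.
  have r0 : 0 <= r by apply: modz_ge0.
  have rlt : r < g.+1%:Z by apply: ltz_pmod.
  have er := divz_eq (w0 z) g.+1%:Z.
  rewrite {1}er -/r; have [->|rn0] := eqVneq r 0; first by rewrite addr0.
  have zz0 : z * t ^ (- (w0 z %/ g.+1%:Z)%Z) != 0 by rewrite mulf_neq0 ?expfz_neq0.
  have : pos (absz r).-1.
    apply/asboolP; exists (z * t ^ (- (w0 z %/ g.+1%:Z)%Z)); split=> //.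
    rewrite w0M ?expfz_neq0 // tX mulNr {1}er -/r; lia.
  by move/hg; lia.
pose v z := if z == 0 then 0 else (w0 z %/ g.+1%:Z)%Z.
have vE z : z != 0 -> v z * g.+1%:Z = w0 z by move=> z0; rewrite /v (negbTE z0) -gdvd.
have g0 : g.+1%:Z != 0 by [].
have hv : is_place iota v.
  split.
  - by rewrite /v eqxx.
  - move=> y z y0 z0; have yz0 : y * z != 0 by rewrite mulf_neq0.
    by have := w0M _ _ y0 z0; rewrite -!vE // -mulrDl => /(mulIf g0).
  - move=> y z y0 z0 yz0; have := w0_min _ _ y0 z0 yz0.
    by rewrite -!vE // !ge_min !ler_pM2r.
  - move=> c c0; have c0' : iota c != 0 by rewrite fmorph_eq0.
    by have /eqP := w0_unit _ (unitB_iota c0); rewrite -vE // mulf_eq0 (negbTE g0) orbF => /eqP.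
  - by exists t; apply: (mulIf g0); rewrite vE // wt mul1r.
exists (exist _ v hv); rewrite /vp /=.
have gpos : 0 < g.+1%:Z by [].
by rewrite -(pmulr_lgt0 _ gpos) vE // w0x ltz_nat fact_gt0.
Qed.

End MaximalRing.

Lemma exists_zero (hK : is_function_field iota) x :
  transc iota x -> exists q : place iota, 0 < vp q x.
Proof.
move=> tx; have [N hN] := fin_over hK tx.
have [B [hB mB]] := exists_max_ring_avoiding tx.
exact: (maximal_ring_place tx hB mB hN).
Qed.

End Chevalley.

(** * Residues, separation and finiteness of places *)

Section Places.
Variables (k : closedFieldType) (K : fieldType) (iota : {rmorphism k -> K}).
Implicit Types (q : place iota) (x y z : K) (s : seq (place iota)) (p : {poly k}).
Local Notation "p @ x" := (polyK iota p x) (at level 35).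

Lemma vp_subC_pole q x c : vp q x < 0 -> vp q (x - iota c) = vp q x.
Proof.
move=> h; have x0 : x != 0 by apply: (vp_neq0 (q := q)); lia.
have [] // := @vpD_lt _ _ _ q x (- iota c) x0.
by apply: vgeN; apply: vge_le (vge_iota q c); lia.
Qed.

Lemma polyK_factor p x : exists2 rs : seq k, size p = ((p != 0%R) + size rs)%N &
  p @ x = iota (lead_coef p) * \prod_(r <- rs) (x - iota r).
Proof.
have [rs ers] := closed_field_poly_normal p.
have [p0|p0] := eqVneq p 0.
  by exists [::]; rewrite p0 ?size_poly0 // lead_coef0 rmorph0 mul0r polyK0.
exists rs.
  by rewrite ers size_scale ?lead_coef_eq0 // size_prod_XsubC.
rewrite {1}ers -mul_polyC polyKM polyKC polyK_prod; congr (_ * _).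
by apply: eq_bigr => r _; rewrite polyKB polyKX polyKC.
Qed.

Lemma prodK_neq0 (I : Type) (r : seq I) (F : I -> K) :
  (forall i, F i != 0) -> \prod_(i <- r) F i != 0.
Proof.
by move=> F0; elim/big_rec: _ => [|i y _ y0]; rewrite ?oner_neq0 // mulf_neq0.
Qed.

Lemma vp_prod q (I : Type) (r : seq I) (F : I -> K) :
  (forall i, F i != 0) -> vp q (\prod_(i <- r) F i) = \sum_(i <- r) vp q (F i).
Proof.
move=> F0; elim: r => [|i r IH]; first by rewrite !big_nil vp1.
by rewrite !big_cons vpM ?IH // prodK_neq0.
Qed.

Lemma vp_polyK_pole q x p : vp q x < 0 -> vp q (p @ x) = vp q x * (size p).-1%:Z.
Proof.
move=> h; have [p0|p0] := eqVneq p 0; first by rewrite p0 polyK0 vp0 size_poly0 mulr0.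
have xr r : x - iota r != 0.
  by apply: (vp_neq0 (q := q)); rewrite vp_subC_pole //; lia.
have [rs srs ->] := polyK_factor p x; rewrite srs p0 /=.
rewrite vpM ?fmorph_eq0 ?lead_coef_eq0 ?prodK_neq0 //.
rewrite vp_iota add0r vp_prod // (eq_bigr (fun=> vp q x)) => [|r _]; last exact: vp_subC_pole.
by rewrite big_const_seq count_predT iter_addr_0 -mulr_natr natz.
Qed.

Lemma vge_polyK q x p : vge q x 0 -> vge q (p @ x) 0.
Proof.
move=> hx; rewrite (polyK_coef _ _ (leqnn _)); apply: vge_sum => i _.
by apply: vgeMl; [exact: vge_iota|exact: vgeX0].
Qed.

Lemma vge_polyKB q x y p n :
  vge q x 0 -> vge q y 0 -> vge q (x - y) n -> vge q (p @ x - p @ y) n.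
Proof.
move=> hx hy hxy; rewrite !(polyK_coef _ _ (leqnn _)) -sumrB; apply: vge_sum => i _.
rewrite -mulrBr; apply: vgeMl; first exact: vge_iota.
rewrite subrXX; apply: vgeMr => //; apply: vge_sum => j _.
by apply: vgeMl; apply: vgeX0.
Qed.

Lemma polyK_comp0 p : p @ (0 : K) = iota p.[0].
Proof.
rewrite (polyK_coef _ _ (leqSpred _)) big_ord_recl /= expr0 mulr1 big1 ?addr0 ?horner_coef0 //.
by move=> i _; rewrite expr0n mulr0.
Qed.

Lemma vp_polyK_zero q x p : 0 < vp q x -> p.[0] != 0 -> p @ x != 0 /\ vp q (p @ x) = 0.
Proof.
move=> hx p0; have c0 : iota p.[0] != 0 by rewrite fmorph_eq0.
have := @vpD_lt _ _ _ q (iota p.[0]) (p @ x - iota p.[0]) c0.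
rewrite (addrC (iota _)) subrK vp_iota; apply; rewrite -polyK_comp0.
apply: vge_polyKB; [right; lia|exact: vge0|rewrite subr0; right; lia].
Qed.

Hypothesis hK : is_function_field iota.

(** If no x - c vanished at [q], every nonzero polynomial in [x] would have value 0 there. In an
    algebraic equation of a uniformiser [t] over k(x), the nonzero terms would then have the
    distinct values i of t^i and could not cancel. *)
Lemma residue q x : vge q x 0 -> exists c, vge q (x - iota c) 1.
Proof.
move=> hx; apply: contrapT => hn.
have xc c : x - iota c != 0 /\ vp q (x - iota c) = 0.
  have h : ~ vge q (x - iota c) 1 by move=> h; apply: hn; exists c.
  have x0 : x - iota c != 0 by apply/eqP => e; apply: h; left.
  split=> //; have := vgeE x0 (vgeB hx (vge_iota q c)).
  by case: (ltgtP (vp q (x - iota c)) 0) => // h1 _; case: h; right; lia.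
have tx : transc iota x.
  by apply: notconst_transc => c e; have [] := xc c; rewrite e subrr eqxx.
have vpoly p : p != 0 -> p @ x != 0 /\ vp q (p @ x) = 0.
  move=> p0; split; first by apply/eqP => /tx /eqP; rewrite (negbTE p0).
  have [rs _ ->] := polyK_factor p x.
  rewrite vpM ?fmorph_eq0 ?lead_coef_eq0 ?prodK_neq0 => // [|r]; last by case: (xc r).
  rewrite vp_iota vp_prod => [|r]; last by case: (xc r).
  by rewrite big1 ?add0r // => r _; case: (xc r).
have [t ht] := uniformizer q.
have t0 : t != 0 by apply: (vp_neq0 (q := q)); rewrite ht.
have [P [P0]] := transc_alg hK t tx.
rewrite (ev2_coef _ _ _ (leqSpred _)) => e.
have [||h _] := @vp_sum_distinct _ _ _ q _ (fun i : 'I_(size P).-1.+1 => P`_i @ x * t ^+ i) ord_max.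
- have key (i : 'I_(size P).-1.+1) : P`_i @ x * t ^+ i != 0 -> vp q (P`_i @ x * t ^+ i) = i%:Z.
    rewrite mulf_eq0 negb_or => /andP[h1 h2].
    have P1 : P`_i != 0 by apply: contraNneq h1 => ->; rewrite polyK0.
    by rewrite vpM // (vpoly _ P1).2 vpX ht add0r natz.
  move=> i j hi hj; rewrite key // key // => -[h]; exact: val_inj.
- rewrite mulf_neq0 ?expf_neq0 //= -/(lead_coef P).
  by have [] := vpoly (lead_coef P) _; rewrite ?lead_coef_eq0.
- by rewrite e eqxx in h.
Qed.

(** The inclusion of valuation rings sends units to units, so the second valuation is the first
    times its own value at a uniformiser [t]; both being normalised, that factor is 1. *)
Lemma place_le_eq q q' : (forall x, vge q x 0 -> vge q' x 0) -> q = q'.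
Proof.
move=> h; have [t ht] := uniformizer q; have [t' ht'] := uniformizer q'.
have t0 : t != 0 by apply: (vp_neq0 (q := q)); rewrite ht.
have unit y : y != 0 -> vp q y = 0 -> vp q' y = 0.
  move=> y0 hy; apply/eqP; rewrite eq_le.
  have h1 := vgeE y0 (h y _); have yi0 : y^-1 != 0 by rewrite invr_eq0.
  have h2 := vgeE yi0 (h y^-1 _); rewrite h1 ?andbT; last by right; rewrite hy.
  by rewrite -oppr_ge0 -vpV; apply: h2; right; rewrite vpV hy.
have val y : y != 0 -> vp q' y = vp q y * vp q' t.
  move=> y0; have X0 := expfz_neq0 (- vp q y) t0.
  have := unit (y * t ^ (- vp q y)); rewrite mulf_neq0 // !vpM // !vpXz ht.
  by move=> /(_ isT); nia.
have et : 0 <= vp q' t by apply: (vgeE t0); apply: h; right; rewrite ht.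
have t'0 : t' != 0 by apply: (vp_neq0 (q := q')); rewrite ht'.
have e1 : vp q' t = 1.
  have := val t' t'0; rewrite ht'; move: (vp q t') (vp q' t) et => a e e0 hae.
  have [a0|a1] : a <= 0 \/ 1 <= a by lia.
    by nia.
  have : (a - 1) * e >= 0 by apply: mulr_ge0; lia.
  rewrite mulrBl mul1r -hae => h1.
  have e1 : e != 0 by apply: contra_eqN hae => /eqP ->; rewrite mulr0.
  by lia.
apply: place_inj => y; have [->|y0] := eqVneq y 0; first by rewrite !vp0.
by rewrite val // e1 mulr1.
Qed.

Lemma place_separate1 q q' : q != q' -> exists z, 0 < vp q z /\ vp q' z < 0.
Proof.
have key (p p' : place iota) : p != p' -> exists a, [/\ a != 0, 0 <= vp p a & vp p' a < 0].
  move=> pp'; apply: contrapT => hn; case/eqP: pp'; apply: place_le_eq => a ha.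
  have [->|a0] := eqVneq a 0; first exact: vge0.
  right; rewrite leNgt; apply/negP => h; apply: hn; exists a; split=> //.
  exact: vgeE.
move=> qq'; have [a [a0 ha1 ha2]] := key _ _ qq'.
rewrite eq_sym in qq'; have [b [b0 hb1 hb2]] := key _ _ qq'.
exists (a / b); rewrite !vpM ?invr_eq0 // !vpV; split; lia.
Qed.

Lemma place_separate q s : q \notin s ->
  exists z, 0 < vp q z /\ forall q', q' \in s -> vp q' z < 0.
Proof.
elim: s => [|r s IH]; first by have [t ht] := uniformizer q; exists t; rewrite ht.
rewrite in_cons negb_or => /andP[qr qs].
have [z [hz1 hz2]] := IH qs; have [w [hw1 hw2]] := place_separate1 qr.
have z0 := vp_neq0 (lt0r_neq0 hz1); have w0 := vp_neq0 (lt0r_neq0 hw1).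
(* The exponent exceeds every |v(z)| on the list: where [w] has a pole, w^m dominates [z]; elsewhere
   on [s] the pole of [z] dominates. *)
pose m := (\sum_(q' <- r :: s) absz (vp q' z)).+1.
have hm q' : q' \in r :: s -> (absz (vp q' z) < m)%N.
  by move=> h; rewrite ltnS (big_rem _ h) leq_addr.
have wm0 := expf_neq0 m w0.
have neg q' : q' \in r :: s -> z + w ^+ m != 0 /\ vp q' (z + w ^+ m) < 0.
  move=> h; have := hm _ h => hm'.
  have vw : vp q' (w ^+ m) = vp q' w * m%:Z by rewrite vpX -mulr_natr natz.
  case: (ltP (vp q' w) 0) => hw.
    have [|h1 h2] := @vpD_lt _ _ _ q' (w ^+ m) z wm0; first by right; nia.
    by rewrite addrC h1 h2; split=> //; nia.
  have q's : q' \in s by move: h; rewrite in_cons => /predU1P[e|//]; move: hw; rewrite e leNgt hw2.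
  have [|h1 h2] := @vpD_lt _ _ _ q' z (w ^+ m) z0.
    by right; have := hz2 _ q's; nia.
  by rewrite h1 h2; split=> //; apply: hz2.
exists (z + w ^+ m); split; last by move=> q' /neg [].
have [zw0 _] := neg r (mem_head _ _).
suff : 1 <= vp q (z + w ^+ m) by lia.
apply: (vgeE zw0); apply: vgeD; first by right; lia.
by right; rewrite vpX -mulr_natr natz; nia.
Qed.

(** With [z] from [place_separate], 1 / (1 + z) is a unit at [q] and vanishes at every pole of
    [z]. *)
Lemma place_idempotent q s : q \notin s ->
  exists u, [/\ u != 0, vp q u = 0 & forall q', q' \in s -> 0 < vp q' u].
Proof.
move=> /place_separate [z [h1 h2]].
have [|z1 vz] := @vpD_lt _ _ _ q 1 z (oner_neq0 _); first by right; rewrite vp1; lia.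
exists (1 + z)^-1; rewrite invr_eq0 z1 vpV vz vp1; split=> // q' /h2 hq'.
have z0 : z != 0 by apply: (vp_neq0 (q := q')); lia.
have [|_ e] := @vpD_lt _ _ _ q' z 1 z0; first by right; rewrite vp1; lia.
by rewrite vpV addrC e oppr_gt0.
Qed.

Definition order0 p := sval (multiplicity_XsubC p 0).

Lemma vp_polyK_pow q x p : 0 < vp q x -> p != 0 ->
  p @ x != 0 /\ vp q (p @ x) = (order0 p)%:Z * vp q x.
Proof.
move=> hx p0; have x0 : x != 0 by apply: (vp_neq0 (q := q)); lia.
rewrite /order0; case: (multiplicity_XsubC p 0) => m [r]; rewrite p0 /= => hr ep.
have [h1 h2] := vp_polyK_zero hx hr.
have -> : p @ x = r @ x * x ^+ m.
  by rewrite {1}ep polyKM polyKXn polyKB polyKX polyKC rmorph0 subr0.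
by rewrite mulf_neq0 ?expf_neq0 // vpM ?expf_neq0 // h2 add0r vpX -mulr_natl natz.
Qed.

(** Functions that are units at one zero of [x] and vanish at the others are independent over k(x):
    in a relation, the coefficient of least order at 0 gives a term that dominates at its own place.
    So the zeros are no more numerous than the degree bound. *)
Lemma zeros_bound x : transc iota x -> exists N, forall s, uniq s ->
  (forall q, q \in s -> 0 < vp q x) -> (size s <= N)%N.
Proof.
move=> tx; have [N hN] := fin_over hK tx; exists N => s us hs.
rewrite leqNgt; apply/negP => hlt.
have [q0 _] : exists q0, q0 \in s by case: s hlt {us hs} => // r s; exists r; rewrite mem_head.
have /choice[z hz] : forall i : 'I_(size s), exists u, [/\ u != 0, vp (nth q0 s i) u = 0 &
    forall j : 'I_(size s), j != i -> 0 < vp (nth q0 s j) u].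
  move=> i; have [|u [u0 u1 u2]] := @place_idempotent (nth q0 s i) (rem (nth q0 s i) s).
    by rewrite mem_rem_uniqF.
  exists u; split=> // j ij; apply: u2; rewrite mem_rem_uniq // inE mem_nth //.
  by rewrite andbT nth_uniq.
have [|a [[i0 ai0] ha]] := hN 'I_(size s) _ z; first by rewrite card_ord.
case: (@arg_minnP _ i0 (fun i => a i != 0%R) (fun i => order0 (a i)) ai0) => i ai hi.
set q := nth q0 s i; have hq : 0 < vp q x by apply: hs; rewrite mem_nth.
have [hz0 hz1 _] := hz i.
have [h1 h2] := vp_polyK_pow hq ai.
have T0 : a i @ x * z i != 0 by rewrite mulf_neq0.
move: ha; rewrite (bigD1 i) //=; have [|h3 _] := @vpD_lt _ _ _ q _ (\sum_(j | j != i) a j @ x * z j) T0;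
  last by move/eqP: h3.
apply: vge_sum => j ji; have [->|aj] := eqVneq (a j) 0; first by rewrite polyK0 mul0r; apply: vge0.
have [h3 h4] := vp_polyK_pow hq aj; have [z0 _ zj] := hz j.
right; rewrite !vpM // h2 h4 hz1; have := hi j aj; have := zj i _; rewrite eq_sym => /(_ ji).
by rewrite -/q; nia.
Qed.

Lemma finite_zeros x : transc iota x -> exists s, forall q, 0 < vp q x -> q \in s.
Proof.
move=> tx; have [N hN] := zeros_bound tx.
pose good n := `[< exists s, [/\ uniq s, forall q, q \in s -> 0 < vp q x & size s = n] >].
have g0 : exists n, good n by exists 0%N; apply/asboolP; exists [::].
have gN n : good n -> (n <= N)%N by move=> /asboolP [s [us hs <-]]; apply: hN.
case: (ex_maxnP g0 gN) => m /asboolP [s [us hs sm]] hm.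
exists s => q hq; apply/negPn/negP => qs.
have : good m.+1.
  apply/asboolP; exists (q :: s); rewrite /= qs us sm; split=> // r.
  by rewrite in_cons => /predU1P[->|/hs].
by move/hm; rewrite ltnn.
Qed.

Lemma finite_vp_support x : exists s, forall q, vp q x != 0 -> q \in s.
Proof.
have [[c ->]|hx] := pselect (exists c, x = iota c).
  by exists [::] => q; rewrite vp_iota eqxx.
have tx y : y = x \/ y = x^-1 -> transc iota y.
  move=> h; apply: notconst_transc => c e; apply: hx; case: h => h.
    by exists c; rewrite -e h.
  by exists c^-1; rewrite fmorphV -e h invrK.
have [s1 h1] := finite_zeros (tx x (or_introl erefl)).
have [s2 h2] := finite_zeros (tx x^-1 (or_intror erefl)).
exists (s1 ++ s2) => q hq; rewrite mem_cat; apply/orP.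
case: (ltgtP 0 (vp q x)) => h; [by left; apply: h1|right; apply: h2; rewrite vpV; lia|].
by rewrite -h eqxx in hq.
Qed.

End Places.

Lemma fsbig_all (I : choiceType) (R : Type) (idx : R) (op : Monoid.com_law idx)
    (F : I -> R) (s : seq I) : uniq s -> (forall i, F i <> idx -> i \in s) ->
  \big[op/idx]_(i \in [set: I]) F i = \big[op/idx]_(i <- s) F i.
Proof.
move=> us hs; rewrite (fsbig_seq _ F us); apply/esym/fsbig_widen => // i [_ /= ni].
by apply: contrapT => /hs.
Qed.

(** * Product formula and Weierstrass gaps *)

Section Divisors.
Variables (k : closedFieldType) (K : fieldType) (iota : {rmorphism k -> K}).
Implicit Types (q : place iota) (x y z : K) (s : seq (place iota)).

Lemma psumE (f : place iota -> nat) s :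
  uniq s -> (forall q, f q != 0%N -> q \in s) -> psum f = (\sum_(q <- s) f q)%N.
Proof. by move=> us hs; apply: fsbig_all => // q /eqP; apply: hs. Qed.

Lemma degE (D : place iota -> int) s :
  uniq s -> (forall q, D q != 0 -> q \in s) -> deg D = \sum_(q <- s) D q.
Proof. by move=> us hs; apply: fsbig_all => // q /eqP; apply: hs. Qed.

Lemma divisor_finP (D : place iota -> int) s :
  (forall q, D q != 0 -> q \in s) -> divisor_fin D.
Proof.
move=> hs; apply: (@sub_finite_set _ _ [set` s]%classic) => //.
Qed.

Hypothesis hK : is_function_field iota.

Lemma k_indep_neq0 n (f : 'I_n -> K) : k_indep iota f -> forall i, f i != 0.
Proof.
move=> indf i; apply/eqP => fi; have := indf (fun j => (j == i)%:R).
rewrite (bigD1 i) //= fi mulr0 add0r big1 => [|j /negbTE ->]; last by rewrite rmorph0 mul0r.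
by move=> /(_ erefl i) /eqP; rewrite eqxx oner_eq0.
Qed.

Lemma k_indep_lift n (f : 'I_n.+1 -> K) i0 :
  k_indep iota f -> k_indep iota (fun j => f (lift i0 j)).
Proof.
move=> indf c hc j; have := indf (fun i => if unlift i0 i is Some j then c j else 0).
rewrite (bigD1_ord i0) //= unlift_none rmorph0 mul0r add0r.
under eq_bigr do rewrite liftK.
by move=> /(_ hc (lift i0 j)); rewrite liftK.
Qed.

Lemma no_pole_const x : (forall q, vge q x 0) -> exists c, x = iota c.
Proof.
move=> hx; apply: contrapT => hn.
have tx : transc iota x^-1.
  by apply: notconst_transc => c e; apply: hn; exists c^-1; rewrite fmorphV -e invrK.
have [q hq] := exists_zero hK tx.
have x0 : x != 0 by rewrite -invr_eq0; apply: (vp_neq0 (q := q)); lia.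
by have := vgeE x0 (hx q); rewrite vpV in hq; lia.
Qed.

Variable (gen : nat).
Hypothesis hgen : is_genus iota gen.

(** The functions in this space become regular everywhere after multiplication by x^m, hence
    constant, so all are multiples of x^(-m). *)
Lemma dimL_principal x (m : int) : x != 0 -> dimL (fun q => m * vp q x) 1.
Proof.
move=> x0; have X0 (n : int) : x ^ n != 0 by rewrite expfz_neq0.
split.
  exists (fun=> x ^ (- m)); split=> [i|c].
    by right=> q; rewrite vpXz; lia.
  rewrite big_ord1 => /eqP; rewrite mulf_eq0 (negbTE (X0 _)) orbF fmorph_eq0 => /eqP e i.
  by rewrite (ord1 i).
case=> f [hf indf].
have /choice[a ha] : forall i, exists a, f i * x ^ m = iota a.
  move=> i; apply: no_pole_const => q; case: (hf i) => [->|h]; first by rewrite mul0r; left.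
  have [->|f0] := eqVneq (f i) 0; first by rewrite mul0r; left.
  by right; rewrite vpM // vpXz; have := h q; lia.
have ef i : f i = iota (a i) * x ^ (- m).
  by rewrite -ha -mulrA -expfzDr // subrr expr0z mulr1.
pose c (i : 'I_2) := if i == ord0 then a ord_max else - a ord0.
have hc := indf c; move: (hc); rewrite big_ord_recl big_ord1 /= !ef /c /=.
have -> : lift ord0 ord0 = ord_max :> 'I_2 by apply: val_inj.
rewrite rmorphN /= mulNr mulrCA mulrA subrr => /(_ erefl) h.
have a1 : a ord_max = 0 := h ord0.
by have := k_indep_neq0 indf ord_max; rewrite ef a1 rmorph0 mul0r eqxx.
Qed.

(* For every [m] the divisor of [x ^ m] has [l = 1], hence degree at most [gen]. *)
Lemma product_formula x s : x != 0 -> uniq s -> (forall q, vp q x != 0 -> q \in s) ->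
  \sum_(q <- s) vp q x = 0.
Proof.
move=> x0 us hs; have [h _] := hgen.
have key (m : int) : m * (\sum_(q <- s) vp q x) <= gen.
  have hs' q : m * vp q x != 0 -> q \in s.
    by rewrite mulf_eq0 negb_or => /andP[_]; apply: hs.
  have := h _ _ (divisor_finP hs') (dimL_principal m x0).
  by rewrite (degE us hs') -mulr_sumr subrK.
move: (\sum_(q <- s) vp q x) key => S key.
have := key (gen.+1%:Z * Num.sg S); rewrite -mulrA -normrEsg.
have [->//|S0] := eqVneq S 0; have : 0 < `|S| by rewrite normr_gt0.
by nia.
Qed.

Section OnePoint.
Variable p : place iota.

Definition regular_off z : Prop := forall q, q != p -> vge q z 0.
(** This is L((m - 1) p). With the shift, [Lspace 0] is zero, and the step from [m] to [m.+1]
    concerns the pole order [m] alone. *)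
Definition Lspace (m : nat) z : Prop := regular_off z /\ vge p z (1 - m%:Z).
Definition nongap (m : nat) : Prop := exists z, [/\ regular_off z, z != 0 & vp p z = - m%:Z].

Lemma regular_offD x y : regular_off x -> regular_off y -> regular_off (x + y).
Proof. by move=> hx hy q qp; apply: vgeD; [apply: hx|apply: hy]. Qed.
Lemma regular_offN x : regular_off x -> regular_off (- x).
Proof. by move=> hx q qp; apply: vgeN; apply: hx. Qed.
Lemma regular_offM x y : regular_off x -> regular_off y -> regular_off (x * y).
Proof. by move=> hx hy q qp; apply: vgeMl; [apply: hx|apply: hy]. Qed.
Lemma regular_off_iota c : regular_off (iota c).
Proof. by move=> q _; apply: vge_iota. Qed.

Lemma regular_off_vp z : regular_off z -> z != 0 -> vp p z <= 0.
Proof.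
move=> hz z0; rewrite leNgt; apply/negP => h.
have [q|c e] := @no_pole_const z.
  by have [->|qp] := eqVneq q p; [right; apply: ltW|apply: hz].
by rewrite e vp_iota in h.
Qed.

(** Subtracting constant multiples of one function whose pole order is exactly [m] removes that
    order from all the others, at the cost of one dimension; the constants are residues of the
    quotients. *)
Lemma Lspace_impose n m (f : 'I_n.+1 -> K) : k_indep iota f ->
  (forall i, Lspace m.+1 (f i)) ->
  exists g : 'I_n -> K, k_indep iota g /\ forall i, Lspace m (g i).
Proof.
move=> indf hf.
have [h|] := pselect (forall i, vge p (f i) (1 - m%:Z)).
  exists (fun j => f (lift ord0 j)); split; first exact: k_indep_lift.
  by move=> i; split=> //; case: (hf (lift ord0 i)).
move/existsNP => [i0 hi0].
have f0 : f i0 != 0 by apply/eqP => e; apply: hi0; rewrite e; left.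
have v0 : vp p (f i0) = - m%:Z.
  have [_ /(vgeE f0) h1] := hf i0.
  by case: (leP (1 - m%:Z) (vp p (f i0))) => h2; [case: hi0; right|lia].
have /choice[c hc] : forall j, exists c, vge p (f (lift i0 j) / f i0 - iota c) 1.
  move=> j; apply: residue => //; have [_ h] := hf (lift i0 j).
  have -> : 0 = (1 - m.+1%:Z) + m%:Z by lia.
  by apply: vgeM => //; right; rewrite vpV v0 opprK.
exists (fun j => f (lift i0 j) - iota (c j) * f i0); split.
  move=> d hd j.
  have := indf (fun i => if unlift i0 i is Some j then d j else - \sum_j d j * c j).
  rewrite (bigD1_ord i0) //= unlift_none.
  under [X in _ + X]eq_bigr do rewrite liftK.
  move=> h; suff e : iota (- (\sum_j0 d j0 * c j0)) * f i0 +
      \sum_j0 iota (d j0) * f (lift i0 j0) = 0.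
    by have := h e (lift i0 j); rewrite liftK.
  rewrite -[RHS]hd rmorphN rmorph_sum /= mulNr mulr_suml addrC -sumrB.
  by apply: eq_bigr => l _; rewrite rmorphM mulrBr mulrA.
move=> j; split.
  apply: regular_offD; first by case: (hf (lift i0 j)).
  apply: regular_offN; apply: regular_offM; [exact: regular_off_iota|by case: (hf i0)].
have -> : f (lift i0 j) - iota (c j) * f i0 = (f (lift i0 j) / f i0 - iota (c j)) * f i0.
  by rewrite mulrBl divfK.
by apply: vgeM => //; right; rewrite v0.
Qed.

Lemma Lspace_bound m n (f : 'I_n -> K) : k_indep iota f -> (forall i, Lspace m (f i)) ->
  (n <= \sum_(j < m) `[< nongap j >])%N.
Proof.
elim: m n f => [|m IH] n f indf hf.
  rewrite big_ord0; case: n f indf hf => // n f indf hf.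
  have f0 := k_indep_neq0 indf ord0; have [h1 /(vgeE f0)] := hf ord0.
  by have := regular_off_vp h1 f0; lia.
rewrite big_ord_recr /=; case: asboolP => hm.
  case: n f indf hf => // n f indf hf.
  by have [g [indg hg]] := Lspace_impose indf hf; rewrite addn1 ltnS; apply: IH indg hg.
rewrite addn0; apply: (IH _ f) => // i; have [h1 h2] := hf i; split=> //.
have [->|f0] := eqVneq (f i) 0; first exact: vge0.
have := vgeE f0 h2; right.
suff : vp p (f i) != - m%:Z by lia.
by apply/eqP => e; apply: hm; exists (f i).
Qed.

(** By [Lspace_bound], l(m p) is at most the number of nongaps up to [m], while the genus inequality
    for the divisor m p reads m - l(m p) + 1 <= gen. So at most [gen] of the m + 1 orders 0, ..., m
    are gaps. *)
Lemma gaps_bound m : (\sum_(j < m) ~~ `[< nongap j >] <= gen)%N.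
Proof.
case: m => [|m]; first by rewrite big_ord0.
pose good n := `[< exists f : 'I_n -> K, k_indep iota f /\ forall i, Lspace m.+1 (f i) >].
have g0 : exists n, good n.
  by exists 0%N; apply/asboolP; exists (fun=> 0); split=> [c _|] [].
have gm n : good n -> (n <= \sum_(j < m.+1) `[< nongap j >])%N.
  by move=> /asboolP [f [h1 h2]]; apply: (Lspace_bound h1 h2).
case: (ex_maxnP g0 gm) => n gn hn; have := gm n gn => hle.
pose D q : int := if q == p then m%:Z else 0.
have hD q : D q != 0 -> q \in [:: p] by rewrite /D inE; case: (q == p).
have LD z : inL D z <-> Lspace m.+1 z.
  split.
    case=> [->|h]; first by split=> [q _|]; left.
    split=> [q /negbTE qp|]; right; have := h; first by move=> /(_ q); rewrite /D qp addr0.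
    by move=> /(_ p); rewrite /D eqxx; lia.
  move=> [h1 h2]; have [->|z0] := eqVneq z 0; [by left|right=> q].
  rewrite /D; case: eqP => [->|/eqP qp]; first by have := vgeE z0 h2; lia.
  by rewrite addr0; apply: (vgeE z0); apply: h1.
have dimn : dimL D n.
  split.
    by move/asboolP: gn => [f [h1 h2]]; exists f; split=> // i; apply/LD.
  case=> f [h1 h2]; have : good n.+1 by apply/asboolP; exists f; split=> // i; apply/LD.
  by move/hn; rewrite ltnn.
have [h _] := hgen; have := h _ _ (divisor_finP hD) dimn.
rewrite (degE (s := [:: p])) // big_seq1 /D eqxx.
have : (\sum_(j < m.+1) `[< nongap j >] + \sum_(j < m.+1) ~~ `[< nongap j >])%N = m.+1.
  rewrite -big_split /= -[RHS](card_ord m.+1) -sum1_card.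
  by apply: eq_bigr => i _; case: asboolP.
by move: (\sum_(j < _) _)%N (\sum_(j < _) _)%N hle; lia.
Qed.

End OnePoint.
End Divisors.

Lemma map_derivMXaddC (R : nzRingType) (P : {poly {poly R}}) (c : {poly R}) :
  map_poly deriv (P * 'X + c%:P) = map_poly deriv P * 'X + (c^`())%:P.
Proof.
apply/polyP => i; rewrite coef_map !coefD !coefMX !coefC coef_map /= derivD.
by case: i => [|i] /=; rewrite ?deriv0 ?coef_map.
Qed.

Lemma deriv_horner (R : comNzRingType) (P : {poly {poly R}}) (r : {poly R}) :
  P.[r]^`() = (map_poly deriv P).[r] + P^`().[r] * r^`().
Proof.
elim/poly_ind: P => [|P c IH]; first by rewrite map_poly0 deriv0 !horner0 deriv0 mul0r addr0.
rewrite map_derivMXaddC !hornerMXaddC derivD derivM IH derivD derivM derivX mulr1 derivC addr0.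
by rewrite hornerD hornerMX; ring.
Qed.

(** * Derivations and Wronskians *)

Section Derivations.
Variables (k : closedFieldType) (K : fieldType) (iota : {rmorphism k -> K}).
Implicit Types (q : place iota) (x y z d e : K) (p r : {poly k}) (P : {poly {poly k}}).
Local Notation "p @ x" := (polyK iota p x) (at level 35).
Local Notation ev2 := (eval2 iota).

Definition is_derivation (D : K -> K) : Prop :=
  [/\ {morph D : x y / x + y}, forall x y, D (x * y) = D x * y + x * D y
    & forall c, D (iota c) = 0].

Section DerivationTheory.
Variable D : K -> K.
Hypothesis hD : is_derivation D.

Lemma derD x y : D (x + y) = D x + D y. Proof. by case: hD => h _ _; apply: h. Qed.
Lemma derM x y : D (x * y) = D x * y + x * D y. Proof. by case: hD => _ h _; apply: h. Qed.
Lemma der_iota c : D (iota c) = 0. Proof. by case: hD. Qed.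
Lemma der0 : D 0 = 0. Proof. by rewrite -{1}(rmorph0 iota) der_iota. Qed.
Lemma derN x : D (- x) = - D x.
Proof. by apply/eqP; rewrite -addr_eq0 -derD addNr der0. Qed.
Lemma derB x y : D (x - y) = D x - D y. Proof. by rewrite derD derN. Qed.
Lemma der_sum (I : Type) (s : seq I) (Q : pred I) (F : I -> K) :
  D (\sum_(i <- s | Q i) F i) = \sum_(i <- s | Q i) D (F i).
Proof. by apply: (big_morph D); [apply: derD|apply: der0]. Qed.
Lemma der_iotaM c x : D (iota c * x) = iota c * D x.
Proof. by rewrite derM der_iota mul0r add0r. Qed.

Lemma derX x n : D (x ^+ n) = x ^+ n.-1 * D x *+ n.
Proof.
elim: n => [|[|n] IH]; first by rewrite expr0 mulr0n -(rmorph1 iota) der_iota.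
  by rewrite expr1 expr0 mul1r.
rewrite exprS derM IH /= mulrnAr mulrA -exprS [RHS]mulrS; congr (_ + _).
by rewrite mulrC.
Qed.

Lemma der_polyK p x : D (p @ x) = p^`() @ x * D x.
Proof.
elim/poly_ind: p => [|p c IH]; first by rewrite deriv0 polyK0 mul0r der0.
rewrite derivD derivC addr0 derivM derivX mulr1 !polyKD !polyKM polyKX polyKC.
by rewrite derD der_iota addr0 derM IH mulrDl mulrAC.
Qed.

Lemma der_ev2 P x y :
  D (ev2 P x y) = ev2 (map_poly deriv P) x y * D x + ev2 P^`() x y * D y.
Proof.
elim/poly_ind: P => [|P c IH].
  by rewrite map_poly0 deriv0 ev20 !mul0r addr0 der0.
rewrite map_derivMXaddC derivD derivC addr0 derivM derivX mulr1.
rewrite !ev2D !ev2M !ev2X !ev2C derD derM IH der_polyK !mulrDl.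
move: (ev2 _ _ _) (ev2 _ _ _) (ev2 _ _ _) (D x) (D y) (_ @ _) => a b c' dx dy g.
by ring.
Qed.

End DerivationTheory.

Lemma ev2_horner P r x : P.[r] @ x = ev2 P x (r @ x).
Proof.
elim/poly_ind: P => [|P c IH]; first by rewrite horner0 polyK0 ev20.
by rewrite hornerMXaddC polyKD polyKM IH ev2D ev2M ev2X ev2C.
Qed.

Lemma vge_ev2B q P x y z n : vge q x 0 -> vge q y 0 -> vge q z 0 ->
  vge q (y - z) n -> vge q (ev2 P x y - ev2 P x z) n.
Proof.
move=> hx hy hz hyz; rewrite !(ev2_coef _ _ _ (leqnn _)) -sumrB; apply: vge_sum => i _.
rewrite -mulrBr; apply: vgeMl; first exact: vge_polyK.
rewrite subrXX; apply: vgeMr => //; apply: vge_sum => j _.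
by apply: vgeMl; apply: vgeX0.
Qed.

Hypotheses (hK : is_function_field iota) (char0 : [pchar k] =i pred0).

(** Applying either derivation to an equation P(x, y) = 0 with P_y nonzero expresses D y through D x
    by the same ratio of partial derivatives. *)
Lemma derivations_proportional D1 D2 x y :
  is_derivation D1 -> is_derivation D2 -> transc iota x ->
  D1 y * D2 x = D2 y * D1 x.
Proof.
move=> h1 h2 tx; have [P [hP dP _]] := transc_minpoly hK char0 y tx.
apply: (mulfI dP).
have e D : is_derivation D -> ev2 P^`() x y * D y = - (ev2 (map_poly deriv P) x y * D x).
  by move=> hD; apply/eqP; rewrite -addr_eq0 addrC -der_ev2 // hP der0.
by rewrite !mulrA !e // !mulNr mulrAC.
Qed.

Section LocalDerivation.
Variables (q : place iota) (t : K).
Hypothesis ht : vp q t = 1.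

Let t0 : t != 0. Proof. by apply: (vp_neq0 (q := q)); rewrite ht. Qed.
Let tint : vge q t 0. Proof. by right; rewrite ht. Qed.
Let tt : transc iota t.
Proof. by apply: notconst_transc => c e; move: ht; rewrite e vp_iota. Qed.

Lemma vge_deriv r n : vge q (r @ t) n -> vge q (r^`() @ t) (n - 1).
Proof.
have [->|r0] := eqVneq r 0; first by rewrite deriv0 polyK0; left.
have h1 : 0 < vp q t by rewrite ht.
have [rt0 vr] := vp_polyK_pow h1 r0 => /(vgeE rt0); rewrite vr ht mulr1 /order0.
case: (multiplicity_XsubC r 0) => m [b _ er] /= hm; rewrite er.
rewrite polyC0 subr0 derivM derivXn polyKD !polyKM.
have hX l : vge q ('X^l @ t) l by right; rewrite polyKXn polyKX vpX ht natz.
have hb b' : vge q (b' @ t) 0 by apply: vge_polyK.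
apply: vgeD; first by apply: vgeMl => //; apply: vge_le (hX m); lia.
apply: vgeMl => //; rewrite -mulr_natr -polyC_natr polyKM polyKC.
by apply: vgeMr; [apply: vge_le (hX _); lia|apply: vge_iota].
Qed.

(** Successive residues of the remainder divided by powers of [t] are the Taylor coefficients of
    [y]. *)
Lemma approximation y : vge q y 0 -> forall m : nat, exists r, vge q (y - r @ t) m.
Proof.
move=> hy; elim=> [|m [r hr]]; first by exists 0; rewrite polyK0 subr0.
have tm0 := expf_neq0 m t0.
have [c hc] : exists c, vge q ((y - r @ t) / t ^+ m - iota c) 1.
  apply: residue => //; have -> : 0 = m%:Z - m%:Z by rewrite subrr.
  by apply: vgeM => //; right; rewrite vpV vpX ht natz.
exists (r + c%:P * 'X^m).
have -> : y - (r + c%:P * 'X^m) @ t = ((y - r @ t) / t ^+ m - iota c) * t ^+ m.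
  by rewrite polyKD polyKM polyKC polyKXn polyKX mulrBl divfK // opprD addrA.
have -> : m.+1%:Z = 1 + m%:Z by lia.
by apply: vgeM => //; right; rewrite vpX ht natz.
Qed.

(* [d] is the [t]-derivative of [y]: the limit of the derivatives of polynomials in [t]
   converging to [y]. *)
Definition dlim y d : Prop := exists C : nat, forall m : nat, exists r,
  vge q (y - r @ t) m /\ vge q (d - r^`() @ t) (m%:Z - C%:Z).

Lemma dlim_uniq y d d' : dlim y d -> dlim y d' -> d = d'.
Proof.
move=> [C hC] [C' hC']; apply/eqP; rewrite -subr_eq0; apply/eqP.
apply: (@vge_nat _ _ _ q) => n.
have [r [hr1 hr2]] := hC (n + C + C').+1; have [s [hs1 hs2]] := hC' (n + C + C').+1.
have h : vge q ((r - s) @ t) (n + C + C').+1.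
  rewrite polyKB; have -> : r @ t - s @ t = (y - s @ t) - (y - r @ t).
    by rewrite opprB [RHS]addrC addrA subrK.
  exact: vgeB.
have := vge_deriv h; rewrite derivB polyKB => h'.
have -> : d - d' = (d - r^`() @ t) - (d' - s^`() @ t) + (r^`() @ t - s^`() @ t).
  by move: (r^`() @ t) (s^`() @ t) => a b; ring.
by apply: vgeD; [apply: vgeB|]; [apply: vge_le hr2|apply: vge_le hs2|apply: vge_le h']; lia.
Qed.

(** The value is forced by implicit differentiation: P(t, y) = 0 gives -P_t / P_y. When r(t)
    approximates [y], P(t, r(t)) is small, and differentiating it shows that r'(t) converges to this
    value. The precision lost is 1 for the derivation and [M] for the division by P_y. *)
Lemma dlim_exists y : vge q y 0 -> exists d, dlim y d.
Proof.
move=> hy; have [P [hP dP _]] := transc_minpoly hK char0 y tt.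
set e := ev2 P^`() t y in dP; pose M := absz (vp q e).
exists (- ev2 (map_poly deriv P) t y / e), M.+1 => m.
have [r hr] := approximation hy m; exists r; split=> //.
have rint : vge q (r @ t) 0 by apply: vge_polyK.
have hr' : vge q (r @ t - y) m by rewrite -opprB; apply: vgeN.
have h1 : vge q (P.[r] @ t) m.
  by rewrite ev2_horner -[X in vge q X]subr0 -hP; apply: vge_ev2B.
have := vge_deriv h1; rewrite deriv_horner polyKD polyKM !ev2_horner => h2.
have h3 : vge q (ev2 (map_poly deriv P) t y + e * r^`() @ t) (m%:Z - 1).
  have -> : ev2 (map_poly deriv P) t y + e * r^`() @ t =
     (ev2 (map_poly deriv P) t (r @ t) + ev2 P^`() t (r @ t) * r^`() @ t) -
     ((ev2 (map_poly deriv P) t (r @ t) - ev2 (map_poly deriv P) t y) +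
      (ev2 P^`() t (r @ t) - e) * r^`() @ t).
    rewrite mulrBl; move: (ev2 _ t (r @ t)) (ev2 _ t y) (ev2 _ t (r @ t)  * _) (e * _) => a b c d.
    by rewrite !opprD !opprK !addrA; ring.
  apply: vgeB => //; apply: (@vge_le _ _ _ _ _ _ m%:Z); first by lia.
  apply: vgeD; first exact: vge_ev2B.
  by apply: vgeMr; [apply: vge_ev2B|apply: vge_polyK].
have -> : - ev2 (map_poly deriv P) t y / e - r^`() @ t =
    - (ev2 (map_poly deriv P) t y + e * r^`() @ t) / e.
  by rewrite opprD mulrDl; congr (_ + _); rewrite mulNr mulrAC mulfV // mul1r.
have -> : m%:Z - M.+1%:Z = (m%:Z - 1) + - M%:Z by lia.
by apply: vgeM; [apply: vgeN|right; rewrite vpV /M; lia].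
Qed.

Lemma dlim_int y d : dlim y d -> vge q d 0.
Proof.
move=> [C hC]; have [r [_]] := hC C; rewrite subrr => h.
by rewrite -(subrK (r^`() @ t) d); apply: vgeD => //; apply: vge_polyK.
Qed.

Lemma dlimD y z d e : dlim y d -> dlim z e -> dlim (y + z) (d + e).
Proof.
move=> [C hC] [C' hC']; exists (C + C')%N => m.
have [r [hr1 hr2]] := hC m; have [s [hs1 hs2]] := hC' m; exists (r + s).
by rewrite derivD !polyKD; split; rewrite opprD addrACA; apply: vgeD => //; [apply: vge_le hr2|apply: vge_le hs2]; lia.
Qed.

Lemma dlimM y z d e : vge q y 0 -> vge q z 0 -> dlim y d -> dlim z e ->
  dlim (y * z) (d * z + y * e).
Proof.
move=> hy hz hd he; have id := dlim_int hd; have ie := dlim_int he.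
case: hd he => [C hC] [C' hC']; exists (C + C')%N => m.
have [r [hr1 hr2]] := hC m; have [s [hs1 hs2]] := hC' m; exists (r * s).
have ir f : vge q (f @ t) 0 by apply: vge_polyK.
rewrite derivM !(polyKD, polyKM); split.
  have -> : y * z - r @ t * s @ t = y * (z - s @ t) + (y - r @ t) * s @ t.
    by move: (r @ t) (s @ t) => a b; ring.
  by apply: vgeD; [apply: vgeMl|apply: vgeMr].
have -> : d * z + y * e - (r^`() @ t * s @ t + r @ t * s^`() @ t) =
   ((d - r^`() @ t) * z + r^`() @ t * (z - s @ t)) + ((y - r @ t) * e + r @ t * (e - s^`() @ t)).
  by move: (r @ t) (s @ t) (r^`() @ t) (s^`() @ t) => a b a' b'; ring.
apply: vgeD; apply: vgeD; [apply: vgeMr => //|apply: vgeMl => //|apply: vgeMr => //|apply: vgeMl => //].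
- by apply: vge_le hr2; lia.
- by apply: vge_le hs1; lia.
- by apply: vge_le hr1; lia.
- by apply: vge_le hs2; lia.
Qed.

Lemma dlim_polyK r : dlim (r @ t) (r^`() @ t).
Proof. by exists 0%N => m; exists r; rewrite !subrr; split; left. Qed.

Lemma dlimXM y d n : vge q y 0 -> dlim y d ->
  dlim (t ^+ n * y) (t ^+ n.-1 *+ n * y + t ^+ n * d).
Proof.
move=> hy hd; apply: dlimM => //; first exact: vgeX0.
by have := dlim_polyK 'X^n; rewrite derivXn -mulr_natr -polyC_natr polyKM polyKC !polyKXn
  polyKX rmorph_nat mulr_natr.
Qed.

(** Extends [dlim] to elements with poles: t^n y is integral for large [n], and the derivative of
    [y] is read off from the product rule for t^n y. *)
Definition dlimK y d : Prop := exists n d1,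
  [/\ vge q (t ^+ n * y) 0, dlim (t ^+ n * y) d1 & t ^+ n * d = d1 - n%:R * t ^+ n.-1 * y].

Lemma dlimK_exists y : exists d, dlimK y d.
Proof.
pose n := absz (vp q y).
have hn : vge q (t ^+ n * y) 0.
  have -> : 0 = n%:Z + - n%:Z by rewrite subrr.
  by apply: vgeM; [right; rewrite vpX ht natz|right; rewrite /n; lia].
have [d hd] := dlim_exists hn.
exists (t ^- n * (d - n%:R * t ^+ n.-1 * y)), n, d; split=> //.
by rewrite mulrA mulfV ?mul1r // expf_neq0.
Qed.

Lemma dlimK_shift y d : dlimK y d -> exists n0, forall n, (n0 <= n)%N -> exists d1,
  [/\ vge q (t ^+ n * y) 0, dlim (t ^+ n * y) d1 & t ^+ n * d = d1 - n%:R * t ^+ n.-1 * y].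
Proof.
move=> [n0 [d1 [h1 h2 h3]]]; exists n0 => n hn; rewrite -(subnK hn).
elim: (n - n0)%N => [|m [d2 [i1 i2 i3]]]; first by exists d1.
rewrite addSn; move: (m + n0)%N i1 i2 i3 => l i1 i2 i3.
exists (t ^+ 0 *+ 1 * (t ^+ l * y) + t ^+ 1 * d2).
rewrite exprS -!mulrA; split; [by apply: vgeMl|by have := dlimXM 1 i1 i2|].
have e : t * (l%:R * (t ^+ l.-1 * y)) = l%:R * (t ^+ l * y).
  by case: (l) => [|l']; rewrite ?mul0r ?mulr0 // mulrCA exprS -mulrA.
rewrite i3 mulrBr -[l%:R * _ * y]mulrA e -natr1 expr1 expr0 mulr1n /=.
by move: (t ^+ l * y) (t * d2) (l%:R : K) => a b c; ring.
Qed.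

Lemma dlimK_uniq y d d' : dlimK y d -> dlimK y d' -> d = d'.
Proof.
move=> /dlimK_shift [n hn] /dlimK_shift [n' hn'].
have [d1 [_ h1 e1]] := hn (n + n')%N (leq_addr _ _).
have [d2 [_ h2 e2]] := hn' (n + n')%N (leq_addl _ _).
by apply: (mulfI (expf_neq0 (n + n') t0)); rewrite e1 e2 (dlim_uniq h1 h2).
Qed.

Lemma dlimKD y z d e : dlimK y d -> dlimK z e -> dlimK (y + z) (d + e).
Proof.
move=> /dlimK_shift [n hn] /dlimK_shift [n' hn'].
have [d1 [i1 h1 e1]] := hn (n + n')%N (leq_addr _ _).
have [d2 [i2 h2 e2]] := hn' (n + n')%N (leq_addl _ _).
exists (n + n')%N, (d1 + d2); rewrite mulrDr; split; [exact: vgeD|exact: dlimD|].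
by rewrite [LHS]mulrDr e1 e2 mulrDr opprD addrACA.
Qed.

Lemma dlimKM y z d e : dlimK y d -> dlimK z e -> dlimK (y * z) (d * z + y * e).
Proof.
move=> /dlimK_shift [n hn] /dlimK_shift [n' hn'].
have [d1 [i1 h1 e1]] := hn (n + n')%N (leq_addr _ _).
have [d2 [i2 h2 e2]] := hn' (n + n')%N (leq_addl _ _).
move: (n + n')%N i1 h1 e1 i2 h2 e2 => m i1 h1 e1 i2 h2 e2.
exists (m + m)%N, (d1 * (t ^+ m * z) + (t ^+ m * y) * d2).
rewrite exprD [_ * (y * z)]mulrACA; split; [exact: vgeMl|exact: dlimM|].
have -> : d1 = t ^+ m * d + m%:R * t ^+ m.-1 * y by rewrite e1 subrK.
have -> : d2 = t ^+ m * e + m%:R * t ^+ m.-1 * z by rewrite e2 subrK.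
have em : m%:R * t ^+ (m + m).-1 = m%:R * (t ^+ m.-1 * t ^+ m).
  by case: (m) => [|l]; rewrite ?mul0r // -exprD.
rewrite natrD !mulrDl em; move: (t ^+ m) (t ^+ m.-1) (m%:R : K) => a b c.
by ring.
Qed.

(** This is d/dt on the completion at [q], restricted to K; algebraicity over k(t) keeps its values
    in K. *)
Lemma local_derivation : exists D,
  [/\ is_derivation D, D t = 1 & forall y, vge q y 0 -> vge q (D y) 0].
Proof.
have /choice[D hD] := dlimK_exists.
have intK y d : vge q y 0 -> dlim y d -> dlimK y d.
  by move=> hy hd; exists 0%N, d; rewrite expr0 !mul1r !mul0r subr0.
have DE y d : vge q y 0 -> dlim y d -> D y = d.
  by move=> hy hd; apply: (dlimK_uniq (hD y)); apply: intK.
exists D; split.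
- split.
  + by move=> x y; apply: (dlimK_uniq (hD _)); apply: dlimKD.
  + by move=> x y; apply: (dlimK_uniq (hD _)); apply: dlimKM.
  + move=> c; apply: DE; first exact: vge_iota.
    by have := dlim_polyK c%:P; rewrite derivC polyK0 polyKC.
- apply: DE; first exact: tint.
  by have := dlim_polyK 'X; rewrite derivX polyK1 polyKX.
- move=> y hy; have [d hd] := dlim_exists hy.
  by rewrite (DE _ _ hy hd); apply: dlim_int hd.
Qed.

End LocalDerivation.
End Derivations.

Section Wronskian.
Variables (k : closedFieldType) (K : fieldType) (iota : {rmorphism k -> K}).
Implicit Types (q : place iota) (x y z : K).

Definition wronskian (D : K -> K) n (f : 'I_n -> K) : K :=
  \det (\matrix_(i < n, j < n) iter i D (f j)).

(** Normalise one coefficient to 1 and apply [D]: the derived coefficients form a relation with one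
    function and one derivative fewer. Either it is nontrivial and induction applies, or all
    coefficients are killed by [D] and are constants. *)
Lemma wronskian_dependent (D : K -> K) n (f c : 'I_n -> K) :
  is_derivation iota D -> (forall y, D y = 0 -> exists a, y = iota a) ->
  (exists i, c i != 0) -> (forall i : 'I_n, \sum_j c j * iter i D (f j) = 0) ->
  ~ k_indep iota f.
Proof.
move=> hD hc; elim: n f c => [|n IH] f c [i0 ci0] hsum indf; first by case: i0 ci0.
pose d j := c j / c i0.
have hd (i : 'I_n.+1) : \sum_j d j * iter i D (f j) = 0.
  under eq_bigr do rewrite /d mulrAC.
  by rewrite -mulr_suml hsum mul0r.
have di0 : d i0 = 1 by rewrite /d mulfV.
have hd' (i : 'I_n) : \sum_j D (d (lift i0 j)) * iter i D (f (lift i0 j)) = 0.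
  have := congr1 D (hd (widen_ord (leqnSn n) i)); rewrite (der_sum hD) (der0 hD).
  under eq_bigr do rewrite (derM hD).
  rewrite big_split /= -[X in _ + X = _]/(\sum_j d j * iter (lift ord0 i) D (f j)) hd addr0.
  rewrite (bigD1_ord i0) //= di0.
  have -> : D 1 = 0 by rewrite -(rmorph1 iota) (der_iota hD).
  by rewrite mul0r add0r.
have indl := k_indep_lift (i0 := i0) indf.
have [[j ej]|] := pselect (exists j, D (d (lift i0 j)) != 0).
  by apply: (IH (fun j => f (lift i0 j)) (fun j => D (d (lift i0 j)))) => //; exists j.
move=> hn; have /choice[a ha] : forall j, exists a, d j = iota a.
  move=> j; case: (unliftP i0 j) => [l ->|->]; last by exists 1; rewrite rmorph1.
  by apply: hc; apply/eqP/negPn/negP => h; apply: hn; exists l.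
have := indf a; under eq_bigr do rewrite -ha.
move=> /(_ (hd ord0) i0) a0; have := ha i0; rewrite a0 di0 rmorph0 => /eqP.
by rewrite oner_eq0.
Qed.

Lemma wronskian_neq0 (D : K -> K) n (f : 'I_n -> K) :
  is_derivation iota D -> (forall y, D y = 0 -> exists a, y = iota a) ->
  k_indep iota f -> wronskian D f != 0.
Proof.
move=> hD hc indf; apply/eqP => w0.
have : \det (\matrix_(i < n, j < n) iter i D (f j))^T == 0 by rewrite det_tr; apply/eqP.
case/det0P => v v0 hv.
apply: (wronskian_dependent (c := fun j => v 0 j) hD hc _ _ indf).
  apply/existsP; apply: contraNT v0; rewrite negb_exists => /forallP h.
  by apply/eqP/rowP => i; rewrite mxE; apply/eqP; move: (h i); rewrite negbK.
move=> i; have := congr1 (fun M : 'rV_n => M 0 i) hv; rewrite !mxE => e; rewrite -[RHS]e.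
by apply: eq_bigr => j _; rewrite !mxE.
Qed.

(** The coefficient of D^l f in (phi D)^i (g f). The resulting matrix is lower triangular with
    diagonal g phi^i, whence the factor g^n phi^(n(n-1)/2) in [wronskian_scale]. *)
Fixpoint leibniz_coef (D : K -> K) (phi g : K) (i l : nat) : K :=
  if i is i'.+1 then
    phi * (D (leibniz_coef D phi g i' l) +
           if l is l'.+1 then leibniz_coef D phi g i' l' else 0)
  else if l == 0%N then g else 0.

Lemma leibniz_coef_gt D phi g i l : is_derivation iota D -> (i < l)%N ->
  leibniz_coef D phi g i l = 0.
Proof.
move=> hD; elim: i l => [|i IH] [|l] //= hl.
by rewrite IH ?(ltn_trans _ hl) // IH // (der0 hD) addr0 mulr0.
Qed.

Lemma leibniz_coef_diag D phi g i : is_derivation iota D ->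
  leibniz_coef D phi g i i = g * phi ^+ i.
Proof.
move=> hD; elim: i => [|i IH] /=; first by rewrite mulr1.
by rewrite leibniz_coef_gt // (der0 hD) add0r IH exprS mulrCA.
Qed.

Lemma iter_leibniz D phi g i f : is_derivation iota D ->
  iter i (fun y => phi * D y) (g * f) = \sum_(l < i.+1) leibniz_coef D phi g i l * iter l D f.
Proof.
move=> hD; elim: i => [|i IH]; first by rewrite big_ord1.
rewrite iterS IH (der_sum hD) mulr_sumr.
transitivity (\sum_(l < i.+1) phi * D (leibniz_coef D phi g i l) * iter l D f +
    \sum_(l < i.+1) phi * leibniz_coef D phi g i l * iter l.+1 D f).
  by rewrite -big_split; apply: eq_bigr => l _; rewrite (derM hD) mulrDr !mulrA.
transitivity (\sum_(l < i.+2) phi * D (leibniz_coef D phi g i l) * iter l D f +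
    \sum_(l < i.+2) phi * (if l : nat is l'.+1 then leibniz_coef D phi g i l' else 0) * iter l D f).
  rewrite [X in _ = X + _]big_ord_recr /= leibniz_coef_gt // (der0 hD) mulr0 mul0r addr0; congr (_ + _).
  by rewrite [RHS]big_ord_recl /= mulr0 mul0r add0r.
by rewrite -big_split; apply: eq_bigr => l _; rewrite /= -mulrDl -mulrDr.
Qed.

Lemma wronskian_scale D phi g n (f : 'I_n -> K) : is_derivation iota D ->
  wronskian (fun y => phi * D y) (fun j => g * f j) = g ^+ n * phi ^+ 'C(n, 2) * wronskian D f.
Proof.
move=> hD; rewrite /wronskian.
pose L := \matrix_(i < n, l < n) leibniz_coef D phi g i l.
have -> : (\matrix_(i < n, j < n) iter i (fun y => phi * D y) (g * f j)) =
    L *m \matrix_(i < n, j < n) iter i D (f j).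
  apply/matrixP => i j; rewrite !mxE iter_leibniz //.
  rewrite (big_ord_widen n (fun l => leibniz_coef D phi g i l * iter l D (f j))) // big_mkcond.
  apply: eq_bigr => l _; rewrite !mxE; case: ltnP => // h.
  by rewrite leibniz_coef_gt // mul0r.
rewrite det_mulmx; congr (_ * _); rewrite det_trig; last first.
  by apply/is_trig_mxP => i j ij; rewrite mxE leibniz_coef_gt.
under eq_bigr do rewrite mxE leibniz_coef_diag //.
rewrite big_split /= prodr_const card_ord; congr (_ * _).
by rewrite prodrXr -bin2_sum big_mkord.
Qed.

Lemma wronskian_base (D : K -> K) n (f f' : 'I_n -> K) (B : 'I_n -> 'I_n -> k) :
  is_derivation iota D -> (forall i, f i = \sum_j iota (B i j) * f' j) ->
  wronskian D f = wronskian D f' * iota (\det (\matrix_(i, j) B i j)).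
Proof.
move=> hD hf; rewrite /wronskian.
have hD' i y z : iter i D (y + z) = iter i D y + iter i D z.
  by elim: i => //= i ->; rewrite (derD hD).
have hD0 i : iter i D 0 = 0 by elim: i => //= i ->; rewrite (der0 hD).
have hDc i c y : iter i D (iota c * y) = iota c * iter i D y.
  by elim: i => //= i ->; rewrite (der_iotaM hD).
rewrite -det_map_mx -[X in _ * X]det_tr -det_mulmx; congr (\det _).
apply/matrixP => i j; rewrite !mxE hf (big_morph (iter i D) (hD' i) (hD0 i)).
by apply: eq_bigr => l _; rewrite !mxE hDc mulrC.
Qed.

Section LocalBounds.
Variables (q : place iota) (t : K) (D : K -> K).
Hypotheses (ht : vp q t = 1) (hD : is_derivation iota D) (Dt : D t = 1).
Hypothesis Dint : forall y, vge q y 0 -> vge q (D y) 0.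

Let t0 : t != 0. Proof. by apply: (vp_neq0 (q := q)); rewrite ht. Qed.

Lemma vge_der y n : vge q y n -> vge q (D y) (n - 1).
Proof.
move=> hy; have tX m : vge q (t ^+ m) m by right; rewrite vpX ht natz.
have DX m : vge q (D (t ^+ m)) (m%:Z - 1).
  rewrite (derX hD) Dt mulr1; case: m => [|m]; first by rewrite mulr0n; left.
  rewrite -mulr_natr -(rmorph_nat iota) /=; apply: vgeMr; last exact: vge_iota.
  by apply: vge_le (tX m); lia.
case: n hy => n hy.
  have e : y = t ^+ n * (y / t ^+ n) by rewrite mulrC divfK // expf_neq0.
  have hu : vge q (y / t ^+ n) 0.
    have -> : 0 = n%:Z - n%:Z by rewrite subrr.
    by apply: vgeM => //; right; rewrite vpV vpX ht natz.
  rewrite e (derM hD); apply: vgeD; first exact: vgeMr.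
  by apply: vgeMr; [apply: vge_le (tX n); lia|apply: Dint].
have hu : vge q (t ^+ n.+1 * y) 0.
  have -> : 0 = n.+1%:Z + Negz n by rewrite NegzE subrr.
  exact: vgeM.
have tn0 := expf_neq0 n.+1 t0.
have -> : D y = (D (t ^+ n.+1 * y) - D (t ^+ n.+1) * y) / t ^+ n.+1.
  by rewrite (derM hD) addrC addKr mulrC mulKf.
have -> : Negz n - 1 = -1 + - n.+1%:Z by rewrite NegzE; lia.
apply: vgeM; last by right; rewrite vpV vpX ht natz.
apply: vgeB; first by apply: vge_le (Dint hu).
have -> : -1 = (n.+1%:Z - 1) + Negz n by rewrite NegzE; lia.
exact: vgeM.
Qed.

Lemma vge_iter_der y n i : vge q y n -> vge q (iter i D y) (n - i%:Z).
Proof.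
move=> hy; elim: i => [|i IH]; first by rewrite subr0.
rewrite iterS; have -> : n - i.+1%:Z = (n - i%:Z) - 1 by lia.
exact: vge_der.
Qed.

Lemma vge_det n (A : 'M[K]_n) (m l : 'I_n -> int) :
  (forall i j, vge q (A i j) (m j - l i)) -> vge q (\det A) (\sum_j m j - \sum_i l i).
Proof.
move=> hA; apply: vge_sum => s _; apply: vgeMl.
  have -> : (-1) ^+ s = iota ((-1) ^+ s) :> K by rewrite rmorphXn rmorphN1.
  exact: vge_iota.
have -> : \sum_j m j - \sum_i l i = \sum_i (m (s i) - l i).
  rewrite sumrB (reindex_inj (@perm_inj _ s)) //.
by apply: vge_prod => i _.
Qed.

Lemma vge_wronskian n (f : 'I_n -> K) (m : 'I_n -> int) :
  (forall j, vge q (f j) (m j)) -> vge q (wronskian D f) (\sum_j m j - 'C(n, 2)%:Z).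
Proof.
move=> hf; have -> : 'C(n, 2)%:Z = \sum_(i < n) (i : nat)%:Z.
  by rewrite -bin2_sum big_mkord -natz natr_sum; apply: eq_bigr => i _; rewrite natz.
by apply: vge_det => i j; rewrite mxE; apply: vge_iter_der.
Qed.

(** The common factor t^m comes out of the Wronskian as its n-th power, so, in contrast to
    [vge_wronskian], no order is lost to differentiation. *)
Lemma vge_wronskian_common n (f : 'I_n -> K) (m : nat) :
  (forall j, vge q (f j) m) -> vge q (wronskian D f) (n * m)%N.
Proof.
move=> hf; have tm0 := expf_neq0 m t0.
have -> : wronskian D f = (t ^+ m) ^+ n * wronskian D (fun j => f j / t ^+ m).
  have := @wronskian_scale D 1 (t ^+ m) n (fun j => f j / t ^+ m) hD.
  rewrite expr1n mulr1 => <-; rewrite /wronskian; congr (\det _); apply/matrixP => i j.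
  rewrite !mxE [_ * (_ / _)]mulrC divfK //; apply: eq_iter => y; by rewrite mul1r.
apply: vgeMr.
  by rewrite -exprM mulnC; right; rewrite vpX ht natz.
rewrite /wronskian -[0](subrr (\sum_(i < n) (0 : int))); apply: vge_det => i j.
rewrite subr0 mxE; elim: (i : nat) => [|l IH]; last exact: Dint.
have -> : 0 = m%:Z - m%:Z by rewrite subrr.
by apply: vgeM => //; right; rewrite vpV vpX ht natz.
Qed.

End LocalBounds.

Lemma sum_sub_seq (T : eqType) (s s' : seq T) (F : T -> int) :
  uniq s -> uniq s' -> {subset s <= s'} ->
  \sum_(q <- s') (if q \in s then F q else 0) = \sum_(q <- s) F q.
Proof.
move=> us us' ss; rewrite -big_mkcond -big_filter; apply: perm_big.
apply: uniq_perm => //; first exact: filter_uniq.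
by move=> q; rewrite mem_filter; case: (boolP (q \in s)) => // /ss ->.
Qed.

Definition indep_on (I : finType) (A : {set I}) (f : I -> K) : Prop :=
  forall c : I -> k, \sum_(i in A) iota (c i) * f i = 0 -> forall i, i \in A -> c i = 0.

(** A recombination over k changes the Wronskian by a constant factor, so at a place of [S] its
    order can be estimated with whichever functions have the largest total value there. *)
Definition adapted_basis q (I : finType) (A : {set I}) (f : I -> K) (m : int) : Prop :=
  exists f' (B : I -> I -> k) (n : I -> int),
  [/\ forall i, i \in A -> f i = \sum_(j in A) iota (B i j) * f' j,
      forall j, j \in A -> vge q (f' j) (n j) & m <= \sum_(j in A) n j].

(* [phi q * D] plays the role of the derivation with respect to a local parameter
   at [q], so that [vp q (phi q)] is the order at [q] of the differential dual to [D]. *)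
Definition global_derivation (D : K -> K) (phi : place iota -> K) (p : place iota) (d : int) : Prop :=
  [/\ is_derivation iota D, forall y, D y = 0 -> exists a, y = iota a,
      forall q, exists t, [/\ vp q t = 1, phi q * D t = 1 &
        forall y, vge q y 0 -> vge q (phi q * D y) 0]
    & forall s, uniq s -> p \in s -> \sum_(q <- s) vp q (phi q) <= d].

Variables (D : K -> K) (phi : place iota -> K) (p : place iota) (d : int).
Hypotheses (hD : global_derivation D phi p d) (hK : is_function_field iota).
Variables (gen : nat) (hgen : is_genus iota gen).

(** Replacing [D] by the local derivation [phi q * D] adds C v_q(phi q) to the order of the
    Wronskian, C being the binomial coefficient. Summed over all places, the order of the global
    Wronskian cancels by the product formula and the rest is at most C d; each place of [S] costs a
    further C for the derivatives. *)
Lemma wronskian_bound (I : finType) (A : {set I}) (f : I -> K)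
    (S T : seq (place iota)) (e : place iota -> int) :
  indep_on A f -> uniq T -> {subset S <= T} ->
  (forall q, q \in S -> adapted_basis q A f (e q)) ->
  (forall q, q \notin S -> exists m : nat,
     (forall i, i \in A -> vge q (f i) m) /\ e q <= (#|A| * m)%N) ->
  \sum_(q <- T) e q <= 'C(#|A|, 2)%:Z * (d + (size (undup S))%:Z).
Proof.
move=> indf uT ST hS hN; case: hD => hDer hconst hloc hd.
pose g (i : 'I_#|A|) := f (enum_val i).
have indg : k_indep iota g.
  move=> c hc i.
  pose c' (x : I) := if x \in A =P true is ReflectT h then c (enum_rank_in h x) else 0.
  have c'E j : c' (enum_val j) = c j.
    rewrite /c'; case: eqP => [h|[]]; last by rewrite enum_valP.
    by rewrite enum_valK_in.
  rewrite -c'E; apply: indf (enum_valP i).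
  by rewrite big_enum_val -[RHS]hc; apply: eq_bigr => j _; rewrite c'E.
pose W := wronskian D g; have W0 : W != 0 by apply: wronskian_neq0.
pose C := 'C(#|A|, 2).
have phi0 q : phi q != 0.
  have [t [_ h _]] := hloc q; apply/eqP => e0; move: h; rewrite e0 mul0r => /eqP.
  by rewrite eq_sym oner_eq0.
have [Wq0 Wq] : (forall q, wronskian (fun y => phi q * D y) g != 0) /\
    forall q, vp q (wronskian (fun y => phi q * D y) g) = vp q (phi q) *+ C + vp q W.
  have eW q : wronskian (fun y => phi q * D y) g = phi q ^+ C * W.
    have := @wronskian_scale D (phi q) 1 _ g hDer; rewrite expr1n mul1r => <-.
    by congr wronskian; apply/funext => j; rewrite mul1r.
  by split=> q; rewrite eW; [rewrite mulf_neq0 ?expf_neq0|rewrite vpM ?expf_neq0 // vpX].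
have derq q : is_derivation iota (fun y => phi q * D y).
  split=> [x y|x y|c]; rewrite ?(derD hDer) ?(derM hDer) ?(der_iota hDer) ?mulr0 ?mulrDr //.
  by rewrite mulrA mulrCA.
have lbS q : q \in S -> e q - C%:Z <= vp q (phi q) *+ C + vp q W.
  move=> /hS [f' [B [n [hf hn he]]]]; have [t [ht h1 h2]] := hloc q.
  rewrite -Wq; apply: (vgeE (Wq0 q)).
  rewrite (@wronskian_base _ _ g (fun j => f' (enum_val j))
            (fun i j => B (enum_val i) (enum_val j)) (derq q)); last first.
    by move=> i; rewrite /g hf ?enum_valP // big_enum_val.
  apply: vgeMr; last exact: vge_iota.
  apply: (@vge_le _ _ _ _ _ _ (\sum_(j < #|A|) n (enum_val j) - C%:Z)).
    by rewrite lerD2r (le_trans he) // big_enum_val.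
  by apply: (vge_wronskian ht (derq q) h1 h2) => j; apply: hn; apply: enum_valP.
(* The maximum with 0 serves the places of the larger list [T'] outside [T], where the order only
   has to be nonnegative. *)
have lbN q : q \notin S -> Num.max 0 (e q) <= vp q (phi q) *+ C + vp q W.
  move=> /hN [m [hf he]]; have [t [ht h1 h2]] := hloc q.
  rewrite -Wq; apply: (@le_trans _ _ (Posz (#|A| * m)%N)); first by rewrite ge_max he.
  apply: (vgeE (Wq0 q)).
  by apply: (vge_wronskian_common ht (derq q) h2) => j; apply: hf; apply: enum_valP.
have [s0 hs0] := finite_vp_support hK W.
pose T' := undup (p :: s0 ++ T).
have uT' : uniq T' by apply: undup_uniq.
have TT' : {subset T <= T'} by move=> q qT; rewrite mem_undup in_cons mem_cat qT !orbT.
have pf : \sum_(q <- T') vp q W = 0.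
  apply: (product_formula hK hgen) => // q /hs0 h.
  by rewrite mem_undup in_cons mem_cat h orbT.
have dT : \sum_(q <- T') vp q (phi q) <= d.
  by apply: hd => //; rewrite mem_undup mem_head.
have : \sum_(q <- T') ((if q \in T then e q else 0) - (if q \in undup S then C%:Z else 0)) <=
       \sum_(q <- T') (vp q (phi q) *+ C + vp q W).
  apply: ler_sum => q _; rewrite mem_undup; case: (boolP (q \in S)) => qS.
    by rewrite ST //; apply: lbS.
  rewrite subr0; apply: le_trans (lbN q qS).
  by case: ifP => _; rewrite le_max lexx ?orbT.
rewrite sumrB big_split /= pf addr0 sumrMnl !sum_sub_seq ?undup_uniq //; last first.
  by move=> q; rewrite mem_undup => /ST /TT'.
rewrite big_const_seq count_predT iter_addr_0 => h.
rewrite mulrDr -lerBlDr -[X in _ - _ * X]natz mulr_natr; apply: le_trans h _.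
by rewrite -mulr_natl natz; apply: ler_wpM2l.
Qed.

End Wronskian.

(** * Linear algebra over k[X] for the discriminant *)

Lemma nilpotent_trace (F : closedFieldType) n (A : 'M[F]_n.+1) m : A ^+ m = 0 -> \tr A = 0.
Proof.
move=> A0; have [rs ers] := closed_field_poly_normal (char_poly A).
move: ers; rewrite (monicP (char_poly_monic A)) scale1r => ers.
have srs : size rs = n.+1.
  by apply/eqP; rewrite -eqSS -(size_prod_XsubC rs id) -ers size_char_poly.
have r0 r : r \in rs -> r = 0.
  move=> hr; have : root (char_poly A) r by rewrite ers root_prod_XsubC.
  rewrite -eigenvalue_root_char => /eigenvalueP [v hv v0].
  have hX l : v *m (A ^+ l) = r ^+ l *: v.
    elim: l => [|l IH]; first by rewrite !expr0 scale1r mulmx1.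
    by rewrite exprSr -mulmxE mulmxA IH -scalemxAl hv scalerA -exprSr.
  have := hX m; rewrite A0 mulmx0 => /esym/eqP.
  by rewrite scaler_eq0 (negbTE v0) orbF expf_eq0 => /andP[_ /eqP].
have : char_poly A = 'X^(n.+1).
  rewrite ers (eq_big_seq (fun=> 'X)) => [|r /r0 ->]; last by rewrite subr0.
  by rewrite big_const_seq count_predT srs iter_mulr_1.
move=> e; have := char_poly_trace A (ltn0Sn n).
rewrite e coefXn /= => /eqP.
by rewrite -[n == n.+1]negbK neq_ltn ltnSn /= eq_sym oppr_eq0 => /eqP.
Qed.

(** Row operations over F that bring the matrix at [c] into rank normal form leave n - rank rows
    divisible by X - c, and each contributes one factor to the determinant. *)
Lemma det_corank_dvd (F : fieldType) n (T : 'M[{poly F}]_n) (c : F) :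
  ('X - c%:P) ^+ (n - \rank (map_mx (horner_eval c) T)) %| \det T.
Proof.
set Tc := map_mx _ T; set r := \rank Tc.
pose L := invmx (col_ebase Tc).
have uL : L \in unitmx by rewrite unitmx_inv col_ebase_unit.
pose T' := map_mx polyC L *m T.
have eT' : map_mx (horner_eval c) T' = pid_mx r *m row_ebase Tc.
  rewrite map_mxM -/Tc -[in LHS](mulmx_ebase Tc) -map_mx_comp.
  rewrite [map_mx _ L](_ : _ = L); last by apply/matrixP => i j; rewrite !mxE /= /horner_eval hornerC.
  by rewrite !mulmxA mulVmx ?col_ebase_unit // mul1mx.
have dvdT' (i j : 'I_n) : (r <= i)%N -> 'X - c%:P %| T' i j.
  move=> hi; rewrite dvdp_XsubCl; apply/eqP.
  have -> : (T' i j).[c] = (pid_mx r *m row_ebase Tc : 'M_n) i j by rewrite -eT' [RHS]mxE.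
  rewrite mxE big1 // => l _; rewrite mxE ltnNge hi andbF mul0r //.
have detT' : \det T' = (\det L)%:P * \det T by rewrite det_mulmx det_map_mx.
have detL : \det L != 0 by rewrite -unitfE -unitmxE.
rewrite -(dvdpZr _ (\det T) detL) -mul_polyC -detT'.
pose d (i : 'I_n) : {poly F} := if (r <= i)%N then 'X - c%:P else 1.
have -> : T' = diag_mx (\row_i d i) *m \matrix_(i, j) (T' i j %/ d i).
  apply/matrixP => i j; rewrite mul_diag_mx [RHS]mxE [X in X * _]mxE [X in _ * X]mxE /d; case: ifP => hi; last by rewrite divp1 mul1r.
  by rewrite mulrC divpK // dvdT'.
rewrite det_mulmx det_diag; apply: dvdp_mulr.
rewrite (eq_bigr d) => [|i _]; last by rewrite mxE.
rewrite /d -big_mkcond prodr_const; rewrite dvdp_exp2l //.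
rewrite -[X in (X - _)%N]card_ord -(cardC (fun i : 'I_n => (r <= i)%N)) leq_subLR addnC.
rewrite leq_add2r -[X in (_ <= X)%N](card_ord r); have hr : (r <= n)%N := rank_leq_row _.
apply: leq_trans (leq_image_card (@widen_ord r n hr) 'I_r).
apply: subset_leq_card. apply/fintype.subsetP => i; rewrite !inE -ltnNge => hi.
by apply/fintype.imageP; exists (Ordinal hi) => //; apply: val_inj.
Qed.

Lemma prod_XsubC_exp_dvd (F : fieldType) (cs : seq F) (n : F -> nat) (p : {poly F}) :
  uniq cs -> (forall c, c \in cs -> ('X - c%:P) ^+ n c %| p) ->
  \prod_(c <- cs) ('X - c%:P) ^+ n c %| p.
Proof.
elim: cs => [|c cs IH]; first by rewrite big_nil dvd1p.
move=> /= /andP[ccs ucs] h; rewrite big_cons Gauss_dvdp.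
  rewrite h ?mem_head //=; apply: IH => // a acs; apply: h.
  by rewrite in_cons acs orbT.
rewrite coprimep_expl // coprimep_sym coprimep_XsubC /root horner_prod prodf_seq_neq0.
apply/allP => a acs /=; rewrite horner_exp hornerXsubC expf_neq0 // subr_eq0.
by apply: contraNneq ccs => ->.
Qed.

Lemma sum_exp_XsubC_le (F : fieldType) (cs : seq F) (n : F -> nat) (p : {poly F}) :
  uniq cs -> p != 0 -> (forall c, c \in cs -> ('X - c%:P) ^+ n c %| p) ->
  (\sum_(c <- cs) n c <= (size p).-1)%N.
Proof.
move=> ucs p0 h; have := dvdp_leq p0 (prod_XsubC_exp_dvd ucs h).
suff -> : size (\prod_(c <- cs) ('X - c%:P) ^+ n c) = (\sum_(c <- cs) n c).+1.
  by move=> h1; rewrite -ltnS (ltn_predK h1).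
elim: cs {ucs h} => [|c cs IH]; first by rewrite !big_nil size_poly1.
rewrite !big_cons size_monicM ?monic_exp ?monicXsubC //.
  by rewrite IH size_exp_XsubC addSn addnS.
by rewrite -size_poly_gt0 IH.
Qed.

(** * A differential of degree at most [2 * gen - 2] *)

Section Apery.
Variables (k : closedFieldType) (K : fieldType) (iota : {rmorphism k -> K}).
Implicit Types (q : place iota) (x y z w : K).
Local Notation "r @ x" := (polyK iota r x) (at level 35).
Hypotheses (hK : is_function_field iota) (char0 : [pchar k] =i pred0).
Variables (gen : nat) (p : place iota).
Hypothesis hgen : is_genus iota gen.

Lemma gap_family (J : finType) (h : J -> nat) :
  injective h -> (forall j, ~ nongap p (h j)) -> (#|J| <= gen)%N.
Proof.
move=> injh hh; pose m := (\max_j h j).+1.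
have hm j : (h j < m)%N by rewrite ltnS leq_bigmax.
apply: leq_trans (gaps_bound hK hgen p m).
pose G : pred 'I_m := fun j => ~~ `[< nongap p j >].
have -> : (\sum_(j < m) ~~ `[< nongap p j >] = #|G|)%N.
  by rewrite -sum1_card [RHS]big_mkcond; apply: eq_bigr => j _; rewrite unfold_in; case: asboolP.
pose h' j : 'I_m := Ordinal (hm j).
have injh' : injective h' by move=> i j [] /injh.
rewrite -(card_codom injh'); apply: subset_leq_card; apply/fintype.subsetP => _ /codomP[j ->].
by rewrite unfold_in; apply/asboolPn; apply: hh.
Qed.

Lemma exists_nongap : exists e, nongap p e.+1.
Proof.
apply: contrapT => hn; have : (#|'I_gen.+1| <= gen)%N.
  apply: (@gap_family _ (fun i : 'I_gen.+1 => i.+1)) => [i j []|j hj]; first exact: val_inj.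
  by apply: hn; exists j.
by rewrite card_ord ltnn.
Qed.

Lemma exists_nongap_mod e i : (i <= e)%N -> exists l, nongap p (i + e.+1 * l).
Proof.
move=> ie; apply: contrapT => hn; have : (#|'I_gen.+1| <= gen)%N.
  apply: (@gap_family _ (fun l : 'I_gen.+1 => (i + e.+1 * l)%N)) => [l j /eqP|j hj].
    by rewrite eqn_add2l eqn_mul2l /= => /eqP /val_inj.
  by apply: hn; exists j.
by rewrite card_ord ltnn.
Qed.

(* [y i] has the least pole order congruent to [i] modulo the pole order [e.+1] of [f]. *)
Definition apery (e : nat) (f : K) (y : 'I_e.+1 -> K) (t : 'I_e.+1 -> nat) : Prop :=
  [/\ regular_off p f /\ vp p f = - e.+1%:Z, forall i, regular_off p (y i),
      forall i, y i != 0 /\ vp p (y i) = - (i + e.+1 * t i)%N%:Z,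
      forall (i : 'I_e.+1) l, nongap p (i + e.+1 * l) -> (t i <= l)%N
    & (\sum_i t i <= gen)%N].

Lemma exists_apery : exists e f (y : 'I_e.+1 -> K) t, apery f y t.
Proof.
have [e [f [fr f0 vf]]] := exists_nongap.
have /choice[t ht] : forall i : 'I_e.+1, exists t, nongap p (i + e.+1 * t) /\
    forall l, nongap p (i + e.+1 * l) -> (t <= l)%N.
  move=> i; have [l hl] := exists_nongap_mod (leq_ord i).
  have ex : exists l, `[< nongap p (i + e.+1 * l) >] by exists l; apply/asboolP.
  case: (ex_minnP ex) => m /asboolP hm hmin; exists m; split=> // l' hl'.
  by apply: hmin; apply/asboolP.
have /choice[y hy] : forall i : 'I_e.+1, exists z,
    [/\ regular_off p z, z != 0 & vp p z = - (i + e.+1 * t i)%N%:Z].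
  by move=> i; case: (ht i).
exists e, f, y, t; split=> // [i|i|i l|]; try by case: (hy i).
  by case: (ht i) => _; apply.
(* Every i + (e + 1) l with l < t i is a gap by minimality of [t i], and these numbers are pairwise
   distinct, which bounds the sum of the [t i]. *)
have := @gap_family {i : 'I_e.+1 & 'I_(t i)}
  (fun u => (tag u + e.+1 * (tagged u : nat))%N).
rewrite card_tagged sumnE big_map big_enum /=.
under eq_bigr do rewrite card_ord.
apply.
  move=> [i l] [j m] /= h.
  have eij : i = j.
    by apply: val_inj; have := congr1 (modn^~ e.+1) h; rewrite !(addnC _ (e.+1 * _)%N) !(mulnC e.+1) !modnMDl !modn_small.
  subst j; congr existT; apply: val_inj; move/eqP: h.
  by rewrite eqn_add2l eqn_mul2l /= => /eqP.
move=> [i l] /= hn; have := (ht i).2 l hn.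
by rewrite leqNgt ltn_ord.
Qed.

Section AperyBasis.
Variables (e : nat) (f : K) (y : 'I_e.+1 -> K) (t : 'I_e.+1 -> nat).
Hypothesis hA : apery f y t.

Let rho (i : 'I_e.+1) := (i + e.+1 * t i)%N.

Let freg : regular_off p f. Proof. by case: hA => -[]. Qed.
Let vf : vp p f = - e.+1%:Z. Proof. by case: hA => -[]. Qed.
Let yreg i : regular_off p (y i). Proof. by case: hA. Qed.
Let vy i : vp p (y i) = - (rho i)%:Z. Proof. by case: hA => _ _ h _ _; case: (h i). Qed.
Let y0 i : y i != 0. Proof. by case: hA => _ _ h _ _; case: (h i). Qed.
Let f0 : f != 0. Proof. by apply: (vp_neq0 (q := p)); rewrite vf. Qed.
Let tf : transc iota f.
Proof. by apply: notconst_transc => c e0; move: vf; rewrite e0 vp_iota. Qed.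

Lemma regular_off_polyK r x : regular_off p x -> regular_off p (r @ x).
Proof. by move=> hx q qp; apply: vge_polyK; apply: hx. Qed.

Definition lincomb (a : 'I_e.+1 -> {poly k}) : K := \sum_i a i @ f * y i.

Lemma vp_lincomb_term (r : {poly k}) i :
  r @ f * y i != 0 -> vp p (r @ f * y i) = - (e.+1 * (size r).-1 + rho i)%N%:Z.
Proof.
rewrite mulf_eq0 negb_or => /andP[h1 h2].
by rewrite vpM // vp_polyK_pole // vf ?vy //; lia.
Qed.

(** The pole order of a(f) y_i is congruent to [i] modulo e + 1, the pole order of [f]. *)
Lemma lincomb_distinct (a : 'I_e.+1 -> {poly k}) i j :
  a i @ f * y i != 0 -> a j @ f * y j != 0 ->
  vp p (a i @ f * y i) = vp p (a j @ f * y j) -> i = j.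
Proof.
move=> hi hj; rewrite !vp_lincomb_term // => /oppr_inj [] h.
apply: val_inj; have := congr1 (modn^~ e.+1) h.
have key (u : 'I_e.+1) l m : ((e.+1 * l + (u + e.+1 * m)) %% e.+1 = u)%N.
  by rewrite addnCA -mulnDr addnC mulnC modnMDl modn_small.
by rewrite /= !key.
Qed.

Lemma lincomb_eq0 a : lincomb a = 0 -> forall i, a i = 0.
Proof.
move=> h i; apply/eqP/negPn/negP => ai.
have ti : a i @ f * y i != 0.
  by rewrite mulf_neq0 //; apply/eqP => /tf /eqP; rewrite (negbTE ai).
by have [] := vp_sum_distinct (@lincomb_distinct a) ti; rewrite -/(lincomb a) h eqxx.
Qed.

Lemma lincombD a b : lincomb a + lincomb b = lincomb (fun i => a i + b i).
Proof. by rewrite /lincomb -big_split; apply: eq_bigr => i _; rewrite polyKD mulrDl. Qed.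

Lemma lincombM r a : r @ f * lincomb a = lincomb (fun i => r * a i).
Proof. by rewrite /lincomb mulr_sumr; apply: eq_bigr => i _; rewrite polyKM mulrA. Qed.

Lemma lincomb_inj a b : lincomb a = lincomb b -> a =1 b.
Proof.
move=> h i; have := @lincomb_eq0 (fun i => a i + (- 1) * b i).
rewrite -lincombD -lincombM h polyKN polyK1 mulN1r subrr => /(_ erefl i) /eqP.
by rewrite mulN1r subr_eq0 => /eqP.
Qed.

Lemma lincomb_delta i r : lincomb (fun j => if j == i then r else 0) = r @ f * y i.
Proof.
rewrite /lincomb (bigD1 i) //= eqxx big1 ?addr0 // => j /negbTE ->.
by rewrite polyK0 mul0r.
Qed.

(** Induction on the pole order [m]: for [i] its residue modulo e + 1, minimality of [t i] makes
    some f^j y_i a function of pole order exactly [m], and subtracting a constant multiple of it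
    lowers the pole of [z]. *)
Lemma apery_span m z : Lspace p m z -> exists a, z = lincomb a /\
  forall i, a i != 0 -> (e.+1 * (size (a i)).-1 + rho i < m)%N.
Proof.
elim: m z => [|m IH] z [zr zv].
  exists (fun=> 0); split=> [|i]; last by rewrite eqxx.
  rewrite /lincomb big1 => [|i _]; last by rewrite polyK0 mul0r.
  apply/eqP/negPn/negP => z0; have := vgeE z0 zv.
  by have := regular_off_vp hK zr z0; lia.
have [zv'|zv'] := pselect (vge p z (1 - m%:Z)).
  have [a [ea ha]] := IH z (conj zr zv'); exists a; split=> // i /ha; exact: ltnW.
have z0 : z != 0 by apply/eqP => h; apply: zv'; left.
have vz : vp p z = - m%:Z.
  have := vgeE z0 zv; suff : ~ (1 - m%:Z <= vp p z) by lia.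
  by move=> h; apply: zv'; right.
have im : (m %% e.+1 < e.+1)%N by rewrite ltn_mod.
pose i := Ordinal im; pose l := (m %/ e.+1)%N.
have em : m = (i + e.+1 * l)%N by rewrite mulnC addnC -divn_eq.
have tl : (t i <= l)%N.
  by case: hA => _ _ _ h _; apply: h; rewrite -em; exists z.
pose j := (l - t i)%N; pose w := f ^+ j * y i.
have w0 : w != 0 by rewrite mulf_neq0 // expf_neq0.
have vw : vp p w = - m%:Z.
  rewrite vpM ?expf_neq0 // vpX vf vy /rho em -mulr_natr natz /j; nia.
have wr : regular_off p w.
  by have := regular_offM (regular_off_polyK 'X^j freg) (yreg i); rewrite polyKXn polyKX.
have [c hc] : exists c, vge p (z / w - iota c) 1.
  by apply: residue => //; right; rewrite vpM ?invr_eq0 // vpV vz vw subrr.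
have [|a [ea ha]] := IH (z - iota c * w); first split.
- by apply: regular_offD => //; apply: regular_offN; apply: regular_offM => //; apply: regular_off_iota.
- have -> : z - iota c * w = (z / w - iota c) * w by rewrite mulrBl divfK.
  by apply: vgeM => //; right; rewrite vw.
exists (fun i' => a i' + (if i' == i then c%:P * 'X^j else 0)); split.
  rewrite -lincombD -ea lincomb_delta polyKM polyKC polyKXn polyKX -mulrA -/w.
  by rewrite subrK.
move=> i' /=; case: (eqVneq i' i) => [->|_]; last by rewrite addr0 => /ha /ltnW.
move=> h.
have hj : (e.+1 * j + rho i <= m)%N by rewrite /rho em /j; nia.
have sc : (size (c%:P * 'X^j)%R <= j.+1)%N.
  by rewrite mul_polyC; apply: leq_trans (size_scale_leq _ _) _; rewrite size_polyXn.
have := size_polyD (a i) (c%:P * 'X^j); rewrite leq_max => /orP[] hs.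
  have [ai|ai] := eqVneq (a i) 0.
    by move: hs h; rewrite ai size_poly0 add0r leqn0 size_poly_eq0 => ->.
  have h1 : ((size (a i + c%:P * 'X^j)%R).-1 <= (size (a i)).-1)%N.
    by rewrite -!subn1 leq_sub2r.
  apply: leq_trans (leqnSn _); apply: leq_trans (ha i ai).
  by rewrite ltnS leq_add2r leq_mul2l h1 orbT.
have h1 : ((size (a i + c%:P * 'X^j)%R).-1 <= j)%N.
  by rewrite -subn1 leq_subLR add1n (leq_trans hs sc).
by rewrite ltnS (leq_trans _ hj) // leq_add2r leq_mul2l h1 orbT.
Qed.

Lemma regular_off_Lspace z : regular_off p z -> exists m, Lspace p m z.
Proof.
by move=> hz; exists (absz (vp p z)).+1; split=> //; right; lia.
Qed.

(** Regularity is placed under the existential, with the matrix 0 as default, so that [mulmat] is a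
    total function. *)
Lemma mulmat_exists z : exists M : 'M[{poly k}]_e.+1,
  regular_off p z -> forall i, z * y i = lincomb (M i).
Proof.
have [hz|nz] := pselect (regular_off p z); last by exists 0.
have /choice[a ha] : forall i, exists a, z * y i = lincomb a.
  move=> i; have [m hm] := regular_off_Lspace (regular_offM hz (yreg i)).
  by have [a [ea _]] := apery_span hm; exists a.
exists (\matrix_(i, j) a i j) => _ i; rewrite ha; apply: eq_bigr => j _.
by rewrite mxE.
Qed.

Definition mulmat z : 'M[{poly k}]_e.+1 := projT1 (cid (mulmat_exists z)).

Lemma mulmatE z i : regular_off p z -> z * y i = lincomb (mulmat z i).
Proof. by move=> hz; rewrite /mulmat; case: cid => M /= h; apply: h. Qed.

Lemma mulmat_uniq z (N : 'M[{poly k}]_e.+1) : regular_off p z ->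
  (forall i, z * y i = lincomb (N i)) -> mulmat z = N.
Proof.
move=> hz h; apply/matrixP => i j.
by apply: (@lincomb_inj (mulmat z i) (N i)); rewrite -mulmatE.
Qed.

Lemma mulmatD z w : regular_off p z -> regular_off p w ->
  mulmat (z + w) = mulmat z + mulmat w.
Proof.
move=> hz hw; apply: mulmat_uniq => [|i]; first exact: regular_offD.
rewrite mulrDl !mulmatE // lincombD; apply: eq_bigr => j _; by rewrite mxE.
Qed.

Lemma mulmatZ r z : regular_off p z -> mulmat (r @ f * z) = r *: mulmat z.
Proof.
move=> hz; apply: mulmat_uniq => [|i].
  by apply: regular_offM => //; apply: regular_off_polyK.
rewrite -mulrA mulmatE // lincombM; apply: eq_bigr => j _; by rewrite mxE.
Qed.

Lemma mulmat1 : mulmat 1 = 1%:M.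
Proof.
apply: mulmat_uniq => [q _|i]; first exact: vge_one.
transitivity (1 @ f * y i); first by rewrite polyK1.
rewrite -lincomb_delta; apply: eq_bigr => j _; rewrite mxE eq_sym.
by case: (i == j).
Qed.

(** Row [i] of [mulmat z] holds the coordinates of z y_i, so the factors come in reverse order. *)
Lemma mulmatM z w : regular_off p z -> regular_off p w ->
  mulmat (z * w) = mulmat w *m mulmat z.
Proof.
move=> hz hw; apply: mulmat_uniq => [|i]; first exact: regular_offM.
rewrite -mulrA mulmatE // /lincomb mulr_sumr.
transitivity (\sum_j \sum_l (mulmat w i j * mulmat z j l) @ f * y l).
  apply: eq_bigr => j _; rewrite mulrCA mulmatE // lincombM.
  by [].
rewrite exchange_big; apply: eq_bigr => l _.
by rewrite mxE polyK_sum mulr_suml.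
Qed.

Lemma regular_offX z n : regular_off p z -> regular_off p (z ^+ n).
Proof. by move=> hz q qp; apply: vgeX0; apply: hz. Qed.

Lemma mulmatX z n : regular_off p z -> mulmat (z ^+ n) = mulmat z ^+ n.
Proof.
move=> hz; elim: n => [|n IH]; first by rewrite !expr0 mulmat1.
by rewrite exprS (mulmatM hz (regular_offX n hz)) IH [RHS]exprSr.
Qed.

Definition trK z : {poly k} := \tr (mulmat z).

(** Degree measured by pole order: [f] has a pole of order e + 1, so r(f) has a pole of order at
    most [b] at [p]. *)
Definition degle (b : nat) (r : {poly k}) : Prop :=
  r = 0 \/ (e.+1 * (size r).-1 <= b)%N.

Lemma degleD b r s : degle b r -> degle b s -> degle b (r + s).
Proof.
move=> [->|hr]; first by rewrite add0r.
move=> [->|hs]; first by rewrite addr0; right.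
right; have := size_polyD r s; rewrite leq_max => /orP[] h.
  by apply: leq_trans hr; rewrite leq_mul2l -!subn1 leq_sub2r ?orbT.
by apply: leq_trans hs; rewrite leq_mul2l -!subn1 leq_sub2r ?orbT.
Qed.

Lemma degleM b c r s : degle b r -> degle c s -> degle (b + c) (r * s).
Proof.
move=> [->|hr]; first by rewrite mul0r; left.
move=> [->|hs]; first by rewrite mulr0; left.
have [->|r0] := eqVneq r 0; first by rewrite mul0r; left.
have [->|s0] := eqVneq s 0; first by rewrite mulr0; left.
right; apply: leq_trans (leq_add hr hs); rewrite -mulnDr leq_mul2l size_mul //.
have : (0 < size r)%N by rewrite size_poly_gt0.
have : (0 < size s)%N by rewrite size_poly_gt0.
by move: (size r) (size s) => a a' ha ha'; apply/orP; right; lia.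
Qed.

Lemma degle_sum (I : Type) (s : seq I) (P : pred I) (F : I -> {poly k}) b :
  (forall i, P i -> degle b (F i)) -> degle b (\sum_(i <- s | P i) F i).
Proof. by move=> h; elim/big_ind: _ => //; [left|move=> *; apply: degleD]. Qed.

Lemma degle_prod (I : Type) (s : seq I) (F : I -> {poly k}) (b : I -> nat) :
  (forall i, degle (b i) (F i)) -> degle (\sum_(i <- s) b i) (\prod_(i <- s) F i).
Proof.
move=> h; elim/big_rec2: _ => [|i r m _ IH]; first by right; rewrite size_poly1 muln0.
exact: degleM.
Qed.

(** Multiplication by [z] raises the pole order of y_i by at most [m], so the coefficient a of y_i
    in z y_i satisfies (e + 1) deg a + rho i <= m + rho i. *)
Lemma trK_degle m z : Lspace p m.+1 z -> degle m (trK z).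
Proof.
move=> hz; apply: degle_sum => i _.
have [->|M0] := eqVneq (mulmat z i i) 0; first by left.
have hzy : Lspace p (m.+1 + rho i) (z * y i).
  split; first by apply: regular_offM => //; case: hz.
  have -> : 1 - (m.+1 + rho i)%N%:Z = (1 - m.+1%:Z) + - (rho i)%:Z by lia.
  by apply: vgeM; [case: hz|right; rewrite vy].
have [a [ea ha]] := apery_span hzy.
have eM : mulmat z i i = a i.
  by apply: (@lincomb_inj (mulmat z i) a); rewrite -ea mulmatE //; case: hz.
right; rewrite eM; have := ha i; rewrite -eM => /(_ M0).
by rewrite eM addSn ltnS leq_add2r.
Qed.

Definition trform : 'M[{poly k}]_e.+1 := \matrix_(i, j) trK (y i * y j).

Lemma trform_degle i j : degle (rho i + rho j) (trform i j).
Proof.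
rewrite mxE; apply: trK_degle; split; first exact: regular_offM.
have -> : 1 - (rho i + rho j).+1%:Z = - (rho i)%:Z + - (rho j)%:Z by lia.
by apply: vgeM; right; rewrite vy.
Qed.

(** In each term of the determinant every [rho i] occurs once for its row and once for its
    column. *)
Lemma det_trform_degle : degle (2 * \sum_i rho i) (\det trform).
Proof.
apply: degle_sum => s _; rewrite mulr_sign; set P := \prod_i _.
have hP : degle (2 * \sum_i rho i) P.
  have -> : (2 * \sum_i rho i = \sum_i (rho i + rho (s i)))%N.
    have e2 : (\sum_i rho (s i) = \sum_i rho i)%N by rewrite [RHS](reindex_inj (@perm_inj _ s)).
    by rewrite [RHS]big_split /= e2 mul2n addnn.
  by apply: degle_prod => i; apply: trform_degle.
case: ifP => // _; case: hP => [->|h]; first by left; rewrite oppr0.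
by right; rewrite size_polyN.
Qed.

Lemma trK_lincomb (a : 'I_e.+1 -> {poly k}) (z : 'I_e.+1 -> K) (w : K) :
  (forall i, regular_off p (z i)) -> w = \sum_i a i @ f * z i ->
  regular_off p w /\ trK w = \sum_i a i * trK (z i).
Proof.
move=> hz ->; elim/big_rec2: _ => [|i r s _ [IH1 IH2]].
  split; first by move=> q _; left.
  have := @mulmatZ 0 1 (fun q _ => vge_one q).
  by rewrite /trK polyK0 mul0r scale0r => ->; rewrite mxtrace0.
have h : regular_off p (a i @ f * z i).
  by apply: regular_offM => //; apply: regular_off_polyK.
split; first exact: regular_offD.
by rewrite /trK mulmatD // mxtraceD -/(trK s) IH2 mulmatZ // mxtraceZ.
Qed.

(* If [z] is in the radical, so is [z * w] for all [w], and some [z * w] is a nonzero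
   element of [k[f]]. *)
Lemma det_trform_neq0 : \det trform != 0.
Proof.
apply/eqP => d0; have /det0P[v v0 hv] : \det trform == 0 by apply/eqP.
pose z := lincomb (fun i => v 0 i).
have z0 : z != 0.
  apply: contra v0 => /eqP hz; apply/eqP/rowP => i; rewrite [RHS]mxE.
  exact: (lincomb_eq0 hz).
have zr : regular_off p z.
  by have [] := @trK_lincomb (fun i => v 0 i) y z yreg erefl.
have trz j : trK (z * y j) = 0.
  have [||_ ->] := @trK_lincomb (fun i => v 0 i) (fun i => y i * y j) (z * y j).
  - by move=> i; apply: regular_offM.
  - by rewrite /z /lincomb mulr_suml; apply: eq_bigr => i _; rewrite mulrA.
  have := congr1 (fun M : 'rV_e.+1 => M 0 j) hv; rewrite !mxE => h; rewrite -[RHS]h.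
  by apply: eq_bigr => i _; rewrite mxE.
have trzw w : regular_off p w -> trK (z * w) = 0.
  move=> hw; have [m hm] := regular_off_Lspace hw.
  have [a [ea _]] := apery_span hm.
  have [||_ ->] := @trK_lincomb a (fun i => z * y i) (z * w).
  - by move=> i; apply: regular_offM.
  - by rewrite ea /lincomb mulr_sumr; apply: eq_bigr => i _; rewrite mulrCA.
  by rewrite big1 // => i _; rewrite trz mulr0.
have [P [hP _ P0]] := transc_minpoly hK char0 z tf.
have {}P0 := P0 z0.
(* Since P(f, z) = 0, the product z w is -P_0(f), whose trace -(e + 1) P_0 is nonzero in
   characteristic zero. *)
pose w := \sum_(i < (size P).-1) P`_i.+1 @ f * z ^+ i.
have wr : regular_off p w.
  move=> q qp; apply: vge_sum => i _; apply: vgeMl; last by apply: regular_offX.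
  by apply: regular_off_polyK.
have ew : z * w = (- P`_0) @ f.
  move: hP; rewrite (ev2_coef _ _ _ (leqSpred _)) big_ord_recl expr0 mulr1 => /eqP.
  rewrite addrC addr_eq0 => /eqP e1; rewrite polyKN -e1 mulr_sumr.
  by apply: eq_bigr => i _; rewrite mulrCA exprS.
have := trzw w wr; rewrite ew -[X in trK X]mulr1 /trK mulmatZ; last by move=> q _; apply: vge_one.
rewrite mulmat1 mxtraceZ mxtrace1 => /eqP; rewrite mulf_eq0 oppr_eq0 (negbTE P0) /=.
by rewrite -polyC_natr polyC_eq0 natk_eq0.
Qed.

(** A power of [z] is divisible by f - c in the ring of functions regular off [p], so the matrix of
    [z] is nilpotent modulo X - c. *)
Lemma trK_vanish (c : k) (Z : seq (place iota)) z :
  (forall q, 0 < vp q (f - iota c) -> q \in Z) ->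
  regular_off p z -> (forall q, q \in Z -> vge q z 1) -> (trK z).[c] = 0.
Proof.
move=> hZ zr hz; pose n := (\sum_(q <- Z) absz (vp q (f - iota c)))%N.
have fc0 : f - iota c != 0.
  by rewrite subr_eq0; apply/eqP => h; apply: (transc_notconst tf h).
have wr : regular_off p (z ^+ n / (f - iota c)).
  move=> q qp; case: (ltP 0 (vp q (f - iota c))) => hq.
    have qZ := hZ q hq.
    have hn : (absz (vp q (f - iota c)) <= n)%N by rewrite /n (big_rem _ qZ) leq_addr.
    apply: (@vge_le _ _ _ _ _ _ (n%:Z - vp q (f - iota c))); first by lia.
    apply: vgeM; last by right; rewrite vpV.
    by have := vgeX n (hz q qZ); rewrite natz.
  apply: vgeMl; first by apply: vgeX0; apply: zr.
  by right; rewrite vpV oppr_ge0.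
have ezn : z ^+ n = ('X - c%:P) @ f * (z ^+ n / (f - iota c)).
  by rewrite polyKB polyKX polyKC mulrC divfK.
have := mulmatX n zr; rewrite ezn mulmatZ // => eM.
pose N := map_mx (horner_eval c) (mulmat z).
have N0 : N ^+ n = 0.
  rewrite /N -rmorphXn /= -eM; apply/matrixP => i j; rewrite !mxE /= /horner_eval.
  by rewrite hornerM hornerXsubC subrr mul0r.
rewrite -[RHS](nilpotent_trace N0) /trK /N.
by rewrite -/(horner_eval c _) rmorph_sum /=; apply: eq_bigr => i _; rewrite mxE.
Qed.

(* Modulo [f - c] the trace form only depends on the values at the points of the fibre. *)
Lemma rank_trform (c : k) (Z : seq (place iota)) :
  (forall q, 0 < vp q (f - iota c) -> q \in Z) -> p \notin Z ->
  (\rank (map_mx (horner_eval c) trform) <= size Z)%N.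
Proof.
move=> hZ pZ; set Tc := map_mx _ _.
have /choice[val hval] : forall u : 'I_e.+1 * 'I_(size Z), exists a,
    vge (nth p Z u.2) (y u.1 - iota a) 1.
  move=> [i j] /=; apply: residue => //; apply: yreg.
  by apply/eqP => h; case/negP: pZ; rewrite -{1}h; apply: mem_nth.
pose E : 'M[k]_(e.+1, size Z) := \matrix_(i, j) val (i, j).
have : (kermx E <= kermx Tc)%MS.
  apply/row_subP => l.
  set v := row l (kermx E); apply/sub_kermxP.
  have vE : v *m E = 0 by rewrite -row_mul mulmx_ker row0.
  apply/rowP => j; rewrite [RHS]mxE.
  pose z := \sum_i iota (v 0 i) * y i.
  have [|zr _] := @trK_lincomb (fun i => (v 0 i)%:P) y z yreg.
    by apply: eq_bigr => i _; rewrite polyKC.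
  have zv q : q \in Z -> vge q z 1.
    move=> qZ; have iq : (index q Z < size Z)%N by rewrite index_mem.
    have := congr1 (fun M : 'rV_(size Z) => iota (M 0 (Ordinal iq))) vE.
    rewrite !mxE rmorph0 rmorph_sum /= => h.
    rewrite -[z]subr0 -h -sumrB; apply: vge_sum => i _.
    rewrite rmorphM -mulrBr [E _ _]mxE; apply: vgeMl; first exact: vge_iota.
    by have := hval (i, Ordinal iq); rewrite /= nth_index.
  have [||_ e1] := @trK_lincomb (fun i => (v 0 i)%:P) (fun i => y i * y j) (z * y j).
  - by move=> i; apply: regular_offM.
  - by rewrite mulr_suml; apply: eq_bigr => i _; rewrite polyKC mulrA.
  have := @trK_vanish c Z (z * y j) hZ (regular_offM zr (yreg j)).
  rewrite e1 => h; rewrite mxE -[RHS]h.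
    rewrite horner_sum; apply: eq_bigr => i _.
    by rewrite !mxE hornerM hornerC.
  move=> q qZ; apply: vgeMr; first exact: zv.
  by apply: yreg; apply/eqP => e2; case/negP: pZ; rewrite -e2.
move/mxrankS; rewrite !mxrank_ker => h.
have hT : (\rank Tc <= e.+1)%N := rank_leq_row _.
by have := rank_leq_col E; have := rank_leq_row E; lia.
Qed.

End AperyBasis.
End Apery.

Section Canonical.
Variables (k : closedFieldType) (K : fieldType) (iota : {rmorphism k -> K}).
Implicit Types (q : place iota) (x y z w : K).
Local Notation "r @ x" := (polyK iota r x) (at level 35).
Hypotheses (hK : is_function_field iota) (char0 : [pchar k] =i pred0).
Variables (gen : nat).
Hypothesis hgen : is_genus iota gen.

(** At [c] the discriminant vanishes to order at least e + 1 minus the size of the fibre. Its degree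
    is at most 2 sum(rho) / (e + 1) = e + 2 sum(t), and the [t i] add up to at most [gen]. *)
Lemma ramification_bound p e f (y : 'I_e.+1 -> K) t (cs : seq k) (Z : k -> seq (place iota)) :
  apery gen p f y t -> uniq cs -> (forall c q, 0 < vp q (f - iota c) -> q \in Z c) ->
  (forall c, p \notin Z c) -> (\sum_(c <- cs) (e.+1 - size (Z c)) <= e + 2 * gen)%N.
Proof.
move=> hA ucs hZ pZ; have d0 := det_trform_neq0 hK char0 hA.
have := @sum_exp_XsubC_le _ cs (fun c => (e.+1 - size (Z c))%N) _ ucs d0.
case: (det_trform_degle hK hA) => [h|hdeg]; first by rewrite h eqxx in d0.
move=> h; have /h h' : forall c, c \in cs ->
    ('X - c%:P) ^+ (e.+1 - size (Z c)) %| \det (trform hK hA).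
  move=> c _; apply: dvdp_trans (det_corank_dvd _ c); apply: dvdp_exp2l.
  by apply: leq_sub2l; exact: rank_trform (hZ c) (pZ c).
apply: leq_trans h' _; rewrite -(leq_pmul2l (ltn0Sn e)); apply: leq_trans hdeg _.
rewrite big_split /= -big_distrr /= mulnDr -(big_mkord xpredT id) bin2_sum.
have -> : (2 * 'C(e.+1, 2) = e.+1 * e)%N by rewrite mul2n bin2 -[RHS]odd_double_half oddM /= andNb.
rewrite mulnDr leq_add2l mulnCA leq_mul2l leq_mul2l /=.
by case: (hA).
Qed.

Section LocalOrder.
Variables (q : place iota) (t : K) (D : K -> K).
Hypotheses (ht : vp q t = 1) (hD : is_derivation iota D) (Dt : D t = 1).
Hypothesis Dint : forall y, vge q y 0 -> vge q (D y) 0.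

(** For y = t^(n+1) u with [u] a unit, the leading term (n + 1) t^n u of the derivative survives in
    characteristic zero. *)
Lemma vp_der_pos y : 0 < vp q y -> D y != 0 /\ vp q (D y) = vp q y - 1.
Proof.
move=> hy; have y0 : y != 0 by apply: (vp_neq0 (q := q)); lia.
have t0 : t != 0 by apply: (vp_neq0 (q := q)); rewrite ht.
pose n := (absz (vp q y)).-1; have en : vp q y = n.+1%:Z by rewrite /n; lia.
have tX := expf_neq0 n.+1 t0; pose u := y / t ^+ n.+1.
have u0 : u != 0 by rewrite mulf_neq0 ?invr_eq0.
have vu : vp q u = 0 by rewrite vpM ?invr_eq0 // vpV vpX ht en natz subrr.
have ey : y = t ^+ n.+1 * u by rewrite mulrC divfK.
pose a := iota n.+1%:R * t ^+ n * u.
have n0 : iota n.+1%:R != 0 by rewrite fmorph_eq0 (natk_eq0 char0).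
have a0 : a != 0 by rewrite mulf_neq0 // mulf_neq0 // expf_neq0.
have va : vp q a = n%:Z.
  have tn0 := expf_neq0 n t0.
  by rewrite /a vpM ?(mulf_neq0 n0) // vpM // vp_iota vpX ht vu natz add0r addr0.
have eD : D y = a + t ^+ n.+1 * D u.
  rewrite ey (derM hD) (derX hD) Dt mulr1 /=; congr (_ + _).
  by rewrite /a rmorph_nat -mulr_natl.
rewrite eD en; have [|-> ->] := @vpD_lt _ _ _ q a (t ^+ n.+1 * D u) a0; last by split=> //; lia.
rewrite va; apply: vgeMr; first by right; rewrite vpX ht natz; lia.
by apply: Dint; right; rewrite vu.
Qed.

Lemma vp_der y : vp q y != 0 -> D y != 0 /\ vp q (D y) = vp q y - 1.
Proof.
move=> hy; have y0 : y != 0 by apply: (vp_neq0 hy).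
case: (ltP 0 (vp q y)) => h; first exact: vp_der_pos.
have [|h1 h2] := @vp_der_pos y^-1; first by rewrite vpV; lia.
have e : D y = - (D y^-1 * y * y).
  have := derM hD y y^-1; rewrite mulfV // -(rmorph1 iota) (der_iota hD) => /esym/eqP.
  rewrite addr_eq0 => /eqP e; rewrite -mulNr -mulNr [- _ * y]mulNr.
  rewrite [D y^-1 * y]mulrC -[y * D y^-1]opprK -e opprK; by rewrite divfK.
rewrite e oppr_eq0 !mulf_neq0 //; split=> //.
by rewrite vpN !vpM ?mulf_neq0 // h2 vpV; lia.
Qed.
End LocalOrder.

(** [D] is d/df, and [phi q] is the derivative of [f] with respect to a uniformiser at [q], so
    v_q(phi q) is the order of df. Off [p] it is the ramification index minus 1, with total at most
    e + 2 gen; at [p] it is -(e + 2). *)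
Lemma exists_global_derivation : exists D phi p,
  @global_derivation _ _ iota D phi p (2 * gen%:Z - 2).
Proof.
have [p _] : exists p : place iota, True.
  case: (hK) => x [tx _]; have [p _] := exists_zero hK tx; by exists p.
have [e [f [y [t hA]]]] := exists_apery hK p hgen.
have [[fr vf] _ _ _ _] := hA.
have tf : transc iota f.
  by apply: notconst_transc => c e0; move: vf; rewrite e0 vp_iota.
have fc0 c : f - iota c != 0.
  by rewrite subr_eq0; apply/eqP => h; apply: (transc_notconst tf h).
have /choice[tau htau] := @uniformizer _ _ iota.
have /choice[Dq hDq] : forall q, exists D,
    [/\ is_derivation iota D, D (tau q) = 1 & forall y, vge q y 0 -> vge q (D y) 0].
  by move=> q; apply: local_derivation.
have derq q : is_derivation iota (Dq q) by case: (hDq q).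
have Dt q : Dq q (tau q) = 1 by case: (hDq q).
have Dint q z : vge q z 0 -> vge q (Dq q z) 0 by case: (hDq q) => _ _; apply.
have Dqf q c : Dq q (f - iota c) = Dq q f by rewrite (derB (derq q)) (der_iota (derq q)) subr0.
have /choice[val hval] : forall q, exists c, q != p -> vge q (f - iota c) 1.
  move=> q; have [->|qp] := eqVneq q p; first by exists 0.
  by have [c hc] := residue hK (fr q qp); exists c.
have ordq q : q != p -> Dq q f != 0 /\ vp q (Dq q f) = vp q (f - iota (val q)) - 1.
  move=> qp; rewrite -(Dqf q (val q)).
  apply: (vp_der (htau q) (derq q) (Dt q) (@Dint q)).
  by have := vgeE (fc0 _) (hval q qp); lia.
have ordp : Dq p f != 0 /\ vp p (Dq p f) = - e.+2%:Z.
  have [|h1 ->] := vp_der (htau p) (derq p) (Dt p) (@Dint p) (y := f); first by rewrite vf.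
  by rewrite vf; split=> //; lia.
have Df0 q : Dq q f != 0 by have [->|/ordq []] := eqVneq q p; [case: ordp|].
pose D z := Dq p z / Dq p f.
have derD : is_derivation iota D.
  split=> [x z|x z|c]; rewrite /D ?(derD (derq p)) ?(derM (derq p)) ?(der_iota (derq p)) ?mul0r //.
    by rewrite mulrDl.
  by rewrite mulrDl mulrAC mulrA.
exists D, (fun q => Dq q f), p; split=> //.
(* If D z = 0, no z - c has nonzero order at [p], because the derivation lowers such an order by
   exactly 1; for nonconstant [z] this contradicts the existence of a residue. *)
- move=> z hz; have Dz0 : Dq p z = 0.
    by apply/eqP; move/eqP: hz; rewrite mulf_eq0 invr_eq0 (negbTE (Df0 p)) orbF.
  apply: contrapT => hn.
  have tz c : z - iota c != 0 by rewrite subr_eq0; apply/eqP => h; apply: hn; exists c.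
  have Dzc c : Dq p (z - iota c) = 0.
    by rewrite (derB (derq p)) (der_iota (derq p)) Dz0 subr0.
  have v0 c : vp p (z - iota c) = 0.
    apply/eqP/negPn/negP => h.
    by have [] := vp_der (htau p) (derq p) (Dt p) (@Dint p) h; rewrite Dzc eqxx.
  have [|c hc] := @residue _ _ _ hK p z.
    by right; have := v0 0; rewrite rmorph0 subr0 => ->.
  by have := vgeE (tz c) hc; rewrite v0.
- move=> q; exists (tau q); split=> //.
    rewrite /D mulrA [Dq q f * _]mulrC.
    have -> := derivations_proportional hK char0 (tau q) (derq p) (derq q) tf.
    by rewrite Dt mul1r mulfV.
  move=> z hz; rewrite /D mulrA [Dq q f * _]mulrC.
  have -> := derivations_proportional hK char0 z (derq p) (derq q) tf.
  by rewrite mulfK //; apply: Dint.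
move=> s us ps.
have /choice[Z hZ] : forall c, exists s, uniq s /\ forall q, (q \in s) = (0 < vp q (f - iota c)).
  move=> c; have [s0 hs0] := finite_vp_support hK (f - iota c).
  exists (undup [seq q <- s0 | 0 < vp q (f - iota c)]); split; first exact: undup_uniq.
  move=> q; rewrite mem_undup mem_filter; case: (ltP 0 (vp q (f - iota c))) => //= h.
  by apply: hs0; lia.
have pZ c : p \notin Z c by rewrite (hZ c).2 -leNgt vp_subC_pole vf.
(* The only pole of f - c is [p], of order e + 1, so its zeros also count e + 1. *)
have sumZ c : \sum_(q <- Z c) vp q (f - iota c) = e.+1%:Z.
  have := @product_formula _ _ _ hK gen hgen (f - iota c) (p :: Z c) (fc0 c).
  rewrite /= pZ (hZ c).1 => /(_ isT); rewrite big_cons vp_subC_pole vf // => h.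
  suff /h : forall q, vp q (f - iota c) != 0 -> q \in p :: Z c.
    by move/eqP; rewrite addrC subr_eq0 => /eqP.
  move=> q hq; rewrite in_cons; have [//|qp] := eqVneq q p.
  rewrite (hZ c).2; have : vge q (f - iota c) 0.
    by apply: vgeB; [apply: fr|apply: vge_iota].
  by move/(vgeE (fc0 c)); lia.
have sumZ' c : \sum_(q <- Z c) (vp q (f - iota c) - 1) = (e.+1 - size (Z c))%N%:Z.
  have h1 : (size (Z c))%:Z <= e.+1%:Z.
    rewrite -(sumZ c) -[size _]sum1_size -natz natr_sum big_seq [leRHS]big_seq.
    by apply: ler_sum => q; rewrite (hZ c).2; lia.
  rewrite sumrB sumZ big_const_seq count_predT iter_addr_0 natz; lia.
pose s' := rem p s; pose cs := undup [seq val q | q <- s'].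
have s'p q : q \in s' -> q != p by rewrite mem_rem_uniq // inE => /andP[].
(* The places are grouped by the value of [f], and each group is enlarged to the whole fibre, where
   the orders are nonnegative. *)
have : \sum_(q <- s') vp q (Dq q f) <= (\sum_(c <- cs) (e.+1 - size (Z c)))%N%:Z.
  rewrite -[X in _ <= X]natz natr_sum; under [leRHS]eq_bigr do rewrite natz -sumZ'.
  have -> : \sum_(q <- s') vp q (Dq q f) =
      \sum_(q <- s') \sum_(c <- cs) (if val q == c then vp q (Dq q f) else 0).
    rewrite big_seq [RHS]big_seq; apply: eq_bigr => q qs.
    rewrite -big_mkcond -big_filter (_ : [seq c <- cs | val q == c] = [:: val q]) ?big_seq1 //.
    rewrite (eq_filter (a2 := pred1 (val q))) => [|c]; last by rewrite /= eq_sym.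
    rewrite filter_pred1_uniq ?undup_uniq // mem_undup; exact: map_f.
  rewrite exchange_big; apply: ler_sum => c _.
  have us' : uniq s' by apply: rem_uniq.
  rewrite -big_mkcond -big_filter.
  rewrite -(@sum_sub_seq _ [seq q <- s' | val q == c] (Z c)) ?filter_uniq ?(hZ c).1 //.
    rewrite big_seq [leRHS]big_seq; apply: ler_sum => q; rewrite (hZ c).2 => hq.
    rewrite mem_filter; case: eqP => [ec|_] /=; last by lia.
    case: ifP => [qs|_]; last by lia.
    by rewrite (ordq q (s'p q qs)).2 ec.
  move=> q; rewrite mem_filter => /andP[/eqP ec qs]; rewrite (hZ c).2.
  by have := vgeE (fc0 _) (hval q (s'p q qs)); rewrite ec; lia.
have := @ramification_bound p e f y t cs Z hA (undup_uniq _) _ pZ.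
move=> /(_ (fun c q h => eq_ind_r is_true h ((hZ c).2 q))) h1 h2.
rewrite (big_rem p) //= ordp.2 -/s'.
move: h1 h2; set A := (\sum_(c <- cs) _)%N; set B := \sum_(q <- s') _ => h1 h2.
lia.
Qed.

End Canonical.

(** * Elimination *)

Section Elimination.
Variable (k : closedFieldType).
Implicit Types (F G P Q : {poly {poly k}}) (a c : {poly k}).

(** Constant content, tested at points: over an algebraically closed field a nonconstant content has
    a root [x], at which all coefficients vanish. *)
Definition primitive2 P : Prop := forall x : k, exists i, (P`_i).[x] != 0.

Lemma divide_XsubC P (x : k) : (forall i, (P`_i).[x] = 0) ->
  exists Q, P = ('X - x%:P) *: Q.
Proof.
move=> h; exists (\poly_(i < size P) (P`_i %/ ('X - x%:P))).
apply/polyP => i; rewrite coefZ coef_poly; case: ltnP => hi; last by rewrite mulr0 nth_default.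
by rewrite mulrC divpK // dvdp_XsubCl /root h.
Qed.

Lemma primitive_part P : P != 0 ->
  exists a P0, [/\ a != 0, P = a *: P0 & primitive2 P0].
Proof.
move: {2}(size (lead_coef P)) (leqnn (size (lead_coef P))) => n.
elim: n P => [|n IH] P hn P0.
  by move: hn; rewrite leqn0 size_poly_eq0 lead_coef_eq0 (negbTE P0).
have [h|/existsNP [x hx]] := pselect (primitive2 P).
  by exists 1, P; split; rewrite ?oner_neq0 ?scale1r.
have [|Q eQ] := @divide_XsubC P x.
  by move=> i; apply/eqP/negPn/negP => h; apply: hx; exists i.
have Q0 : Q != 0 by apply: contraNneq P0 => h; rewrite eQ h scaler0.
have [|//|a [P1 [a0 eP1 pP1]]] := IH Q.
  move: hn; rewrite eQ lead_coefZ size_mul ?polyXsubC_eq0 ?lead_coef_eq0 //.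
  by rewrite size_XsubC.
exists (('X - x%:P) * a), P1; split=> //.
  by rewrite mulf_neq0 // polyXsubC_eq0.
by rewrite eQ eP1 scalerA.
Qed.

(* Gauss: a root [x] of [c] must kill [Q] modulo [X - x], since [P] survives. *)
Lemma primitive_dvd c F P Q : c != 0 -> primitive2 P -> c *: F = Q * P ->
  exists Q', F = Q' * P.
Proof.
move=> c0 hP; move: {2}(size c) (leqnn (size c)) => n.
elim: n c Q c0 => [|n IH] c Q c0 hn e; first by move: hn; rewrite leqn0 size_poly_eq0 (negbTE c0).
have [sc|sc] := eqVneq (size c) 1%N.
  have /size_poly1P [a a0 ec] : size c == 1%N by apply/eqP.
  exists (a^-1%:P *: Q); rewrite -scalerAl -e ec scalerA -polyCM mulVf // scale1r //.
have [x hx] := closed_rootP c sc.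
have evx (i : nat) : ((Q * P)`_i).[x] = 0.
  by rewrite -e coefZ hornerM (eqP hx) mul0r.
pose ev := map_poly (horner_eval x).
have : ev Q * ev P = 0.
  by rewrite -rmorphM; apply/polyP => i; rewrite coef_map coef0 /= /horner_eval evx.
move=> /eqP; rewrite mulf_eq0 => /orP[] /eqP h; last first.
  have [i] := hP x; have := congr1 (fun r : {poly k} => r`_i) h.
  by rewrite coef_map coef0 /= /horner_eval => ->; rewrite eqxx.
have [Q1 eQ1] : exists Q1, Q = ('X - x%:P) *: Q1.
  apply: divide_XsubC => i; have := congr1 (fun r : {poly k} => r`_i) h.
  by rewrite coef_map coef0.
have [c1 ec1] : exists c1, c = c1 * ('X - x%:P) by apply/factor_theorem.
have c10 : c1 != 0 by apply: contraNneq c0 => h1; rewrite ec1 h1 mul0r.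
apply: (IH c1 Q1 c10).
  by move: hn; rewrite ec1 size_mul ?polyXsubC_eq0 // size_XsubC addn2 /=.
have X0 : ('X - x%:P)%:P != 0 by rewrite polyC_eq0 polyXsubC_eq0.
apply: (mulfI X0); rewrite mulrA !mul_polyC.
by rewrite scalerA [_ * c1]mulrC -ec1 e eQ1.
Qed.

(** If the resultant vanishes, the gcd has positive degree in the outer variable, and by
    [primitive_dvd] its primitive part divides both polynomials without denominators, against
    coprimality. A polynomial of degree 0 in that variable is its own eliminant. *)
Lemma elimination F G : nonconstant2 F -> nonconstant2 G -> coprime2 F G ->
  exists r A B, r != 0 /\ r%:P = A * F + B * G.
Proof.
move=> hF hG hFG.
have n0 P : nonconstant2 P -> P != 0.
  by move=> hP; apply/eqP => e; apply: hP; exists 0; rewrite e !polyC0.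
have [sF|sF] := leqP (size F) 1.
  exists F`_0, 1, 0; rewrite mul1r mul0r addr0; split; last by rewrite -size1_polyC.
  by have := n0 F hF; rewrite {1}(size1_polyC sF) polyC_eq0.
have [sG|sG] := leqP (size G) 1.
  exists G`_0, 0, 1; rewrite mul1r mul0r add0r; split; last by rewrite -size1_polyC.
  by have := n0 G hG; rewrite {1}(size1_polyC sG) polyC_eq0.
have [r0|r0] := eqVneq (resultant F G) 0; last first.
  by have [[A B] [_ _ e]] := resultant_in_ideal sF sG; exists (resultant F G), A, B.
have sP : (1 < size (gcdp F G))%N by rewrite -resultant_eq0 r0.
set P := gcdp F G in sP; have P0 : P != 0 by rewrite -size_poly_gt0; lia.
have [a [P1 [a0 eP pP1]]] := primitive_part P0.
have key H : P %| H -> exists Q, H = P1 * Q.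
  move/Pdiv.Idomain.dvdpP => [[c Q] /= c0 e].
  have [|Q' eQ'] := @primitive_dvd c H P1 (a *: Q) c0 pP1.
    by rewrite e eP -scalerAl -scalerAr.
  by exists Q'; rewrite mulrC.
have [Q1 e1] := key F (Pdiv.Idomain.dvdp_gcdl _ _).
have [Q2 e2] := key G (Pdiv.Idomain.dvdp_gcdr _ _).
have [c [_ ec]] := hFG P1 Q1 Q2 e1 e2.
move: sP; rewrite eP ec -mul_polyC -polyCM => h.
by have := size_polyC_leq1 (a * c%:P); rewrite leqNgt h.
Qed.

Lemma coprime2_swap F G : coprime2 F G -> coprime2 (swapXY F) (swapXY G).
Proof.
move=> h P Q1 Q2 e1 e2.
have [||c [c0 ec]] := h (swapXY P) (swapXY Q1) (swapXY Q2).
- by rewrite -(swapXYK F) e1 rmorphM.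
- by rewrite -(swapXYK G) e2 rmorphM.
exists c; split=> //; by rewrite -(swapXYK P) ec swapXY_polyC map_polyC.
Qed.

Lemma nonconstant2_swap F : nonconstant2 F -> nonconstant2 (swapXY F).
Proof.
move=> h [c e]; apply: h; exists c.
by rewrite -(swapXYK F) e swapXY_polyC map_polyC.
Qed.

Lemma elimination_swap F G : nonconstant2 F -> nonconstant2 G -> coprime2 F G ->
  exists r A B, r != 0 /\ map_poly polyC r = A * F + B * G.
Proof.
move=> /nonconstant2_swap hF /nonconstant2_swap hG /coprime2_swap hFG.
have [r [A [B [r0 e]]]] := elimination hF hG hFG.
exists r, (swapXY A), (swapXY B); split=> //.
by rewrite -swapXY_polyC e rmorphD !rmorphM /= !swapXYK.
Qed.

End Elimination.

Lemma leq_sum_min (I J : Type) (r : seq I) (s : seq J) (a : I -> nat) (b : J -> nat) g :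
  (g <= \sum_(i <- r) a i)%N -> (g <= \sum_(j <- s) b j)%N ->
  (g <= \sum_(i <- r) \sum_(j <- s) minn (a i) (b j))%N.
Proof.
have sub (L : Type) (l : seq L) (f : L -> nat) m :
    (minn m (\sum_(i <- l) f i) <= \sum_(i <- l) minn m (f i))%N.
  elim: l => [|i l IH]; first by rewrite !big_nil minn0.
  by rewrite !big_cons; move: IH; set A := (\sum_(_ <- l) _)%N; set B := (\sum_(_ <- l) _)%N; lia.
move=> h1 h2; apply: (@leq_trans (\sum_(i <- r) minn g (a i))).
  by apply: leq_trans (sub _ _ _ _); rewrite leq_min leqnn.
apply: leq_sum => i _.
apply: (@leq_trans (minn (a i) (\sum_(j <- s) b j))); last exact: sub.
by move: h2; set A := (\sum_(_ <- s) _)%N; lia.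
Qed.

(** * Local bounds for the gcd *)

Section PlaceMinima.
Variables (k : closedFieldType) (K : fieldType) (iota : {rmorphism k -> K}).
Implicit Types (q : place iota) (x y : K).

Definition v0min q x y : nat :=
  minn (v0 q x) (v0 q y).

Lemma vge_v0 q x : (0 < v0 q x)%N -> vge q x (v0 q x).
Proof. by rewrite /v0 => h; right; lia. Qed.

Lemma vp_le_v0 q x : vp q x <= (v0 q x)%:Z.
Proof. by rewrite /v0; lia. Qed.

Lemma gcd_term_vge q x y :
  (0 < gcd_term q x y)%N -> vge q x (gcd_term q x y) /\ vge q y (gcd_term q x y).
Proof.
rewrite /gcd_term; case: eqP => [->|_] h; first by split; [left|apply: vge_v0].
case: eqP h => [->|_] h; first by split; [apply: vge_v0|left].
rewrite leq_min in h; case/andP: h => h1 h2.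
by split; [apply: vge_le (vge_v0 h1)|apply: vge_le (vge_v0 h2)];
  rewrite lez_nat ?geq_minl ?geq_minr.
Qed.

Lemma vge_polyK_roots q x (r : {poly k}) (rs : seq k) (n : int) :
  r != 0 -> r = lead_coef r *: \prod_(a <- rs) ('X - a%:P) -> (forall c, x <> iota c) ->
  vge q (polyK iota r x) n -> n <= (\sum_(a <- rs) v0 q (x - iota a))%N%:Z.
Proof.
move=> r0 er hx.
have xa a : x - iota a != 0 by rewrite subr_eq0; apply/eqP/hx.
have e : polyK iota r x = iota (lead_coef r) * \prod_(a <- rs) (x - iota a).
  rewrite {1}er -mul_polyC polyKM polyKC polyK_prod; congr (_ * _).
  by apply: eq_bigr => a _; rewrite polyKB polyKX polyKC.
have l0 : iota (lead_coef r) != 0 by rewrite fmorph_eq0 lead_coef_eq0.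
rewrite e => /vgeE; rewrite mulf_neq0 ?prodK_neq0 // => /(_ isT) h.
apply: le_trans h _; rewrite vpM ?prodK_neq0 // vp_iota add0r vp_prod //.
rewrite -[leRHS]natz natr_sum; apply: ler_sum => a _.
by rewrite natz vp_le_v0.
Qed.

(** For nonzero [c], x - c can vanish only where [x] has order 0; for c = 0 its zeros are those of
    [x]. *)
Lemma v0_subC_unit q x (c : k) :
  (v0 q (x - iota c) <= if c == 0%R then absz (vp q x) else if vp q x == 0%R then v0 q (x - iota c) else 0)%N.
Proof.
case: eqP => [->|/eqP c0]; first by rewrite rmorph0 subr0 /v0; lia.
case: eqP => // /eqP vx0; rewrite /v0.
have ic : iota c != 0 by rewrite fmorph_eq0.
case: (ltP (vp q x) 0) => h; first by rewrite vp_subC_pole //; lia.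
rewrite -opprB vpN; have [|_ ->] := @vpD_lt _ _ _ q (iota c) (- x) ic; last by rewrite vp_iota.
by apply: vgeN; right; rewrite vp_iota; lia.
Qed.

Lemma gcd_term_le_l q x y : x != 0 -> (gcd_term q x y <= v0 q x)%N.
Proof. by move=> /negbTE x0; rewrite /gcd_term x0; case: ifP => _; rewrite ?geq_minl. Qed.

Lemma gcd_term_le_r q x y : y != 0 -> (gcd_term q x y <= v0 q y)%N.
Proof. by move=> /negbTE y0; rewrite /gcd_term y0; case: ifP => _; rewrite ?geq_minr. Qed.

End PlaceMinima.

(** [E] is read off from the sizes of [A] and of its coefficients before any field is given; this
    keeps the later constants uniform in the curve. *)
Lemma ev2_vge_bound (k : closedFieldType) (A : {poly {poly k}}) : exists E : nat,
  forall (K : fieldType) (iota : {rmorphism k -> K}) (q : place iota) (x y : K),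
  vge q (eval2 iota A x y) (- (E * (absz (vp q x) + absz (vp q y)))%N%:Z).
Proof.
exists (size A + \max_(i < size A) size (A`_i)%R)%N => K iota q x y.
rewrite (ev2_coef _ _ _ (leqnn _)); apply: vge_sum => i _.
rewrite (polyK_coef _ _ (leqnn _)) mulr_suml; apply: vge_sum => j _.
rewrite -mulrA; apply: vgeMl; first exact: vge_iota.
have si : (size (A`_i)%R <= \max_(l < size A) size (A`_l)%R)%N by apply: leq_bigmax.
have hi := ltn_ord i; have hj := ltn_ord j.
apply: (@vge_le _ _ _ _ _ _ (vp q x *+ j + vp q y *+ i)); last first.
  by apply: vgeM; apply: vgeX; apply: vge_vp.
rewrite -[_ *+ j]mulr_natr -[_ *+ i]mulr_natr !natz.
have aux (c : int) (l u : nat) : (l <= u)%N -> - (u * absz c)%N%:Z <= c * l%:Z.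
  move=> lu; apply: (@le_trans _ _ (- (l * absz c)%N%:Z)).
    by rewrite lerN2 lez_nat leq_mul2r lu orbT.
  by rewrite mulnC PoszM -mulNr ler_wpM2r //; lia.
rewrite mulnDr PoszD opprD; apply: lerD; apply: aux.
  by apply: leq_trans (leq_addl _ _); apply: leq_trans si; apply: ltnW.
by apply: leq_trans (leq_addr _ _); apply: ltnW.
Qed.

(** The eliminants r1(g1) and r2(g2) lie in the ideal of the two values, and r1(g1) is nonzero
    because [g1] is transcendental. Where [g1] and [g2] have order 0, only nonzero roots contribute,
    and the gcd, being at most each of the two sums over roots, is at most the double sum of minima.
    Where one of them has a zero or a pole, a multiple of its order suffices. *)
Lemma gcd_pointwise (k : closedFieldType) (F G : {poly {poly k}}) :
  nonconstant2 F -> nonconstant2 G -> coprime2 F G ->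
  exists (C : nat) (rs1 rs2 : seq k),
  [/\ forall a, a \in rs1 -> a != 0, forall a, a \in rs2 -> a != 0 &
   forall (K : fieldType) (iota : {rmorphism k -> K}) (g1 g2 : K),
   (forall c, g1 <> iota c) -> (forall c, g2 <> iota c) ->
   ~~ ((eval2 iota F g1 g2 == 0) && (eval2 iota G g1 g2 == 0)) /\
   forall q : place iota, (gcd_term q (eval2 iota F g1 g2) (eval2 iota G g1 g2) <=
    C * (absz (vp q g1) + absz (vp q g2)) +
    \sum_(a <- rs1) \sum_(b <- rs2) v0min q (g1 - iota a) (g2 - iota b))%N].
Proof.
move=> hF hG hFG.
have [r1 [A1 [B1 [r10 e1]]]] := elimination hF hG hFG.
have [r2 [A2 [B2 [r20 e2]]]] := elimination_swap hF hG hFG.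
have [rs1 ers1] := closed_field_poly_normal r1.
have [rs2 ers2] := closed_field_poly_normal r2.
have [EA1 hA1] := ev2_vge_bound A1; have [EB1 hB1] := ev2_vge_bound B1.
have [EA2 hA2] := ev2_vge_bound A2; have [EB2 hB2] := ev2_vge_bound B2.
pose E := (EA1 + EB1 + EA2 + EB2)%N.
pose nz (a : k) := a != 0.
exists (E + size rs1 + size rs2)%N, (filter nz rs1), (filter nz rs2); split.
- by move=> a; rewrite mem_filter => /andP[].
- by move=> a; rewrite mem_filter => /andP[].
move=> K iota g1 g2 h1 h2; set f := eval2 iota F g1 g2; set g := eval2 iota G g1 g2.
have E1 : polyK iota r1 g1 = eval2 iota A1 g1 g2 * f + eval2 iota B1 g1 g2 * g.
  by rewrite -(ev2C iota r1 g1 g2) e1 ev2D !ev2M.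
have E2 : polyK iota r2 g2 = eval2 iota A2 g1 g2 * f + eval2 iota B2 g1 g2 * g.
  by rewrite -(ev2_map_polyC iota r2 g1 g2) e2 ev2D !ev2M.
split.
  apply/negP => /andP[/eqP f0 /eqP g0]; move: E1; rewrite f0 g0 !mulr0 addr0 => h.
  by have := notconst_transc h1 h => /eqP; rewrite (negbTE r10).
move=> q; set gam := gcd_term q f g; set V := (absz (vp q g1) + absz (vp q g2))%N.
have [->|gam0] := posnP gam; first by [].
have [vf vg] := gcd_term_vge gam0; rewrite -/gam in vf vg.
have comb A B EA EB : (EA <= E)%N -> (EB <= E)%N ->
    vge q (eval2 iota A g1 g2) (- (EA * V)%N%:Z) ->
    vge q (eval2 iota B g1 g2) (- (EB * V)%N%:Z) ->
    vge q (eval2 iota A g1 g2 * f + eval2 iota B g1 g2 * g) (gam%:Z - (E * V)%N%:Z).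
  move=> hA hB vA vB.
  have lA : (EA * V <= E * V)%N by rewrite leq_mul2r hA orbT.
  have lB : (EB * V <= E * V)%N by rewrite leq_mul2r hB orbT.
  apply: vgeD.
    by apply: vge_le (vgeM vA vf); lia.
  by apply: vge_le (vgeM vB vg); lia.
have k1 : gam%:Z - (E * V)%N%:Z <= (\sum_(a <- rs1) v0 q (g1 - iota a))%N%:Z.
  by apply: (vge_polyK_roots r10 ers1 h1); rewrite E1; apply: comb (hA1 _ _ q g1 g2) (hB1 _ _ q g1 g2); rewrite /E; lia.
have k2 : gam%:Z - (E * V)%N%:Z <= (\sum_(a <- rs2) v0 q (g2 - iota a))%N%:Z.
  by apply: (vge_polyK_roots r20 ers2 h2); rewrite E2; apply: comb (hA2 _ _ q g1 g2) (hB2 _ _ q g1 g2); rewrite /E; lia.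
have small (x : K) (rs : seq k) : vp q x != 0 ->
    (\sum_(a <- rs) v0 q (x - iota a) <= size rs * absz (vp q x))%N.
  move=> /negbTE vx; rewrite -sum1_size big_distrl /=; apply: leq_sum => a _.
  by rewrite mul1n; apply: leq_trans (v0_subC_unit q x a) _; rewrite vx; case: ifP.
have zero (x : K) (rs : seq k) : vp q x = 0 ->
    (\sum_(a <- rs) v0 q (x - iota a) = \sum_(a <- filter nz rs) v0 q (x - iota a))%N.
  move=> vx; rewrite big_filter [LHS](bigID nz) /= [X in (_ + X)%N]big1 ?addn0 // => a.
  rewrite /nz negbK => /eqP a0; apply/eqP; rewrite -leqn0.
  by apply: leq_trans (v0_subC_unit q x a) _; rewrite a0 eqxx vx.
rewrite (mulnDl (E + size rs1)) (mulnDl E) -addnA -addnA.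
have [v1|v1] := eqVneq (vp q g1) 0; last first.
  have := small g1 rs1 v1.
  have : (size rs1 * absz (vp q g1) <= size rs1 * V)%N by rewrite leq_mul2l leq_addr orbT.
  move: k1; set S1 := (\sum_(a <- rs1) _)%N; move: (E * V)%N (size rs1 * V)%N (size rs1 * absz (vp q g1))%N => ? ? ? ? ? ?; lia.
have [v2|v2] := eqVneq (vp q g2) 0; last first.
  have := small g2 rs2 v2.
  have : (size rs2 * absz (vp q g2) <= size rs2 * V)%N by rewrite leq_mul2l leq_addl orbT.
  move: k2; set S1 := (\sum_(a <- rs2) _)%N; move: (E * V)%N (size rs2 * V)%N (size rs2 * absz (vp q g2))%N => ? ? ? ? ? ?; lia.
have V0 : V = 0%N by rewrite /V v1 v2.
rewrite V0 !muln0 !add0n; apply: leq_sum_min.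
  by rewrite -zero //; move: k1; rewrite V0 muln0 subr0.
by rewrite -zero //; move: k2; rewrite V0 muln0 subr0.
Qed.

Lemma leq_sum_sub (I : eqType) (s s' : seq I) (F : I -> nat) :
  uniq s -> uniq s' -> {subset s <= s'} -> (\sum_(q <- s) F q <= \sum_(q <- s') F q)%N.
Proof.
move=> us us' ss; rewrite [leqRHS](bigID (mem s)) /= -[X in (_ <= X + _)%N]big_filter.
rewrite [X in (_ <= X + _)%N](perm_big s) ?leq_addr //; apply: uniq_perm; rewrite ?filter_uniq // => q.
by rewrite mem_filter; case: (boolP (q \in s)) => // /ss ->.
Qed.

Lemma mulz_max0_le (z : int) (l m : nat) :
  (l <= m)%N -> z * l%:Z <= (m * absz (Num.max (0 : int) z))%N%:Z.
Proof.
move=> hl; rewrite mulnC PoszM; apply: (@le_trans _ _ (Num.max 0 z * l%:Z)).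
  by apply: ler_wpM2r => //; lia.
rewrite gez0_abs; last by lia.
by apply: ler_wpM2l; lia.
Qed.

Lemma leq_of_subz (a b c d e : nat) :
  a%:Z - b%:Z <= c%:Z -> (b <= d)%N -> (e <= a)%N -> (e <= c + d)%N.
Proof. lia. Qed.

Lemma abszB_le (a b m : nat) : (a <= m)%N -> (b <= m)%N -> (absz (a%:Z - b%:Z) <= m)%N.
Proof. lia. Qed.

Lemma bin2_le (m : nat) : ('C(m, 2) <= m * m)%N.
Proof.
by rewrite bin2 -divn2; apply: leq_trans (leq_div _ _) _; rewrite leq_mul2l leq_pred orbT.
Qed.

(** * Wronskian bounds for monomials in two [S]-units *)

Section Heights.
Variables (k : closedFieldType) (K : fieldType) (iota : {rmorphism k -> K}).
Implicit Types (q : place iota) (x y z w : K) (S T : seq (place iota)).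

Lemma vpXE q x m : vp q (x ^+ m) = vp q x * m%:Z.
Proof. by rewrite vpX -mulr_natr natz. Qed.

(** The sum is taken over a finite list by definition, empty when the support is infinite, so a
    bound over all finite lists carries over. *)
Lemma psum_mul_le (f : place iota -> nat) (m B : nat) :
  (forall T, uniq T -> (m * (\sum_(q <- T) f q) <= B)%N) -> (m * psum f <= B)%N.
Proof. by move=> h; rewrite /psum; apply: h; exact: finite_support_uniq. Qed.

Lemma psum_le (f : place iota -> nat) (B : nat) :
  (forall T, uniq T -> (\sum_(q <- T) f q <= B)%N) -> (psum f <= B)%N.
Proof.
by move=> h; rewrite -[psum f]mul1n; apply: psum_mul_le => T uT; rewrite mul1n; apply: h.
Qed.

Lemma hgt_subC x c : hgt iota (x - iota c) = hgt iota x.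
Proof.
rewrite /hgt; congr psum; apply/funext => q; congr absz.
case: (ltP (vp q x) 0) => h; first by rewrite vp_subC_pole.
have : vge q (x - iota c) 0 by apply: vgeB; [right|apply: vge_iota].
by case=> [->|h']; [rewrite vp0|]; lia.
Qed.

Hypotheses (hK : is_function_field iota).
Variables (gen : nat).
Hypothesis hgen : is_genus iota gen.

Lemma sum_poles_le x T : uniq T ->
  (\sum_(q <- T) absz (Num.max (0 : int) (- vp q x)) <= hgt iota x)%N.
Proof.
move=> uT; have [s hs] := finite_vp_support hK x.
rewrite /hgt (@psumE _ _ _ _ (undup (T ++ s))) ?undup_uniq //; last first.
  move=> q hq; rewrite mem_undup mem_cat hs ?orbT //.
  by apply: contraNneq hq => ->.
apply: leq_sum_sub => //; first exact: undup_uniq.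
by move=> q qT; rewrite mem_undup mem_cat qT.
Qed.

Lemma sum_zeros_le x T : x != 0 -> uniq T -> (\sum_(q <- T) v0 q x <= hgt iota x)%N.
Proof.
move=> x0 uT; have [s hs] := finite_vp_support hK x.
pose T' := undup (T ++ s); have uT' : uniq T' by apply: undup_uniq.
have hT' q : vp q x != 0 -> q \in T' by move/hs; rewrite mem_undup mem_cat => ->; rewrite orbT.
apply: (@leq_trans (\sum_(q <- T') v0 q x)).
  apply: leq_sum_sub => // q qT; by rewrite mem_undup mem_cat qT.
apply: leq_trans (sum_poles_le x uT').
rewrite -lez_nat -!natz !natr_sum -subr_ge0 -sumrB.
under eq_bigr do rewrite !natz.
rewrite (eq_bigr (fun q => - vp q x)) => [|q _]; last by rewrite /v0; lia.
by rewrite sumrN (product_formula hK hgen x0 uT' hT') oppr0.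
Qed.

Lemma sum_abs_le x T : x != 0 -> uniq T -> (\sum_(q <- T) absz (vp q x) <= 2 * hgt iota x)%N.
Proof.
move=> x0 uT; rewrite mul2n -addnn; have := leq_add (sum_zeros_le x0 uT) (sum_poles_le x uT).
apply: leq_trans; rewrite -big_split /=; apply: leq_sum => q _.
by rewrite /v0; lia.
Qed.

Section Units.
Variables (D : K -> K) (phi : place iota -> K) (p : place iota).
Hypothesis hD : global_derivation D phi p (2 * gen%:Z - 2).
Variables (S : seq (place iota)) (g1 g2 : K).
Hypotheses (S1 : in_OS S g1) (S2 : in_OS S g2).

Definition euler_char : int := 2 * gen%:Z - 2 + (size (undup S))%:Z.
Definition euler_pos : nat := absz (Num.max 1 euler_char).

Lemma euler_charE : (2 * gen)%:Z - 2 + (size (undup S))%:Z = euler_char.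
Proof. by rewrite /euler_char PoszM. Qed.

Let g10 : g1 != 0. Proof. by case: S1. Qed.
Let g20 : g2 != 0. Proof. by case: S2. Qed.
Let v1 q : q \notin S -> vp q g1 = 0. Proof. by case: S1 => _; apply. Qed.
Let v2 q : q \notin S -> vp q g2 = 0. Proof. by case: S2 => _; apply. Qed.

Section Box.
Variable n' : nat.
Let n := n'.+1.
Let I : finType := ('I_n * 'I_n)%type.
Let o : I := (ord0, ord0).

Definition mono (x y : K) (i : 'I_n'.+1 * 'I_n'.+1) : K := x ^+ i.1 * y ^+ i.2.

Lemma cardI : #|[set: I]| = (n * n)%N.
Proof. by rewrite cardsT card_prod !card_ord. Qed.

Lemma vp_mono q x y i : x != 0 -> y != 0 ->
  vp q (mono x y i) = vp q x * (i.1 : nat)%:Z + vp q y * (i.2 : nat)%:Z.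
Proof.
move=> x0 y0; by rewrite /mono vpM ?expf_neq0 // !vpXE.
Qed.

Lemma mono_neq0 x y i : x != 0 -> y != 0 -> mono x y i != 0.
Proof. by move=> x0 y0; rewrite mulf_neq0 ?expf_neq0. Qed.

Lemma sum_vp_mono i : \sum_(q <- undup S) vp q (mono g1 g2 i) = 0.
Proof.
apply: (product_formula hK hgen); rewrite ?undup_uniq ?mono_neq0 // => q.
rewrite vp_mono // mem_undup; apply: contraR => qS.
by rewrite v1 // v2 // !mul0r addr0.
Qed.

(** The exchange step that yields adapted bases at the places of [S]: [f j] is traded for a
    combination [x] in which it occurs. *)
Lemma exchange_span (A : {set I}) (f : I -> K) (j : I) (x : K) (c : I -> k) :
  j \in A -> c j != 0 -> x = \sum_(i in A) iota (c i) * f i ->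
  exists B : I -> I -> k, forall i, i \in A ->
    f i = \sum_(l in A) iota (B i l) * (if l == j then x else f l).
Proof.
move=> jA cj ex.
exists (fun i l => if i == j then (if l == j then (c j)^-1 else - c l / c j) else (i == l)%:R).
move=> i iA; rewrite (bigD1 j) //= eqxx; have [->|ij] := eqVneq i j; last first.
  rewrite rmorph0 mul0r add0r (bigD1 i) /=; last by rewrite iA.
  rewrite eqxx rmorph1 mul1r (negbTE ij) big1 ?addr0 // => l /andP[_ /negbTE].
  by rewrite eq_sym => ->; rewrite rmorph0 mul0r.
rewrite ex (bigD1 j) //= mulrDr mulrA -rmorphM mulVf // rmorph1 mul1r -addrA mulr_sumr.
rewrite -[LHS]addr0; congr (_ + _); rewrite -big_split big1 //= => l /andP[_ /negbTE ->].
by rewrite mulrA -rmorphM -mulrDl -rmorphD mulNr [_^-1 * _]mulrC subrr rmorph0 mul0r.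
Qed.

Lemma euler_pos_ge (C : nat) : C%:Z * euler_char <= (C * euler_pos)%N%:Z.
Proof. by rewrite PoszM ler_wpM2l // /euler_pos; lia. Qed.

Lemma unit_box_congruence q (u v : K) (m : nat) i :
  vge q u 0 -> vge q v 0 -> vge q (u - 1) m -> vge q (v - 1) m -> vge q (mono u v i - 1) m.
Proof.
move=> hu hv h1 h2.
have X w j : vge q w 0 -> vge q (w - 1) m -> vge q (w ^+ j - 1) m.
  move=> hw h; rewrite subrX1; apply: vgeMr => //; apply: vge_sum => l _; exact: vgeX0.
have -> : mono u v i - 1 = (u ^+ i.1 - 1) * v ^+ i.2 + (v ^+ i.2 - 1).
  by rewrite /mono mulrBl mul1r addrA subrK.
by apply: vgeD; [apply: vgeMr; [apply: X|apply: vgeX0]|apply: X].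
Qed.

(** Off [S] all the functions m_i - 1 with i different from [o] vanish to order [mu]. Along [S] the
    values of all n^2 monomials add up to zero by the product formula, and the loss is the largest
    value at each place, at most n' (v0 g1 + v0 g2), which sums to the heights. *)
Lemma gcd_bound_indep (a b : k) T : (0 < n')%N -> a != 0 -> b != 0 ->
  indep_on iota [set: I] (mono g1 g2) -> uniq T ->
  ((n * n - 1) * (\sum_(q <- T | q \notin S) v0min q (g1 - iota a) (g2 - iota b)) <=
   'C(n * n - 1, 2) * euler_pos + n' * (hgt iota g1 + hgt iota g2))%N.
Proof.
move=> n'0 a0 b0 ind uT.
have ia0 : iota a != 0 by rewrite fmorph_eq0.
have ib0 : iota b != 0 by rewrite fmorph_eq0.
pose u := g1 / iota a; pose v := g2 / iota b.
have u0 : u != 0 by rewrite mulf_neq0 ?invr_eq0.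
have v0' : v != 0 by rewrite mulf_neq0 ?invr_eq0.
have vu q : vp q u = vp q g1 by rewrite vpM ?invr_eq0 // vpV vp_iota subr0.
have vv q : vp q v = vp q g2 by rewrite vpM ?invr_eq0 // vpV vp_iota subr0.
pose m := mono u v.
have m0 i : m i != 0 by apply: mono_neq0.
have vm q i : vp q (m i) = vp q (mono g1 g2 i) by rewrite !vp_mono // vu vv.
have mo : m o = 1 by rewrite /m /mono !expr0 mulr1.
have em i : m i = iota (a ^- i.1 * b ^- i.2) * mono g1 g2 i.
  rewrite /m /mono /u /v !exprMn !exprVn rmorphM !fmorphV !rmorphXn.
  by rewrite mulrACA mulrC.
have indm : indep_on iota [set: I] m.
  move=> c hc i _; have := ind (fun i => c i * (a ^- i.1 * b ^- i.2)).
  have -> : \sum_(i in [set: I]) iota (c i * (a ^- i.1 * b ^- i.2)) * mono g1 g2 i =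
            \sum_(i in [set: I]) iota (c i) * m i.
    by apply: eq_bigr => j _; rewrite em rmorphM mulrA.
  move=> /(_ hc i (finset.in_setT _)) /eqP; rewrite mulf_eq0 => /orP[/eqP //|].
  by rewrite mulf_eq0 !invr_eq0 !expf_eq0 (negbTE a0) (negbTE b0) !andbF.
pose A : {set I} := [set~ o].
have cA : #|A| = (n * n - 1)%N by rewrite cardsC1 card_prod !card_ord subn1.
pose f i := m i - 1.
have indf : indep_on iota A f.
  move=> c hc i iA.
  pose c' i := if i == o then - \sum_(j in A) c j else c i.
  have : \sum_(j in [set: I]) iota (c' j) * m j = 0.
    rewrite (bigD1 o) ?finset.in_setT //= /c' eqxx mo mulr1 rmorphN rmorph_sum /= addrC.
    rewrite (eq_big (fun j => j \in A) (fun j => iota (c j) * m j)); first last.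
    - by move=> j; rewrite !inE => /= /negbTE ->.
    - by move=> j; rewrite !inE.
    rewrite -sumrB -[RHS]hc; apply: eq_bigr => j _.
    by rewrite mulrBr mulr1.
  move=> /indm /(_ i (finset.in_setT _)); rewrite /c'.
  by move: iA; rewrite !inE => /negbTE ->.
pose mu q := v0min q (g1 - iota a) (g2 - iota b).
pose bd' q := (n' * (v0 q g1 + v0 q g2))%N.
pose e q : int := if q \in S then \sum_i vp q (m i) - (bd' q)%:Z else (#|A| * mu q)%N%:Z.
pose T' := undup (S ++ T); have uT' : uniq T' by apply: undup_uniq.
have ST' : {subset S <= T'} by move=> q qS; rewrite mem_undup mem_cat qS.
have hS q : q \in S -> adapted_basis q A f (e q).
  move=> qS.
  (* [m s] has the largest value at [q]: the differences m_i - m_s span the same space as the m_i -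
     1, and each has at least the value of m_i. *)
  case: (@arg_maxP _ _ _ o xpredT (fun i => vp q (m i)) isT) => s _ hs.
  (* The index set omits [o], so the slot [s], whose difference would be 0, is given to the monomial
     m_o = 1. *)
  pose sg (i : I) := if i == s then o else i.
  exists (fun i => m (sg i) - m s),
    (fun i j => (if i == s then 0 else (i == j)%:R) - (if j == s then 1 else 0)),
    (fun i => vp q (m (sg i))); split.
  - move=> i; rewrite !inE => io.
    have [so|so] := eqVneq s o.
      rewrite (bigD1 i) ?inE //= so (negbTE io) eqxx subr0 rmorph1 mul1r /sg so (negbTE io) mo.
      rewrite big1 ?addr0 // => j; rewrite !inE => /andP[jo ji].
      by rewrite (negbTE jo) eq_sym (negbTE ji) subr0 rmorph0 mul0r.
    have [is_|is_] := eqVneq i s.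
      rewrite (bigD1 s) ?inE //= eqxx sub0r rmorphN rmorph1 mulN1r /sg eqxx mo opprB /f is_.
      rewrite big1 ?addr0 // => j; rewrite !inE => /andP[_ js].
      by rewrite (negbTE js) subr0 rmorph0 mul0r.
    rewrite (bigD1 s) ?inE //= eqxx (negbTE is_) sub0r rmorphN rmorph1 mulN1r.
    rewrite (bigD1 i) /=; last by rewrite !inE io is_.
    rewrite eqxx (negbTE is_) subr0 rmorph1 mul1r /sg eqxx (negbTE is_) mo opprB.
    rewrite big1 ?addr0; last first.
      move=> j; rewrite !inE => /andP[/andP[_ js] ji].
      by rewrite (negbTE js) eq_sym (negbTE ji) subr0 rmorph0 mul0r.
    by rewrite /f addrC addrA subrK.
  - move=> j _; apply: vgeB; right => //; exact: hs.
  - rewrite /e qS; have hbd : vp q (m s) <= (bd' q)%:Z.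
      rewrite vm vp_mono // /bd' /v0; move: (leq_ord s.1) (leq_ord s.2).
      move: (s.1 : nat) (s.2 : nat) (vp q g1) (vp q g2) => i j x y hi hj.
      by rewrite mulnDr PoszD; apply: lerD; apply: mulz_max0_le.
    have -> : \sum_(j in A) vp q (m (sg j)) = \sum_i vp q (m i) - vp q (m s).
      have [so|so] := eqVneq s o.
        rewrite [in RHS](bigD1 o) //= so addrAC subrr add0r.
        apply: eq_big => [j|j]; first by rewrite !inE.
        by rewrite !inE /sg so => /negbTE ->.
      rewrite [in RHS](bigD1 s) //= addrAC subrr add0r (bigD1 s) ?inE //= /sg eqxx.
      rewrite [in RHS](bigD1 o) /=; last by rewrite eq_sym.
      congr (_ + _); apply: eq_big => [j|j]; first by rewrite !inE andbC.
      by rewrite !inE => /andP[_ /negbTE ->].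
    by rewrite lerD2l lerN2.
have hN q : q \notin S -> exists l : nat, (forall i, i \in A -> vge q (f i) l) /\ e q <= (#|A| * l)%N.
  move=> qS; exists (mu q); rewrite /e (negbTE qS); split=> // i _.
  have uq : vge q u 0 by right; rewrite vu v1.
  have vq : vge q v 0 by right; rewrite vv v2.
  have [mu0|mu0] := posnP (mu q).
    rewrite mu0; apply: vgeB; last exact: vge_one.
    by apply: vgeMl; apply: vgeX0.
  have := mu0; rewrite /mu /v0min leq_min => /andP[h1 h2].
  apply: unit_box_congruence => //.
    have -> : u - 1 = (g1 - iota a) * (iota a)^-1 by rewrite mulrBl mulfV.
    apply: vgeMr; last by right; rewrite vpV vp_iota.
    by apply: vge_le (vge_v0 h1); rewrite lez_nat geq_minl.
  have -> : v - 1 = (g2 - iota b) * (iota b)^-1 by rewrite mulrBl mulfV.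
  apply: vgeMr; last by right; rewrite vpV vp_iota.
  by apply: vge_le (vge_v0 h2); rewrite lez_nat geq_minr.
have := wronskian_bound hD hK hgen indf uT' ST' hS hN.
rewrite -/euler_char => hW.
have hW' := le_trans hW (euler_pos_ge _).
have eS : \sum_(q <- T') e q =
    (#|A| * \sum_(q <- T' | q \notin S) mu q)%N%:Z - (\sum_(q <- undup S) bd' q)%N%:Z.
  rewrite (bigID (mem S)) /= addrC; congr (_ + _).
    rewrite big_distrr /= -natz natr_sum; apply: eq_bigr => q /negbTE qS.
    by rewrite /e qS natz.
  rewrite -big_filter (perm_big (undup S)); last first.
    apply: uniq_perm; rewrite ?filter_uniq ?undup_uniq // => q.
    by rewrite mem_filter mem_undup; case: (boolP (q \in S)) => // /ST' ->.
  transitivity (\sum_(q <- undup S) (\sum_i vp q (m i) - (bd' q)%:Z)).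
    by rewrite big_seq [RHS]big_seq; apply: eq_bigr => q; rewrite mem_undup /e => ->.
  rewrite sumrB exchange_big big1 /= => [|i _].
    rewrite sub0r -[X in _ = - X]natz natr_sum; congr (- _); apply: eq_bigr => q _; by rewrite natz.
  by rewrite -[RHS](sum_vp_mono i); apply: eq_bigr => q _; rewrite vm.
have hbd : (\sum_(q <- undup S) bd' q <= n' * (hgt iota g1 + hgt iota g2))%N.
  rewrite /bd' -big_distrr /= leq_mul2l big_split /= leq_add ?orbT //;
    by apply: sum_zeros_le; rewrite ?undup_uniq.
have hT : (\sum_(q <- T | q \notin S) mu q <= \sum_(q <- T' | q \notin S) mu q)%N.
  rewrite -big_filter -[leqRHS]big_filter; apply: leq_sum_sub; rewrite ?filter_uniq //.
  by move=> q; rewrite !mem_filter => /andP[-> qT]; rewrite mem_undup mem_cat qT orbT.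
have hT2 : (#|A| * \sum_(q <- T | q \notin S) mu q <= #|A| * \sum_(q <- T' | q \notin S) mu q)%N.
  by rewrite leq_mul2l hT orbT.
rewrite eS in hW'; rewrite cA in hW' hT2.
exact: leq_of_subz hW' hbd hT2.
Qed.

Lemma id_span (A : {set I}) (f : I -> K) i : i \in A ->
  f i = \sum_(j in A) iota ((i == j)%:R) * f j.
Proof.
move=> iA; rewrite (bigD1 i) //= eqxx rmorph1 mul1r big1 ?addr0 // => j /andP[_ /negbTE].
by rewrite eq_sym => ->; rewrite rmorph0 mul0r.
Qed.

Lemma ev2_mono (H : {poly {poly k}}) x y : (size H <= n)%N ->
  (forall j, (size (H`_j)%R <= n)%N) ->
  eval2 iota H x y = \sum_(i : 'I_n * 'I_n) iota (H`_i.2)`_i.1 * mono x y i.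
Proof.
move=> sH sHj; rewrite (ev2_coef _ _ _ sH).
transitivity (\sum_(j < n) \sum_(i < n) iota (H`_j)`_i * (x ^+ i * y ^+ j)).
  apply: eq_bigr => j _; rewrite (polyK_coef _ _ (sHj j)) mulr_suml.
  by apply: eq_bigr => i _; rewrite mulrA.
by rewrite exchange_big pair_bigA.
Qed.

Lemma sum_S_vp_mono (A : {set I}) :
  \sum_(q <- undup S) \sum_(i in A) vp q (mono g1 g2 i) = 0.
Proof. by rewrite exchange_big big1 // => i _; apply: sum_vp_mono. Qed.

Lemma vge_mono0 q i : q \notin S -> vge q (mono g1 g2 i) 0.
Proof. by move=> qS; right; rewrite vp_mono // v1 // v2 // !mul0r. Qed.

Lemma wronskian_bound_S (A : {set I}) (f : I -> K) (e : place iota -> int) :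
  indep_on iota A f -> (forall q, q \notin S -> forall i, i \in A -> vge q (f i) 0) ->
  (forall q, q \in S -> adapted_basis q A f (e q)) ->
  \sum_(q <- undup S) e q <= ('C(#|A|, 2) * euler_pos)%N%:Z.
Proof.
move=> indf fint hS; apply: le_trans (euler_pos_ge _).
pose e' q := if q \in S then e q else 0.
have -> : \sum_(q <- undup S) e q = \sum_(q <- undup S) e' q.
  by rewrite big_seq [RHS]big_seq; apply: eq_bigr => q; rewrite mem_undup /e' => ->.
apply: (wronskian_bound hD hK hgen indf).
- exact: undup_uniq.
- by move=> q; rewrite mem_undup.
- by move=> q qS; rewrite /e' qS; apply: hS.
- move=> q qS; exists 0%N; rewrite /e' (negbTE qS) muln0; split=> // i iA.
  exact: fint.
Qed.

(** In h = H(g1, g2) the monomial 1 occurs with coefficient H(0, 0). At a place of [S] where [h]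
    vanishes it replaces 1, of value 0, so the Wronskian gains v0(h) over a family whose values add
    up to zero along [S]. *)
Lemma proximity_bound (H : {poly {poly k}}) T : (size H <= n)%N ->
  (forall j, (size (H`_j)%R <= n)%N) -> (H`_0)`_0 != 0 ->
  indep_on iota [set: I] (mono g1 g2) -> uniq T ->
  eval2 iota H g1 g2 != 0 /\
  (\sum_(q <- T | q \in S) v0 q (eval2 iota H g1 g2) <= 'C(n * n, 2) * euler_pos)%N.
Proof.
move=> sH sHj H0 ind uT; set h := eval2 iota H g1 g2.
pose c (i : I) := (H`_i.2)`_i.1.
have eh : h = \sum_(i in [set: I]) iota (c i) * mono g1 g2 i.
  by rewrite /h (ev2_mono _ _ sH sHj); apply: eq_bigl => i; rewrite finset.in_setT.
split.
  apply/eqP => h0; have := ind c; rewrite -eh => /(_ h0 o (finset.in_setT _)) /eqP.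
  by rewrite /c /= (negbTE H0).
pose e q : int := \sum_(i in [set: I]) vp q (mono g1 g2 i) + (v0 q h)%:Z.
have := @wronskian_bound_S [set: I] (mono g1 g2) e ind (fun q qS i _ => vge_mono0 i qS).
rewrite cardI => hW; rewrite -big_filter.
apply: (@leq_trans (\sum_(q <- undup S) v0 q h)).
  apply: leq_sum_sub; rewrite ?filter_uniq ?undup_uniq // => q.
  by rewrite mem_filter mem_undup => /andP[].
rewrite -lez_nat; apply: le_trans (hW _).
  rewrite big_split /= sum_S_vp_mono add0r -[leLHS]natz natr_sum.
  by apply: ler_sum => q _; rewrite natz.
move=> q qS; have mo : mono g1 g2 o = 1 by rewrite /mono !expr0 mulr1.
have [h0|h0] := posnP (v0 q h).
  exists (mono g1 g2), (fun i j => (i == j)%:R), (fun i => vp q (mono g1 g2 i)); split.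
  - by move=> i iA; apply: id_span.
  - by move=> j _; apply: vge_vp.
  - by rewrite /e h0 addr0.
have [B hB] := @exchange_span [set: I] (mono g1 g2) o h c (finset.in_setT _) H0 eh.
exists (fun l => if l == o then h else mono g1 g2 l), B,
  (fun l => if l == o then (v0 q h)%:Z else vp q (mono g1 g2 l)); split=> //.
  by move=> j _; case: ifP => _; [apply: vge_v0|apply: vge_vp].
rewrite /e (bigD1 o) ?finset.in_setT //= [leRHS](bigD1 o) ?finset.in_setT //= ?eqxx mo vp1 add0r addrC.
rewrite lerD2r; apply: ler_sum => j /andP[_ /negbTE ->]; exact: lexx.
Qed.

(** In a relation of minimal support, the monomials other than [i0] are independent, and any of them
    can be exchanged for [i0]. At each place of [S] the one of least value is dropped, which gains
    its distance to [i0]. The Wronskian bound limits the sum of these distances, and they dominate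
    the poles of m_i1 / m_i0. *)
Lemma near_dependence : ~ indep_on iota [set: I] (mono g1 g2) ->
  exists a b : int, [/\ (a != 0) || (b != 0), (absz a <= n')%N, (absz b <= n')%N &
    (hgt iota (g1 ^ a * g2 ^ b) <= (n * n) * (n * n) * euler_pos)%N].
Proof.
move=> nind; pose m := mono g1 g2.
have m0 i : m i != 0 by apply: mono_neq0.
pose supp (c : I -> k) : {set I} := [set i | c i != 0].
pose good l := `[< exists c : I -> k, [/\ exists i, c i != 0,
  \sum_i iota (c i) * m i = 0 & #|supp c| = l] >].
have ex : exists l, good l.
  move/existsNP: nind => [c /not_implyP [hc /existsNP [i /not_implyP [_ ci]]]].
  exists #|supp c|; apply/asboolP; exists c; split=> //; first by exists i; apply/eqP.
  by rewrite -[RHS]hc; apply: eq_bigl => j; rewrite finset.in_setT.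
case: (ex_minnP ex) => s /asboolP [c [[i0 ci0] hc sc]] smin.
pose A := supp c; pose A' := A :\ i0.
have i0A : i0 \in A by rewrite inE.
have cA : #|A'|.+1 = s by rewrite -sc (cardsD1 i0 (supp c)) i0A add1n.
have sumA : \sum_(i in A) iota (c i) * m i = 0.
  rewrite -[RHS]hc [RHS](bigID (fun i => i \in A)) /= [X in _ + X]big1 ?addr0 // => i.
  by rewrite inE negbK => /eqP ->; rewrite rmorph0 mul0r.
have A'E i : (i \in A') = (i != i0) && (i \in A) by rewrite !inE.
have em0 : m i0 = \sum_(i in A') iota (- c i / c i0) * m i.
  have h0 : iota (c i0) != 0 by rewrite fmorph_eq0.
  apply: (mulfI h0); move: sumA; rewrite (bigD1 i0) //= => /eqP; rewrite addr_eq0 => /eqP ->.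
  rewrite mulr_sumr -sumrN; apply: eq_big => [i|i _]; first by rewrite A'E andbC.
  by rewrite [RHS]mulrA -(rmorphM iota) [c i0 * _]mulrC divfK // rmorphN mulNr.
have [i1 i1A'] : exists i1, i1 \in A'.
  apply: contrapT => hn; move/eqP: em0; rewrite big1 ?(negbTE (m0 _)) // => i iA'.
  by case: hn; exists i.
have indA' : indep_on iota A' m.
  move=> d hd i iA'; apply/eqP/negPn/negP => di.
  pose d' j := if j \in A' then d j else 0.
  have : good #|supp d'|.
    apply/asboolP; exists d'; split=> //; first by exists i; rewrite /d' iA'.
    rewrite -[RHS]hd [RHS]big_mkcond; apply: eq_bigr => j _; rewrite /d'.
    by case: ifP => // _; rewrite rmorph0 mul0r.
  move/smin; rewrite -cA ltnNge => /negP; apply; apply: subset_leq_card.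
  by apply/fintype.subsetP => j; rewrite inE /d'; case: (boolP (j \in A')) => // _ /eqP.
have /choice[st hst] : forall q, exists s, s \in A /\ forall i, i \in A -> vp q (m s) <= vp q (m i).
  by move=> q; case: (@arg_minP _ _ _ i0 (fun i => i \in A) (fun i => vp q (m i)) i0A) => j jA hj; exists j.
pose e q : int := \sum_(i in A) vp q (m i) - vp q (m (st q)).
have hsum q : \sum_(i in A) vp q (m i) = vp q (m i0) + \sum_(i in A') vp q (m i).
  by rewrite (bigD1 i0) //=; congr (_ + _); apply: eq_bigl => i; rewrite A'E andbC.
have hW : \sum_(q <- undup S) e q <= ('C(#|A'|, 2) * euler_pos)%N%:Z.
  apply: (wronskian_bound_S indA') => [q qS i _|q qS]; first exact: vge_mono0.
  have [sA smin'] := hst q; have [si0|si0] := eqVneq (st q) i0.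
    exists m, (fun i j => (i == j)%:R), (fun i => vp q (m i)); split.
    - by move=> i iA; apply: id_span.
    - by move=> j _; apply: vge_vp.
    - by rewrite /e si0 hsum addrAC subrr add0r.
  have sA' : st q \in A' by rewrite A'E si0.
  have cs : - c (st q) / c i0 != 0.
    by rewrite mulf_neq0 ?invr_eq0 // oppr_eq0; move: sA; rewrite inE.
  have [B hB] := @exchange_span A' m (st q) (m i0) (fun i => - c i / c i0) sA' cs em0.
  exists (fun l => if l == st q then m i0 else m l), B,
    (fun l => if l == st q then vp q (m i0) else vp q (m l)); split=> //.
    by move=> j _; case: ifP => _; apply: vge_vp.
  rewrite /e hsum (bigD1 (st q)) //= [leRHS](bigD1 (st q)) //= eqxx.
  rewrite addrA addrAC addrK lerD2l.
  by apply: ler_sum => j /andP[_ /negbTE ->]; exact: lexx.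
rewrite sumrB sum_S_vp_mono sub0r in hW.
exists (i1.1%:Z - i0.1%:Z), (i1.2%:Z - i0.2%:Z).
have hz : g1 ^ (i1.1%:Z - i0.1%:Z) * g2 ^ (i1.2%:Z - i0.2%:Z) = m i1 / m i0.
  by rewrite !expfzDr // -!exprnN -!exprnP /m /mono invfM mulrACA.
split.
- move: i1A'; rewrite A'E => /andP[ne _]; rewrite -negb_and; apply: contra ne.
  rewrite !subr_eq0 => /andP[/eqP[h1] /eqP[h2]]; apply/eqP.
  by apply: injective_projections; apply: val_inj.
- exact: abszB_le (leq_ord i1.1) (leq_ord i0.1).
- exact: abszB_le (leq_ord i1.2) (leq_ord i0.2).
rewrite hz; apply: (@leq_trans ('C(#|A'|, 2) * euler_pos)); last first.
  rewrite leq_mul2r; apply/orP; right.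
  have hA : (#|A'| <= n * n)%N by rewrite -cardI subset_leq_card //; apply/fintype.subsetP => j; rewrite finset.in_setT.
  exact: leq_trans (bin2_le _) (leq_mul hA hA).
have i1A : i1 \in A by move: i1A'; rewrite A'E => /andP[].
rewrite /hgt (@psumE _ _ _ _ (undup S)) ?undup_uniq //; last first.
  move=> q; rewrite mem_undup; apply: contraR => qS.
  by rewrite vpM ?invr_eq0 // vpV !vp_mono // v1 // v2.
rewrite -lez_nat; apply: le_trans hW; rewrite -[leLHS]natz natr_sum.
apply: (@le_trans _ _ (\sum_(q <- undup S) (vp q (m i0) - vp q (m (st q))))); last first.
  by rewrite sumrB sum_vp_mono sub0r.
apply: ler_sum => q _.
have [_ smin'] := hst q; have h0 := smin' _ i0A; have h1 := smin' _ i1A.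
rewrite natz vpM ?invr_eq0 // vpV; move: h0 h1; rewrite -/m.
by move: (vp q (m i0)) (vp q (m i1)) (vp q (m (st q))) => x y z; clear; lia.
Qed.

End Box.
End Units.
End Heights.

Lemma absz_shift_inj (a b : int) (m : nat) : (absz a <= m)%N -> (absz b <= m)%N ->
  absz (b + m%:Z) = absz (a + m%:Z) -> a = b.
Proof. lia. Qed.

(** * Monomials of small height *)

Section NearDependence.
Variables (k : closedFieldType) (K : fieldType) (iota : {rmorphism k -> K}).
Implicit Types (q : place iota) (x y z w u : K) (T : seq (place iota)).

Definition one_mod q (m : nat) x : Prop := [/\ x != 0, vp q x = 0 & vge q (x - 1) m].

Lemma one_modP q (m : nat) x : (0 < m)%N -> vge q (x - 1) m -> one_mod q m x.
Proof.
move=> m0 h; have [|h1 h2] := @vpD_lt _ _ _ q 1 (x - 1) (oner_neq0 _).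
  by rewrite vp1; apply: vge_le h; lia.
by move: h1 h2; rewrite addrC subrK vp1 => h1 h2; split.
Qed.

Lemma one_modM q m x y : one_mod q m x -> one_mod q m y -> one_mod q m (x * y).
Proof.
move=> [x0 vx hx] [y0 vy hy]; split; [by rewrite mulf_neq0|by rewrite vpM // vx vy|].
have -> : x * y - 1 = (x - 1) * y + (y - 1) by rewrite mulrBl mul1r addrA subrK.
by apply: vgeD => //; apply: vgeMr => //; right; rewrite vy.
Qed.

Lemma one_modV q m x : one_mod q m x -> one_mod q m x^-1.
Proof.
move=> [x0 vx hx]; split; [by rewrite invr_eq0|by rewrite vpV vx oppr0|].
have -> : x^-1 - 1 = - ((x - 1) * x^-1) by rewrite mulrBl mulfV // mul1r opprB.
by apply: vgeN; apply: vgeMr => //; right; rewrite vpV vx.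
Qed.

Lemma one_modXz q m x (a : int) : one_mod q m x -> one_mod q m (x ^ a).
Proof.
move=> h; have X (l : nat) : one_mod q m (x ^+ l).
  elim: l => [|l IH]; last by rewrite exprS; apply: one_modM.
  by rewrite expr0; split; rewrite ?oner_neq0 ?vp1 ?subrr //; left.
by case: a => a; [apply: X|rewrite NegzE -exprnN; apply/one_modV/X].
Qed.

(** The congruences are made multiplicative, x/c and y/d being 1 up to order [mu], because the
    exponents may be negative. *)
Lemma v0min_le_near q x y (c d : k) (a b : int) : c != 0 -> d != 0 ->
  x ^ a * y ^ b != iota (c ^ a * d ^ b) ->
  (v0min q (x - iota c) (y - iota d) <= v0 q (x ^ a * y ^ b - iota (c ^ a * d ^ b))%R)%N.
Proof.
move=> c0 d0 hne; set z := x ^ a * y ^ b; set e := c ^ a * d ^ b; set mu := v0min q _ _.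
have [->//|mu0] := posnP mu.
have := mu0; rewrite {1}/mu /v0min leq_min => /andP[h1 h2].
have ic0 : iota c != 0 by rewrite fmorph_eq0.
have id0 : iota d != 0 by rewrite fmorph_eq0.
have key w f (l : nat) : iota f != 0 -> (mu <= l)%N -> vge q (w - iota f) l -> one_mod q mu (w / iota f).
  move=> f0 hl hw; apply: one_modP => //.
  have -> : w / iota f - 1 = (w - iota f) / iota f by rewrite mulrBl mulfV.
  by apply: vgeMr; [apply: vge_le hw|right; rewrite vpV vp_iota].
have k1 := key _ _ _ ic0 (geq_minl _ _) (vge_v0 h1).
have k2 := key _ _ _ id0 (geq_minr _ _) (vge_v0 h2).
have := one_modM (one_modXz a k1) (one_modXz b k2).
have ie0 : iota e != 0 by rewrite fmorph_eq0 mulf_neq0 // expfz_neq0.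
have -> : (x / iota c) ^ a * (y / iota d) ^ b = z / iota e.
  by rewrite !expfzMl !exprz_inv -!invr_expz mulrACA -invfM /z /e rmorphM /= !fmorphXz.
move=> [_ _ hz]; have : vge q (z - iota e) mu.
  have -> : z - iota e = (z / iota e - 1) * iota e by rewrite mulrBl divfK // mul1r.
  by apply: vgeMr => //; apply: vge_iota.
have ze0 : z - iota e != 0 by rewrite subr_eq0.
by move/(vgeE ze0); rewrite /v0; lia.
Qed.

Hypotheses (hK : is_function_field iota).
Variables (gen : nat).
Hypothesis hgen : is_genus iota gen.

Lemma sum_v0min_near T x y (c d : k) (a b : int) : c != 0 -> d != 0 ->
  (forall e, x ^ a * y ^ b <> iota e) -> uniq T ->
  (\sum_(q <- T) v0min q (x - iota c) (y - iota d) <= hgt iota (x ^ a * y ^ b)%R)%N.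
Proof.
move=> c0 d0 hz uT; have hne := introN eqP (hz (c ^ a * d ^ b)).
rewrite -(hgt_subC iota _ (c ^ a * d ^ b)).
apply: leq_trans (sum_zeros_le hK hgen _ uT); last by rewrite subr_eq0.
by apply: leq_sum => q _; apply: v0min_le_near.
Qed.

Section Laurent.
Variables (I : finType) (P : pred I) (c : I -> k) (E : I -> int) (kap : nat) (z : K).
Hypotheses (hE : forall i, (absz (E i) <= kap)%N) (tz : transc iota z).
Let y := \sum_(i | P i) iota (c i) * z ^ (E i).

Let z0 : z != 0.
Proof. by apply/eqP; have := transc_notconst tz (c := 0); rewrite rmorph0. Qed.

Lemma laurent_height T : uniq T ->
  (\sum_(q <- T) absz (vp q y) <= 4 * kap * hgt iota z)%N.
Proof.
move=> uT; have [->|y0] := eqVneq y 0.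
  by rewrite big1 // => q _; rewrite vp0.
apply: leq_trans (sum_abs_le hK hgen y0 uT) _.
(* One factor 2 passes from the zeros and poles of [y] to its height, the other from those of [z] to
   the height of [z]. *)
have -> : (4 * kap * hgt iota z = 2 * (2 * (kap * hgt iota z)))%N by rewrite !mulnA.
rewrite leq_mul2l /=.
apply: psum_le => T' uT'; rewrite mulnCA.
apply: leq_trans (_ : kap * \sum_(q <- T') absz (vp q z) <= _)%N; last first.
  by rewrite leq_mul2l (sum_abs_le hK hgen z0 uT') orbT.
rewrite big_distrr /=; apply: leq_sum => q _.
have : vge q y (- (kap * absz (vp q z))%N%:Z).
  apply: vge_sum => i _; apply: vgeMl; first exact: vge_iota.
  right; rewrite vpXz; have := hE i; move: (E i) (vp q z) => a v ha.
  have h1 : (absz a * absz v <= kap * absz v)%N by rewrite leq_mul2r ha orbT.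
  by have := abszM v a; rewrite mulnC in h1; rewrite mulnC; lia.
by move/(vgeE y0); lia.
Qed.

(** Multiplication by z^kap turns the sum into a polynomial in the transcendental [z], with distinct
    exponents. *)
Lemma laurent_neq0 i0 : P i0 -> c i0 != 0 ->
  (forall i j, P i -> P j -> E i = E j -> i = j) -> y != 0.
Proof.
move=> Pi0 ci0 inj; apply/eqP => y0.
pose p := \sum_(i | P i) c i *: 'X^(absz (E i + kap%:Z)).
have : polyK iota p z = 0.
  transitivity (z ^ kap%:Z * y); last by rewrite y0 mulr0.
  rewrite polyK_sum /y mulr_sumr; apply: eq_bigr => i _.
  rewrite -mul_polyC polyKM polyKC polyKXn polyKX mulrCA -expfzDr //.
  have -> : kap%:Z + E i = (absz (E i + kap%:Z))%:Z by have := hE i; lia.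
  by rewrite -exprnP.
move/tz => p0; have := congr1 (fun r : {poly k} => r`_(absz (E i0 + kap%:Z))) p0.
rewrite coef0 coef_sum (bigD1 i0) //= coefZ coefXn eqxx mulr1 big1 ?addr0.
  by move/eqP; rewrite (negbTE ci0).
move=> i /andP[Pi ne]; rewrite coefZ coefXn; case: eqP => [h|]; last by rewrite mulr0.
case/eqP: ne; apply: inj => //; exact: absz_shift_inj (hE i) (hE i0) h.
Qed.
End Laurent.

Lemma absz_lin (a b x y : int) (m : nat) : (absz x <= m)%N -> (absz y <= m)%N ->
  (absz (x * a + y * b)%R <= (absz a + absz b) * m)%N.
Proof.
move=> hx hy; have h1 : (absz x * absz a <= absz a * m)%N by rewrite mulnC leq_mul2l hx orbT.
have h2 : (absz y * absz b <= absz b * m)%N by rewrite mulnC leq_mul2l hy orbT.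
by rewrite mulnDl; move: (abszM x a) (abszM y b) h1 h2; lia.
Qed.

(** At each place [B] bounds either the zero of H(x, y), hence the gcd, or the orders of [x] and
    [y], in which case [gcd_pointwise] applies. *)
Definition proximity_control (H : {poly {poly k}}) x y (C : nat) z : Prop :=
  exists B : place iota -> nat,
  (forall T, uniq T -> (\sum_(q <- T) B q <= C * hgt iota z)%N) /\
  forall q, (eval2 iota H x y != 0 /\ (v0 q (eval2 iota H x y) <= B q)%N) \/
    (absz (vp q x) + absz (vp q y) <= B q)%N.

(* With [al * a + be * b = 1] the monomials in [g1, g2] become monomials in [z] and [w];
   grouping the terms of [H] by their exponent of [w], the groups have pairwise distinct
   valuations unless [vp q w] is controlled by [z]. *)
Lemma near_proximity_primitive (n' : nat) (H : {poly {poly k}}) (g1 g2 : K) (a b al be : int) :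
  (size H <= n'.+1)%N -> (forall j, (size (H`_j)%R <= n'.+1)%N) -> (H`_0)`_0 != 0 ->
  al * a + be * b = 1 -> g1 != 0 -> g2 != 0 ->
  let z := g1 ^ a * g2 ^ b in transc iota z ->
  let M := (absz al + absz be + absz a + absz b).+1 in
  proximity_control H g1 g2
    (M * ((n'.+1 * n'.+1) * (4 * ((absz al + absz be) * n')) + 2)) z.
Proof.
move=> sH sHj H0 bez g10 g20 z tz M.
have z0 : z != 0 by apply/eqP; have := transc_notconst tz (c := 0); rewrite rmorph0.
pose w := g1 ^ be * g2 ^ (- al).
have w0 : w != 0 by rewrite mulf_neq0 // expfz_neq0.
have eg1 : g1 = z ^ al * w ^ b.
  rewrite /z /w !expfzMl !exprz_exp mulrACA -!expfzDr // (_ : a * al + be * b = 1); last by rewrite -bez; ring.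
  by rewrite (_ : b * al + - al * b = 0) ?expr1z ?expr0z ?mulr1 //; ring.
have eg2 : g2 = z ^ be * w ^ (- a).
  rewrite /z /w !expfzMl !exprz_exp mulrACA -!expfzDr // (_ : b * be + - al * - a = 1); last by rewrite -bez; ring.
  by rewrite (_ : a * be + be * - a = 0) ?expr1z ?expr0z ?mul1r //; ring.
pose I : finType := ('I_n'.+1 * 'I_n'.+1)%type.
pose o : I := (ord0, ord0).
pose E (i : 'I_n'.+1 * 'I_n'.+1) : int := (i.1 : nat)%:Z * al + (i.2 : nat)%:Z * be.
pose L (i : 'I_n'.+1 * 'I_n'.+1) : int := (i.1 : nat)%:Z * b - (i.2 : nat)%:Z * a.
pose kap := ((absz al + absz be) * n')%N.
have hE (i : I) : (absz (E i) <= kap)%N by apply: absz_lin; apply: leq_ord.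
have EL (i j : I) : E i = E j -> L i = L j -> i = j.
  move=> e1 e2; have d1 (l : I) : (l.1 : nat)%:Z = a * E l + be * L l.
    by rewrite -[LHS]mulr1 -bez /E /L; ring.
  have d2 (l : I) : (l.2 : nat)%:Z = b * E l - al * L l.
    by rewrite -[LHS]mulr1 -bez /E /L; ring.
  apply: injective_projections; apply: val_inj; apply/eqP; rewrite -eqz_nat.
    by rewrite /= (d1 i) (d1 j) e1 e2.
  by rewrite /= (d2 i) (d2 j) e1 e2.
(* A canonical representative of the monomials with the same exponent [L] of [w]. *)
pose rep (i : I) : I := odflt i [pick j | L j == L i].
have Lrep i : L (rep i) = L i.
  by rewrite /rep; case: pickP => [j /eqP //|/(_ i)]; rewrite eqxx.
have repL i j : L i = L j -> rep i = rep j.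
  move=> e; rewrite /rep (eq_pick (_ : (fun l => L l == L i) =1 (fun l => L l == L j))).
    by case: pickP => // /(_ j); rewrite eqxx.
  by move=> l; rewrite e.
pose c (i : I) := (H`_i.2)`_i.1.
pose C (y : I) := \sum_(i | rep i == y) iota (c i) * z ^ E i.
have eh : eval2 iota H g1 g2 = \sum_y w ^ L y * C y.
  rewrite (ev2_mono iota _ _ sH sHj) (partition_big rep xpredT) //=; apply: eq_bigr => y _.
  rewrite mulr_sumr; apply: eq_bigr => i /eqP ry.
  rewrite [RHS]mulrCA -/(c i) -ry Lrep; congr (_ * _).
  rewrite /mono {1}eg1 {1}eg2 !exprMn !exprnP !exprz_exp mulrACA -!expfzDr // mulrC.
  by congr (w ^ _ * z ^ _); rewrite /L /E; ring.
pose b0 q := (\sum_y absz (vp q (C y)) + absz (vp q z))%N.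
exists (fun q => M * b0 q)%N; split.
  move=> T uT; rewrite -big_distrr /= -mulnA leq_mul2l /=.
  rewrite big_split /= mulnDl; apply: leq_add; last exact: (sum_abs_le hK hgen z0 uT).
  rewrite exchange_big /=; apply: (@leq_trans (\sum_(y : I) 4 * kap * hgt iota z)).
    by apply: leq_sum => y _; apply: laurent_height.
  by rewrite sum_nat_const card_prod card_ord !mulnA.
move=> q; set h := eval2 iota H g1 g2 in eh *.
have Crep (y : I) : C y != 0 -> rep y = y.
  move=> Cy; have [i /eqP ri] : exists i, rep i == y.
    apply: contrapT => hn; case/eqP: Cy; rewrite /C big1 // => i ri; by case: hn; exists i.
  by rewrite -[in RHS]ri; apply: repL; rewrite -ri Lrep.
have vC (y : I) : (absz (vp q (C y)) <= b0 q)%N by rewrite /b0 (bigD1 y) //= -addnA leq_addr.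
have [hw|hw] := leqP (absz (vp q w)) (b0 q); [right|left].
  have hz : (absz (vp q z) <= b0 q)%N by rewrite leq_addl.
  have v1 : vp q g1 = vp q z * al + vp q w * b by rewrite {1}eg1 vpM ?expfz_neq0 // !vpXz.
  have v2 : vp q g2 = vp q z * be + vp q w * - a by rewrite {1}eg2 vpM ?expfz_neq0 // !vpXz.
  have h1 := absz_lin al b hz hw; have h2 := absz_lin be (- a) hz hw.
  rewrite v1 v2; apply: leq_trans (leq_add h1 h2) _; rewrite -mulnDl leq_mul2r.
  by apply/orP; right; rewrite /M; lia.
have X0 (y : I) : C y != 0 -> w ^ L y * C y != 0 by move=> h0; rewrite mulf_neq0 // expfz_neq0.
have vX (y : I) : C y != 0 -> vp q (w ^ L y * C y) = vp q w * L y + vp q (C y).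
  by move=> h0; rewrite vpM ?expfz_neq0 // vpXz.
have Cn (y : I) : w ^ L y * C y != 0 -> C y != 0 by rewrite mulf_eq0 negb_or => /andP[].
(* If two groups had equal value, v(w) times a nonzero integer would be a difference of values of
   the [C y], so |v(w)| <= b0, which is the case already settled. *)
have distinct (i j : I) : w ^ L i * C i != 0 -> w ^ L j * C j != 0 ->
    vp q (w ^ L i * C i) = vp q (w ^ L j * C j) -> i = j.
  move=> /Cn hi /Cn hj; rewrite !vX // => hv; rewrite -(Crep i hi) -(Crep j hj).
  apply/eqP/negPn/negP => ne.
  have ij : i != j by apply: contraNneq ne => ->.
  have LL : L i != L j by apply: contraNneq ne => /repL ->.
  have hb : (absz (vp q (C i)) + absz (vp q (C j)) <= b0 q)%N.
    rewrite /b0 (bigD1 i) //= (bigD1 j) /=; last by rewrite eq_sym.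
    by rewrite addnA -addnA leq_addr.
  have hd : vp q w * (L i - L j) = vp q (C j) - vp q (C i).
    rewrite mulrBr; move: hv; move: (_ * L i) (_ * L j) (vp q (C i)) (vp q (C j)) => x1 x2 x3 x4.
    by clear; lia.
  have := abszM (vp q w) (L i - L j); rewrite hd => hm.
  have l1 : (0 < absz (L i - L j))%N by rewrite absz_gt0 subr_eq0.
  have l2 := leq_pmulr (absz (vp q w)) l1.
  rewrite -hm in l2.
  move: hb hw l2; move: (b0 q) (absz (vp q w)) (vp q (C i)) (vp q (C j)) => b1 b2 b3 b4.
  by clear; lia.
(* The group of the constant term has [w]-exponent 0, and its coefficient is nonzero: within a group
   the exponents of [z] are distinct, and H(0, 0) is one of the coefficients. *)
have Lo : L (rep o) = 0 by rewrite Lrep /L /= !mul0r subr0.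
have Co : C (rep o) != 0.
  apply: (laurent_neq0 hE tz (i0 := o)); [by rewrite eqxx|by rewrite /c|].
  move=> i j /eqP ri /eqP rj e; apply: (EL i j e).
  by rewrite -(Lrep i) -(Lrep j) ri rj.
have [h0 hle] := vp_sum_distinct distinct (X0 _ Co).
rewrite -eh in h0 hle; split=> //; rewrite /v0.
move: hle; rewrite (vX _ Co) Lo mulr0 add0r => hle.
apply: (@leq_trans (b0 q)); last by rewrite leq_pmull.
move: hle (vC (rep o)); move: (vp q h) (vp q (C (rep o))) (b0 q) => x1 x2 x3.
by clear; lia.
Qed.

End NearDependence.

(** * Uniform constants and the final estimate *)

Lemma negpart_mul_le (v e : int) : 1 <= e ->
  (absz (Num.max (0 : int) (- v)) <= absz (Num.max (0 : int) (- (v * e))))%N.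
Proof.
move=> he; case: (leP 0 v) => hv; first by lia.
have : v * e <= v * 1 by apply: ler_wnM2l => //; apply: ltW.
by rewrite mulr1; move: (v * e) => u; lia.
Qed.

Lemma int_bounded1 (f : int -> nat) N : exists M, forall a, (absz a <= N)%N -> (f a <= M)%N.
Proof.
elim: N => [|N [M hM]]; first by exists (f 0) => a; rewrite leqn0 absz_eq0 => /eqP ->.
exists (M + f N.+1%:Z + f (- N.+1%:Z))%N => a ha.
have [h|h] := leqP (absz a) N; first by rewrite -addnA (leq_trans (hM a h)) // leq_addr.
have [->|->] : a = N.+1%:Z \/ a = - N.+1%:Z by lia.
  by rewrite -addnA addnCA leq_addr.
by rewrite leq_addl.
Qed.

Lemma int_bounded2 (f : int -> int -> nat) N :
  exists M, forall a b, (absz a <= N)%N -> (absz b <= N)%N -> (f a b <= M)%N.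
Proof.
have /choice[g hg] := fun a => int_bounded1 (f a) N.
have [M hM] := int_bounded1 g N; exists M => a b ha hb.
exact: leq_trans (hg a b hb) (hM a ha).
Qed.

Lemma poly2_size_bound (k : closedFieldType) (H : {poly {poly k}}) :
  exists n0, forall n, (n0 <= n)%N ->
    (size H <= n.+1)%N /\ forall j, (size (H`_j)%R <= n.+1)%N.
Proof.
exists (size H + \max_(j < size H) size (H`_j)%R)%N => n hn; split.
  by apply: leqW; apply: leq_trans hn; rewrite leq_addr.
move=> j; have [hj|hj] := ltnP j (size H); last by rewrite nth_default // size_poly0.
apply: leqW; apply: leq_trans hn; apply: leq_trans (leq_addl _ _).
exact: (@leq_bigmax _ (fun j : 'I_(size H) => size (H`_j)%R) (Ordinal hj)).
Qed.

(** Dividing the exponents by their gcd d gives coprime ones, for a monomial z' with z = z'^d and no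
    larger height. Only finitely many exponents are bounded by [N], so the constants, which involve
    Bezout coefficients, have a common bound. *)
Lemma near_proximity (k : closedFieldType) (H : {poly {poly k}}) (N : nat) :
  exists C : nat, (H`_0)`_0 != 0 ->
  forall (K : fieldType) (iota : {rmorphism k -> K}), is_function_field iota ->
  forall gen, is_genus iota gen -> forall (g1 g2 : K) (a b : int),
  g1 != 0 -> g2 != 0 -> (absz a <= N)%N -> (absz b <= N)%N -> (a != 0) || (b != 0) ->
  (forall c, g1 ^ a * g2 ^ b <> iota c) ->
  proximity_control iota H g1 g2 C (g1 ^ a * g2 ^ b).
Proof.
have [H0|H0] := eqVneq ((H`_0)`_0) 0; first by exists 0%N.
have [n' /(_ n' (leqnn _)) [sH sHj]] := poly2_size_bound H.
have /choice[f hf] : forall ab : int * int, exists C : nat,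
  (ab.1 != 0) || (ab.2 != 0) ->
  forall (K : fieldType) (iota : {rmorphism k -> K}), is_function_field iota ->
  forall gen, is_genus iota gen -> forall (g1 g2 : K),
  g1 != 0 -> g2 != 0 -> (forall c, g1 ^ ab.1 * g2 ^ ab.2 <> iota c) ->
  proximity_control iota H g1 g2 C (g1 ^ ab.1 * g2 ^ ab.2).
  move=> [a b] /=; have [h0|h0] := boolP ((a != 0) || (b != 0)); last by exists 0%N.
  pose d := gcdz a b; have d0 : d != 0 by rewrite gcdz_eq0 negb_and.
  have [al [be ebez]] := Bezoutz a b.
  pose a' := (a %/ d)%Z; pose b' := (b %/ d)%Z.
  have ea : a = a' * d by rewrite /a' divzK // dvdz_gcdl.
  have eb : b = b' * d by rewrite /b' divzK // dvdz_gcdr.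
  have bez : al * a' + be * b' = 1.
    by apply: (mulIf d0); rewrite mulrDl -!mulrA -ea -eb mul1r.
  have d1 : 1 <= d by have : 0 <= d by []; lia.
  exists ((absz al + absz be + absz a' + absz b').+1 *
     ((n'.+1 * n'.+1) * (4 * ((absz al + absz be) * n')) + 2))%N => _.
  move=> K iota hK gen hgen g1 g2 g10 g20 hz.
  pose z' := g1 ^ a' * g2 ^ b'.
  have ez : g1 ^ a * g2 ^ b = z' ^ d by rewrite ea eb /z' expfzMl !exprz_exp.
  have tz : transc iota z'.
    by apply: notconst_transc => c e; apply: (hz (c ^ d)); rewrite ez e fmorphXz.
  have [B [hB1 hB2]] := near_proximity_primitive hK hgen sH sHj H0 bez g10 g20 tz.
  exists B; split=> // T uT; apply: leq_trans (hB1 T uT) _; rewrite leq_mul2l.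
  apply/orP; right; rewrite ez; apply: psum_le => T' uT'.
  apply: leq_trans (sum_poles_le hK (z' ^ d) uT'); apply: leq_sum => q _.
  by rewrite vpXz; apply: negpart_mul_le.
have [M hM] := int_bounded2 (fun a b => f (a, b)) N.
exists M => _ K iota hK gen hgen g1 g2 a b g10 g20 ha hb hab hz.
have [B [hB1 hB2]] := hf (a, b) hab K iota hK gen hgen g1 g2 g10 g20 hz.
exists B; split=> // T uT; apply: leq_trans (hB1 T uT) _.
by rewrite leq_mul2r hM ?orbT.
Qed.

Lemma sum_pairs_le (I : Type) (A B : eqType) (T : seq I) (P : pred I) (ra : seq A)
  (rb : seq B) (f : A -> B -> I -> nat) (m M : nat) :
  (forall a b, a \in ra -> b \in rb -> (m * (\sum_(q <- T | P q) f a b q) <= M)%N) ->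
  (m * (\sum_(q <- T | P q) \sum_(a <- ra) \sum_(b <- rb) f a b q) <=
   size ra * size rb * M)%N.
Proof.
move=> h; rewrite exchange_big /= -mulnA big_distrr /= -[size ra]sum1_size big_distrl /=.
rewrite big_seq [leqRHS]big_seq; apply: leq_sum => a ain.
rewrite mul1n exchange_big /= big_distrr /= -[size rb]sum1_size big_distrl /=.
rewrite big_seq [leqRHS]big_seq; apply: leq_sum => b bin; rewrite mul1n; exact: h.
Qed.

Lemma box_sum (L A ep h : nat) : (L * (A * ep + 2 * h) = L * A * ep + 2 * L * h)%N.
Proof. by rewrite mulnDr !mulnA (mulnC 2%N L). Qed.

(** With n = n' + 1, n^2 - 1 = n' (n' + 2); cancelling [n'] leaves the loss 2 h against the factor
    n' + 2. *)
Lemma cancel_box (n' N c ep h1 h2 h : nat) : (0 < n')%N -> (h1 <= h)%N -> (h2 <= h)%N ->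
  (c <= (n'.+1 * n'.+1 - 1) * (n'.+1 * n'.+1 - 1))%N ->
  ((n'.+1 * n'.+1 - 1) * N <= c * ep + n' * (h1 + h2))%N ->
  (n'.+2 * N <= n'.+2 * (n' * n'.+2) * ep + 2 * h)%N.
Proof.
move=> n0 l1 l2 lc.
have e : (n'.+1 * n'.+1 - 1 = n' * n'.+2)%N by lia.
rewrite e in lc.
rewrite e => hN; rewrite -(leq_pmul2l n0) mulnA; apply: leq_trans hN _.
rewrite [leqRHS]mulnDr; apply: leq_add; last by rewrite leq_mul2l mul2n -addnn leq_add ?orbT.
by rewrite mulnA leq_mul2r; apply/orP; right; apply: leq_trans lc _; rewrite !mulnA.
Qed.

(** [Lam], the number of pairs of nonzero roots, is fixed before the box size [n'], so the
    coefficient 2 Lam / (n' + 2) of the height can be made small afterwards. A constant [g1] or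
    [g2], or a constant monomial in the dependent case, gives the first alternative. *)
Lemma gcd_bounds (k : closedFieldType) (char0 : [pchar k] =i pred0) (F G : {poly {poly k}}) :
  nonconstant2 F -> nonconstant2 G -> coprime2 F G ->
  exists Lam n0 : nat, forall n' : nat, (n0 < n')%N -> exists C : nat,
    forall (K : fieldType) (iota : {rmorphism k -> K}), is_function_field iota ->
    forall gen, is_genus iota gen -> forall (S : seq (place iota)) (g1 g2 : K),
    in_OS S g1 -> in_OS S g2 ->
    let h := maxn (hgt iota g1) (hgt iota g2) in
    let f := eval2 iota F g1 g2 in let g := eval2 iota G g1 g2 in
    (exists m1 m2 : int, (m1 != 0 \/ m2 != 0) /\ (absz m1 + absz m2 <= 2 * n')%N /\
       exists a : k, g1 ^ m1 * g2 ^ m2 = iota a) \/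
    [/\ ~~ ((f == 0) && (g == 0)),
      forall T : seq (place iota), uniq T -> (n'.+2 * (\sum_(q <- T | q \notin S) gcd_term q f g)%N <=
         C * euler_pos gen S + 2 * Lam * h)%N &
      (F`_0)`_0 != 0 \/ (G`_0)`_0 != 0 -> forall T : seq (place iota), uniq T ->
        (n'.+2 * (\sum_(q <- T) gcd_term q f g)%N <= C * euler_pos gen S + 2 * Lam * h)%N].
Proof.
move=> hF hG hFG.
have [Cp [rs1 [rs2 [nz1 nz2 hp]]]] := gcd_pointwise hF hG hFG.
have [nF hnF] := poly2_size_bound F; have [nG hnG] := poly2_size_bound G.
pose Lam := (size rs1 * size rs2)%N.
exists Lam, (nF + nG)%N => n' hn'.
have [CF hCF] := near_proximity F n'; have [CG hCG] := near_proximity G n'.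
have n'0 : (0 < n')%N by apply: leq_ltn_trans hn'.
have [sF sFj] := hnF n' (leq_trans (leq_addr _ _) (ltnW hn')).
have [sG sGj] := hnG n' (leq_trans (leq_addl _ _) (ltnW hn')).
pose n := n'.+1; pose Q := ((n * n) * (n * n))%N.
(* [C1] serves the independent case off [S] and [n'.+2 * Q] that case on [S]; in the dependent case
   [C2] bounds the sum of minima and [C3] the proximity term. *)
pose C1 := (Lam * (n'.+2 * (n' * n'.+2)))%N.
pose C2 := (n'.+2 * (Lam * Q))%N.
pose C3 := (n'.+2 * (Cp.+1 * (CF + CG) * Q))%N.
exists (C1 + n'.+2 * Q + C2 + C3)%N => K iota hK gen hgen S g1 g2 S1 S2 h f g.
set ep := euler_pos gen S.
have g10 : g1 != 0 by case: S1.
have g20 : g2 != 0 by case: S2.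
have [[a ea]|h1] := pselect (exists a, g1 = iota a).
  left; exists 1, 0; split; [by left|split; [by rewrite absz0 addn0; lia|]].
  by exists a; rewrite expr1z expr0z mulr1.
have [[a ea]|h2] := pselect (exists a, g2 = iota a).
  left; exists 0, 1; split; [by right|split; [by rewrite absz0 add0n; lia|]].
  by exists a; rewrite expr1z expr0z mul1r.
have {}h1 c : g1 <> iota c by move=> e; apply: h1; exists c.
have {}h2 c : g2 <> iota c by move=> e; apply: h2; exists c.
have [nzfg hq] := hp K iota g1 g2 h1 h2.
rewrite -/f -/g in nzfg hq.
have [D [phi [p hD]]] := exists_global_derivation hK char0 hgen.
pose Sg (q : place iota) := (\sum_(a <- rs1) \sum_(b <- rs2) v0min q (g1 - iota a) (g2 - iota b))%N.
have offS (T : seq (place iota)) : (\sum_(q <- T | q \notin S) gcd_term q f g <= \sum_(q <- T | q \notin S) Sg q)%N.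
  apply: leq_sum => q qS; apply: leq_trans (hq q) _.
  by case: S1 S2 => _ v1 [_ v2]; rewrite v1 // v2 // muln0 add0n.
have gle (q : place iota) (H : K) : H = f \/ H = g -> H != 0 -> (gcd_term q f g <= v0 q H)%N.
  by case=> ->; [apply: gcd_term_le_l|apply: gcd_term_le_r].
have [ind|nind] := pselect (indep_on iota [set: 'I_n * 'I_n] (mono g1 g2)).
  have ha (T : seq (place iota)) : uniq T -> (n'.+2 * (\sum_(q <- T | q \notin S) gcd_term q f g) <=
      C1 * ep + 2 * Lam * h)%N.
    move=> uT; apply: (@leq_trans (n'.+2 * (\sum_(q <- T | q \notin S) Sg q))).
      by rewrite leq_mul2l offS orbT.
    apply: leq_trans (@sum_pairs_le _ _ _ T _ rs1 rs2 _ _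
      (n'.+2 * (n' * n'.+2) * ep + 2 * h) _) _; last first.
      by rewrite box_sum.
    move=> a b /nz1 a0 /nz2 b0; apply: cancel_box n'0 _ _ (bin2_le _)
      (gcd_bound_indep hK hgen hD S1 S2 n'0 a0 b0 ind uT); first exact: leq_maxl.
    exact: leq_maxr.
  right; split=> //.
    move=> T uT; apply: leq_trans (ha T uT) _; rewrite leq_add2r leq_mul2r.
    by rewrite -!addnA leq_addr orbT.
  have key (H : {poly {poly k}}) (T : seq (place iota)) : (size H <= n)%N -> (forall j, (size (H`_j)%R <= n)%N) ->
      (H`_0)`_0 != 0 -> eval2 iota H g1 g2 = f \/ eval2 iota H g1 g2 = g -> uniq T ->
      (n'.+2 * (\sum_(q <- T | q \in S) gcd_term q f g) <= n'.+2 * Q * ep)%N.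
    move=> sH sHj H0 hH uT; rewrite -mulnA leq_mul2l; apply/orP; right.
    have [Hne hS] := proximity_bound hK hgen hD S1 S2 sH sHj H0 ind uT.
    apply: (@leq_trans (\sum_(q <- T | q \in S) v0 q (eval2 iota H g1 g2))).
      by apply: leq_sum => q _; apply: gle.
    by apply: leq_trans hS _; rewrite leq_mul2r bin2_le orbT.
  move=> h00 T uT; rewrite (bigID (mem S)) /= mulnDr.
  have {key}hS : (n'.+2 * (\sum_(q <- T | q \in S) gcd_term q f g) <= n'.+2 * Q * ep)%N.
    by case: h00 => h00; [apply: (key F) => //; left|apply: (key G) => //; right].
  apply: leq_trans (leq_add hS (ha T uT)) _; rewrite addnA leq_add2r -mulnDl leq_mul2r.
  by rewrite (addnC C1) -(addnA _ C2) leq_addr orbT.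
have [a [b [ab0 ha hb hz]]] := near_dependence hK hgen hD S1 S2 nind.
have [[c ec]|hc] := pselect (exists c, g1 ^ a * g2 ^ b = iota c).
  left; exists a, b; split; first by case/orP: ab0; [left|right].
  by split; [rewrite mul2n -addnn leq_add|exists c].
have {}hc c : g1 ^ a * g2 ^ b <> iota c by move=> e; apply: hc; exists c.
have sumSg (T : seq (place iota)) : uniq T -> (\sum_(q <- T) Sg q <= Lam * Q * ep)%N.
  move=> uT; rewrite -(mulnA Lam) -[leqLHS]mul1n.
  apply: leq_trans (@sum_pairs_le _ _ _ T _ rs1 rs2 _ _ (Q * ep) _) _; last by [].
  move=> c d /nz1 c0 /nz2 d0; rewrite mul1n; apply: leq_trans hz.
  exact: (sum_v0min_near hK hgen c0 d0 hc uT).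
right; split=> //.
  move=> T uT; apply: (@leq_trans (C2 * ep)).
    rewrite /C2 -(mulnA _ _ ep) leq_mul2l; apply/orP; right; apply: leq_trans (offS T) _.
    by apply: leq_trans _ (sumSg T uT); rewrite [leqRHS](bigID (mem S)) /= leq_addl.
  apply: leq_trans _ (leq_addr _ _); rewrite leq_mul2r; apply/orP; right.
  by rewrite -addnA addnCA leq_addr.
have key (H : {poly {poly k}}) (CH : nat) (T : seq (place iota)) : (CH <= CF + CG)%N -> (H`_0)`_0 != 0 ->
    eval2 iota H g1 g2 = f \/ eval2 iota H g1 g2 = g ->
    proximity_control iota H g1 g2 CH (g1 ^ a * g2 ^ b) -> uniq T ->
    (\sum_(q <- T) gcd_term q f g <= (Cp.+1 * (CF + CG) * Q + Lam * Q) * ep)%N.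
  move=> hCH H0 hH [B [hB1 hB2]] uT.
  apply: (@leq_trans (\sum_(q <- T) (Cp.+1 * B q + Sg q))%N).
    apply: leq_sum => q _; case: (hB2 q) => [[Hne hv]|hv].
      apply: leq_trans (gle q _ hH Hne) _; apply: leq_trans hv _.
      by apply: leq_trans (leq_addr _ _); rewrite leq_pmull.
    apply: leq_trans (hq q) _; rewrite leq_add2r; apply: leq_mul => //.
  rewrite big_split /= mulnDl; apply: leq_add (sumSg T uT).
  rewrite -big_distrr /= -(mulnA _ Q) -(mulnA _ _ (Q * ep)%N) leq_mul2l.
  apply/orP; right; apply: leq_trans (hB1 T uT) _.
  by apply: leq_mul.
move=> h00 T uT; apply: (@leq_trans ((C3 + C2) * ep)); last first.
  apply: leq_trans _ (leq_addr _ _); rewrite leq_mul2r; apply/orP; right.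
  by rewrite (addnC C3) -(addnA _ C2) leq_addl.
rewrite /C3 /C2 -mulnDr -(mulnA _ _ ep) leq_mul2l; apply/orP; right.
case: h00 => h00.
  by apply: (key F CF) => //; [exact: leq_addr|left|exact: (hCF h00 K iota hK gen hgen g1 g2 a b)].
by apply: (key G CG) => //; [exact: leq_addl|right|exact: (hCG h00 K iota hK gen hgen g1 g2 a b)].
Qed.

Lemma euler_pos_real (R : realType) (k : closedFieldType) (K : fieldType)
  (iota : {rmorphism k -> K}) (gen : nat) (S : seq (place iota)) :
  Num.max 1 (((2 * gen)%:Z - 2 + (size (undup S))%:Z)%:~R) = (euler_pos gen S)%:R :> R.
Proof.
rewrite euler_charE /euler_pos; set e := euler_char gen S.
have [h|h] := leP 1 e.
  by rewrite max_r ?ler1z // -[in LHS](gez0_abs (le_trans ler01 h)).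
by rewrite max_l // lerz1 ltW.
Qed.

(** Each of the two terms takes half of (n' + 2) eps h; hence the factors 4 and 2 in the
    hypotheses. *)
Lemma eps_absorb (R : realType) (n' C Lam X ep h : nat) (eps : R) : 0 < eps ->
  4 * Lam%:R <= n'.+2%:R * eps -> 2 * C%:R * ep%:R <= n'.+2%:R * eps * h%:R ->
  (n'.+2 * X <= C * ep + 2 * Lam * h)%N -> X%:R <= eps * h%:R.
Proof.
move=> e0 h1 h2; rewrite -(ler_nat R) natrD !natrM => hX.
have n0 : 0 < n'.+2%:R :> R by rewrite ltr0n.
have hh : 0 <= h%:R :> R by rewrite ler0n.
rewrite -(ler_pM2l n0); apply: le_trans hX _.
have := ler_wpM2r hh h1.
move: h2; rewrite -mulrA; move: (C%:R * ep%:R) (Lam%:R) (n'.+2%:R) (h%:R) => u l n v.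
rewrite -[n * eps * v]mulrA.
move: (n * (eps * v)) => w; rewrite -[4 * l * v]mulrA -[2 * l * v]mulrA.
by move: (l * v) => lv; lra.
Qed.

Theorem theorem1p5 (k : closedFieldType) (char0 : [pchar k] =i pred0)
  (F G : {poly {poly k}}) (hF : nonconstant2 F) (hG : nonconstant2 G)
  (hFG : coprime2 F G) (R : realType) (eps : R) (heps : 0 < eps) :
  exists (m : nat) (c : R),
    forall (K : fieldType) (iota : {rmorphism k -> K}),
      is_function_field iota ->
      forall (gen : nat), is_genus iota gen ->
      forall (S : seq (place iota)) (g1 g2 : K),
        in_OS S g1 -> in_OS S g2 ->
        c * Num.max 1 (((2 * gen)%:Z - 2 + (size (undup S))%:Z)%:~R)
          <= (maxn (hgt iota g1) (hgt iota g2))%:R ->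
        (exists m1 m2 : int, (m1 != 0 \/ m2 != 0) /\
            (`|m1| + `|m2| <= 2 * m)%N /\
            exists a : k, g1 ^ m1 * g2 ^ m2 = iota a)
        \/
        (NSgcd_le S (eval2 iota F g1 g2) (eval2 iota G g1 g2)
           (eps * (maxn (hgt iota g1) (hgt iota g2))%:R) /\
         (~ (eval2k F 0 0 = 0 /\ eval2k G 0 0 = 0) ->
          hgcd_le iota (eval2 iota F g1 g2) (eval2 iota G g1 g2)
           (eps * (maxn (hgt iota g1) (hgt iota g2))%:R))).
Proof.
have [Lam [n0 bnd]] := gcd_bounds char0 hF hG hFG.
(* Chosen so that (n' + 2) eps >= 4 Lam, while [n0] keeps the box larger than the degrees of [F] and
   [G]. *)
pose n' := (n0 + Num.bound (4 * Lam%:R / eps)).+1.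
have [C hC] := bnd n' (leq_addr _ _).
have hn' : 4 * Lam%:R <= n'.+2%:R * eps.
  rewrite -ler_pdivrMr //; apply: le_trans (ltW (archi_boundP _)) _.
    by rewrite divr_ge0 ?mulr_ge0 // ltW.
  by rewrite ler_nat; do 3!apply: leqW; apply: leq_addl.
(* With this [c] the height condition gives 2 C max(1, 2g - 2 + |S|) <= eps h, and a fortiori the
   bound with the factor n' + 2. *)
exists n', (2 * C%:R / eps) => K iota hK gen hgen S g1 g2 S1 S2.
rewrite euler_pos_real; set h := maxn _ _ => hh.
have {}hh : 2 * C%:R * (euler_pos gen S)%:R <= n'.+2%:R * eps * h%:R.
  move: hh; rewrite mulrAC ler_pdivrMr // => hh; apply: le_trans hh _.
  rewrite mulrC -mulrA ler_peMl ?mulr_ge0 ?ler0n ?ler1n //; exact: ltW.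
have [|[nz ha hb]] := hC K iota hK gen hgen S g1 g2 S1 S2; first by left.
right; split.
  split=> //; apply: (eps_absorb heps hn' hh); apply: psum_mul_le => T uT.
  rewrite (eq_bigr (fun q : place iota => if q \notin S then
    gcd_term q (eval2 iota F g1 g2) (eval2 iota G g1 g2) else 0%N)); last first.
    by move=> q _; case: ifP.
  by rewrite -big_mkcond; apply: ha.
move=> h00; split=> //; apply: (eps_absorb heps hn' hh); apply: psum_mul_le; apply: hb.
move/not_andP: h00; rewrite /eval2k !horner_coef0.
by case=> /eqP; [left|right].
Qed.
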